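(* Let $n\ge1$, $\sigma\in[0,2)$ and $s\ge 0$. Assume $(|D|^2u_0,u_1,\theta_0)\in L^2(\mathbb{R}^n)\times L^2(\mathbb{R}^n)\times L^2(\mathbb{R}^n)$. Then the solution to the Cauchy problem (P) satisfies $$\left(|D|^{s+2}u,\;|D|^su_t,\;|D|^s\theta\right)(t,\cdot)\in\Gamma^{\kappa}(\mathbb{R}^n)\times\Gamma^{\kappa}(\mathbb{R}^n)\times\Gamma^{\kappa}(\mathbb{R}^n)\qquad\text{for any } t>0,$$ where $\kappa=1$ when $\sigma\in\left[0,\frac32\right]$, and $\kappa=\frac{1}{4-2\sigma}$ when $\sigma\in\left(\frac32,2\right)$.
   Context: Cauchy problem (P): for unknown functions $u=u(t,x)$, $\theta=\theta(t,x)$, $$u_{tt}+\Delta^2u+\Delta\theta+(-\Delta)^{\sigma}u_t=0,\qquad \theta_t-\Delta\theta-\Delta u_t=0,\qquad t>0,\ x\in\mathbb{R}^n,$$ with $(u,u_t,\theta)(0,x)=(u_0,u_1,\theta_0)(x)$. $|D|^s$ is the pseudo-differential operator with symbol $|\xi|^s$, $(-\Delta)^\sigma$ has symbol $|\xi|^{2\sigma}$, and $\langle\xi\rangle=(1+|\xi|^2)^{1/2}$. The partial Fourier transform $w^{(0)}(t,\xi)$ in $x$ of $(u_t+|D|^2u,u_t-|D|^2u,\theta)^{\mathrm T}$ solves $w^{(0)}_t+(|\xi|^2A_0+|\xi|^{2\sigma}A_1)w^{(0)}=0$ with initial value $(\hat u_1+|\xi|^2\hat u_0,\hat u_1-|\xi|^2\hat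 u_0,\hat\theta_0)^{\mathrm T}$, where $$A_0=\tfrac12\begin{pmatrix}0&-2&-2\\2&0&-2\\1&1&2\end{pmatrix},\qquad A_1=\tfrac12\begin{pmatrix}1&1&0\\1&1&0\\0&0&0\end{pmatrix}.$$ Gevrey spaces: for $\kappa\in[1,\infty)$, $$\Gamma^\kappa(\mathbb{R}^n):=\left\{f\in L^2(\mathbb{R}^n):\ \text{there exists a constant } c>0 \text{ such that } \exp\left(c\langle\xi\rangle^{1/\kappa}\right)\hat f\in L^2(\mathbb{R}^n)\right\}.$$ *)

(* Defs.v *)
From HB Require Import structures.
From mathcomp Require Import all_boot all_order all_algebra.
From mathcomp Require Import all_classical all_reals all_analysis.
From mathcomp Require Import complex.

Set Implicit Arguments.
Unset Strict Implicit.
Unset Printing Implicit Defensive.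

Import Order.TTheory GRing.Theory Num.Theory.
Import numFieldNormedType.Exports.
Import Normc.

Local Open Scope classical_set_scope.
Local Open Scope ring_scope.
Local Open Scope complex_scope.

Section product_of_tuples.
Local Open Scope ereal_scope.
Context d (T : measurableType d) (R : realType).
Variable m1 : {sigma_finite_measure set T -> \bar R}.

Definition cons_tuple n (p : T * n.-tuple T) : n.+1.-tuple T :=
  [tuple of p.1 :: p.2].

Lemma measurable_cons_tuple n : measurable_fun setT (@cons_tuple n).
Proof. exact: measurable_cons. Qed.

Section step.
Variables (n : nat) (m : {sigma_finite_measure set (n.-tuple T) -> \bar R}).

Definition cons_measure : set (n.+1.-tuple T) -> \bar R :=
  pushforward (m1 \x m) (@cons_tuple n).

Let cons_measure0 : cons_measure set0 = 0.
Proof. by rewrite /cons_measure /pushforward preimage_set0 measure0. Qed.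

Let cons_measure_ge0 A : 0 <= cons_measure A.
Proof. by rewrite /cons_measure /pushforward measure_ge0. Qed.

Let cons_measure_sigma_additive : semi_sigma_additive cons_measure.
Proof.
move=> F mF tF mUF; rewrite /cons_measure /pushforward preimage_bigcup.
have mc := @measurable_cons_tuple n.
apply: measure_semi_sigma_additive.
- by move=> k; rewrite -[X in measurable X]setTI; exact: mc.
- apply/trivIsetP => /= i j _ _ ij; rewrite -preimage_setI.
  by move/trivIsetP : tF => /(_ _ _ _ _ ij) ->//; rewrite preimage_set0.
- by rewrite -preimage_bigcup -[X in measurable X]setTI; exact: mc.
Qed.

HB.instance Definition _ := isMeasure.Build _ _ _ cons_measure
  cons_measure0 cons_measure_ge0 cons_measure_sigma_additive.

Let cons_measure_sigma_finite : sigma_finite setT cons_measure.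
Proof.
have [F FT Foo] : sigma_finite setT (m1 \x m).
  have /sigma_finiteP[F [TF ndF Foo]] := sigma_finiteT m1.
  have /sigma_finiteP[G [TG ndG Goo]] := sigma_finiteT m.
  exists (fun k => F k `*` G k).
    rewrite -setXTT TF TG predeqE => -[x y]; split.
      move=> [/= [i _ Fix] [k _ Gky]]; exists (maxn i k) => //; split.
      - by move: x Fix; exact/subsetPset/ndF/leq_maxl.
      - by move: y Gky; exact/subsetPset/ndG/leq_maxr.
    by move=> [i _ []/= ? ?]; split; exists i.
  move=> k; have [? ?] := Foo k; have [? ?] := Goo k.
  split; first exact: measurableX.
  by rewrite product_measure1E// lte_mul_pinfty// ge0_fin_numE.
pose uncons (t : n.+1.-tuple T) : T * n.-tuple T :=
  (thead t, [tuple of behead t]).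
have unconsK : cancel (@cons_tuple n) uncons.
  move=> [x t]; rewrite /uncons /cons_tuple theadE; congr pair.
  exact: val_inj.
exists (fun k => uncons @^-1` F k).
  by rewrite -preimage_bigcup -FT preimage_setT.
move=> k; have [mF Fk] := Foo k; split.
  rewrite -[X in measurable X]setTI.
  have mu : measurable_fun setT uncons.
    apply/measurable_fun_pairP; split => /=.
      exact: measurable_tnth.
    exact: measurable_behead.
  exact: mu.
rewrite /cons_measure /pushforward -comp_preimage.
rewrite (_ : uncons \o @cons_tuple n = id) ?preimage_id//.
by apply/funext => p; exact: unconsK.
Qed.

HB.instance Definition _ := Measure_isSigmaFinite.Build _ _ _ cons_measure
  cons_measure_sigma_finite.
End step.

(* The n-fold product of m1. *)
Fixpoint tuple_measure n : {sigma_finite_measure set (n.-tuple T) -> \bar R} :=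
  match n with
  | 0%N => \d_([tuple] : 0.-tuple T)
  | k.+1 => cons_measure (tuple_measure k)
  end.

End product_of_tuples.

(* R^n, with the product of the Borel sigma-algebras. *)
Notation Rn R n := (n.-tuple (measurableTypeR R)).

Section euclidean_space.
Context (R : realType) (n : nat).
Local Notation E := (Rn R n).

Definition lebesgue_Rn : {sigma_finite_measure set E -> \bar R} :=
  tuple_measure (@lebesgue_measure R) n.

Definition dot (x y : E) : R := \sum_(i < n) (tnth x i : R) * (tnth y i : R).
Definition enorm (x : E) : R := Num.sqrt (dot x x).
Definition japanese (x : E) : R := Num.sqrt (1 + enorm x ^+ 2).

Definition cmeasurable (f : E -> R[i]) : Prop :=
  measurable_fun [set: E] (fun x => complex.Re (f x)) /\
  measurable_fun [set: E] (fun x => complex.Im (f x)).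

Definition cintegrable (f : E -> R[i]) : Prop :=
  lebesgue_Rn.-integrable [set: E] (fun x => (complex.Re (f x))%:E) /\
  lebesgue_Rn.-integrable [set: E] (fun x => (complex.Im (f x))%:E).

Definition cintegral (f : E -> R[i]) : R[i] :=
  Rintegral lebesgue_Rn [set: E] (fun x => complex.Re (f x)) +i*
  Rintegral lebesgue_Rn [set: E] (fun x => complex.Im (f x)).

Definition L2 (f : E -> R[i]) : Prop :=
  (fun x => complex.Re (f x)) \in Lfun lebesgue_Rn 2%:E /\
  (fun x => complex.Im (f x)) \in Lfun lebesgue_Rn 2%:E.

Definition L2norm (f : E -> R[i]) : \bar R :=
  Lnorm lebesgue_Rn 2%:E (fun x => (normc (f x))%:E).

Definition shift_coord (x : E) (i : 'I_n) (h : R) : E :=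
  [tuple (tnth x j : R) + (if j == i then h else 0) | j < n].

Definition partial (i : 'I_n) (f : E -> R[i]) : E -> R[i] := fun x =>
  derive1 (fun h : R => complex.Re (f (shift_coord x i h))) 0 +i*
  derive1 (fun h : R => complex.Im (f (shift_coord x i h))) 0.

Definition has_partial (i : 'I_n) (f : E -> R[i]) (x : E) : Prop :=
  derivable (fun h : R => complex.Re (f (shift_coord x i h))) 0 1 /\
  derivable (fun h : R => complex.Im (f (shift_coord x i h))) 0 1.

Definition partials (a : seq 'I_n) (f : E -> R[i]) : E -> R[i] :=
  foldr partial f a.

Definition laplacian (f : E -> R[i]) : E -> R[i] := fun x =>
  \sum_(i < n) partial i (partial i f) x.

(* All iterated partial derivatives exist and are bounded; this forces each of
   them to be Lipschitz, so f is C^oo in the usual sense. *)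
Definition schwartz (f : E -> R[i]) : Prop :=
  (forall a i x, has_partial i (partials a f) x) /\
  (forall a k, exists M : R, forall x,
      (1 + enorm x) ^+ k * normc (partials a f x) <= M).

Definition schwartz_norm (N : nat) (f : E -> R[i]) : R :=
  sup [set r | exists (a : seq 'I_n) (x : E), (size a <= N)%N /\
                 r = (1 + enorm x) ^+ N * normc (partials a f x)].

(* The non-unitary convention, for which - Delta has symbol |xi|^2. *)
Definition fourier (f : E -> R[i]) : E -> R[i] := fun xi =>
  cintegral (fun x => f x * (cos (dot x xi) -i* sin (dot x xi))).

(* Functionals on functions; only their values on Schwartz functions matter,
   and equality of distributions is equality there. *)
Definition distribution_Rn : Type := (E -> R[i]) -> R[i].

Definition dist_eq (T U : distribution_Rn) : Prop :=
  forall f, schwartz f -> T f = U f.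

Definition tempered (T : distribution_Rn) : Prop :=
  (forall (a : R[i]) f g, schwartz f -> schwartz g ->
      T (fun x => a * f x + g x) = a * T f + T g) /\
  (exists (N : nat) (C : R), forall f, schwartz f ->
      normc (T f) <= C * schwartz_norm N f).

Definition tempered_fun (h : E -> R[i]) : Prop :=
  cmeasurable h /\ forall f, schwartz f -> cintegrable (fun x => h x * f x).

Definition dist_of (h : E -> R[i]) : distribution_Rn :=
  fun f => cintegral (fun x => h x * f x).

Definition dist_fourier (T : distribution_Rn) : distribution_Rn :=
  fun f => T (fourier f).

Definition dist_laplacian (T : distribution_Rn) : distribution_Rn :=
  fun f => T (laplacian f).

(* |D|^2 = - Delta is defined on every tempered distribution. The distribution
   |D|^(s+2) u is rendered as |D|^s (|D|^2 u): when |D|^2 u is in L^2, the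
   Fourier transform of u itself need not be a function near the origin. *)
Definition dist_absD2 (T : distribution_Rn) : distribution_Rn :=
  fun f => - dist_laplacian T f.

Definition is_fourier (T : distribution_Rn) (h : E -> R[i]) : Prop :=
  tempered_fun h /\ dist_eq (dist_fourier T) (dist_of h).

(* U = |D|^s T; |D|^s acts on distributions whose Fourier transform is a
   function. *)
Definition is_absD (s : R) (T U : distribution_Rn) : Prop :=
  exists h, is_fourier T h /\
            is_fourier U (fun xi => (enorm xi `^ s)%:C * h xi).

Definition in_L2 (T : distribution_Rn) : Prop :=
  exists f, L2 f /\ dist_eq T (dist_of f).

Definition gevrey (kappa : R) (f : E -> R[i]) : Prop :=
  L2 f /\
  exists2 c : R, 0 < c & exists h, [/\ L2 h, is_fourier (dist_of f) h &
    L2 (fun xi => (expR (c * japanese xi `^ kappa^-1))%:C * h xi)].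

Definition absD_in_gevrey (s kappa : R) (T : distribution_Rn) : Prop :=
  exists g, gevrey kappa g /\ is_absD s T (dist_of g).

(* T belongs to C([0, oo); L^2). *)
Definition continuous_L2 (T : R -> distribution_Rn) : Prop :=
  exists f : R -> E -> R[i],
    (forall t, 0 <= t -> L2 (f t) /\ dist_eq (T t) (dist_of (f t))) /\
    (forall t0, 0 <= t0 ->
       L2norm (fun x => f t x - f t0 x)
         @[t --> within [set t | 0 <= t] (nbhs t0)] --> (0 : \bar R)).

(* T belongs to C([0, oo); S'). *)
Definition continuous_dist (T : R -> distribution_Rn) : Prop :=
  forall f, schwartz f ->
    {within `[0, +oo[, continuous (fun t => complex.Re (T t f))} /\
    {within `[0, +oo[, continuous (fun t => complex.Im (T t f))}.

Definition is_time_derivative (T T' : R -> distribution_Rn) : Prop :=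
  forall f, schwartz f -> forall t : R, 0 < t ->
    is_derive t 1 (fun r => complex.Re (T r f)) (complex.Re (T' t f)) /\
    is_derive t 1 (fun r => complex.Im (T r f)) (complex.Im (T' t f)).

(* Solutions in the energy class: |D|^2 u, u_t and theta are in
   C([0, oo); L^2), and the equations hold in S' for every t > 0. *)
Record cauchy_solution (sigma : R) (u0 : distribution_Rn) (u1 theta0 : E -> R[i])
    (u ut theta : R -> distribution_Rn) : Prop := {
  sol_tempered : forall t, 0 <= t -> tempered (u t) ;
  sol_continuous : continuous_dist u ;
  sol_absD2u : continuous_L2 (fun t => dist_absD2 (u t)) ;
  sol_ut : continuous_L2 ut ;
  sol_theta : continuous_L2 theta ;
  sol_ut_derivative : is_time_derivative u ut ;
  sol_plate_eq : exists utt damping : R -> distribution_Rn,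
    [/\ is_time_derivative ut utt,
        forall t, 0 < t -> is_absD (2 * sigma) (ut t) (damping t) &
        forall t, 0 < t -> forall f, schwartz f ->
          utt t f + dist_laplacian (dist_laplacian (u t)) f
          + dist_laplacian (theta t) f + damping t f = 0] ;
  sol_heat_eq : exists thetat : R -> distribution_Rn,
    is_time_derivative theta thetat /\
    forall t, 0 < t -> forall f, schwartz f ->
      thetat t f - dist_laplacian (theta t) f - dist_laplacian (ut t) f = 0 ;
  sol_u0 : dist_eq (u 0) u0 ;
  sol_u1 : dist_eq (ut 0) (dist_of u1) ;
  sol_theta0 : dist_eq (theta 0) (dist_of theta0) }.

End euclidean_space.

Definition gevrey_index (R : realType) (sigma : R) : R :=
  if sigma <= 3 / 2 then 1 else (4 - 2 * sigma)^-1.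

(* Main.v *)
(** With p = |xi|^2 and d = |xi|^(2 sigma), the Fourier transforms (V, W, H) of (|D|^2 u, u_t, theta)
    solve V' = p W, W' = - p V + p H - d W, H' = - p H - p W at each frequency. Adding small cross
    terms V W and H W to V^2 + W^2 + H^2 gives a form that decays at a rate of order p when d <= p,
    and of order p^2 / d when d >= p (the coefficient of V W must then be of order p / d). For
    |xi| >= 1 both rates dominate |xi|^tau with tau = min(1, 4 - 2 sigma) = 1 / kappa, so that the
    solution at time t > 0 carries a factor exp(- c t |xi|^tau), which absorbs |xi|^s and the Gevrey
    weight.

    The equations hold only in S', so the system is known only after testing against Schwartz
    functions. Testing against (1 + |xi|^2)^2 psi and using duality in L^2 shows that t |-> (V, W, H),
    cut off to a set B of bounded frequencies, is differentiable in L^2. The energy estimate thus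
    holds integrated over B; applying it to all B on which the rate is at least j, for each natural
    number j, gives the decay for almost every xi. *)

Require Import Defs.
From mathcomp Require Import all_boot all_order all_algebra.
From mathcomp Require Import all_classical all_reals all_analysis.
From mathcomp Require Import measurable_realfun complex.
From mathcomp Require Import ring lra.

Set Implicit Arguments.
Unset Strict Implicit.
Unset Printing Implicit Defensive.

Import Order.TTheory GRing.Theory Num.Theory.
Import numFieldNormedType.Exports.
Import Normc.

Local Open Scope classical_set_scope.
Local Open Scope ring_scope.
Local Open Scope complex_scope.

(** * Integration on R^n *)

Section integration_on_Rn.
Context {R : realType}.
Notation leb := (@lebesgue_measure R).
Notation mu n := (lebesgue_Rn R n).

(** The multiplier |xi|^(2 sigma) need not be smooth at the origin, so it does not act on Schwartz
    functions, and the time derivative of W need not be in L^2. The weight (1 + |xi|^2)^2 answers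
    both: it preserves Schwartz functions and, since sigma < 2, it dominates |xi|^2 and |xi|^(2
    sigma), so that the right-hand sides divided by it are continuous in time with values in L^2.
    For each test function the mean value theorem gives an intermediate time that depends on the
    test function; that continuity makes the error uniform, and duality turns it into a bound in
    norm. The coefficients of the system are real, so real and imaginary parts solve it separately
    and the energy method is run on real functions. For |xi| <= 1 no decay is claimed: the rate is
    lowered by 1, which costs a factor exp(t), and rounding the rate down to an integer j costs
    another; both are harmless at a fixed t. The differential inequality is available for t > 0 only
    and reaches t = 0 by continuity. *)

Lemma ge0_integral_shift (h : R) (f : measurableTypeR R -> \bar R) :
  measurable_fun setT f -> (forall x, 0 <= f x)%E ->
  (\int[leb]_x f (x + h)%R = \int[leb]_x f x)%E.
Proof.
move=> mf f0.
have ms : measurable_fun setT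
    (fun x : measurableTypeR R => x + h : measurableTypeR R).
  by apply: measurable_funD => //; exact: measurable_cst.
(* Lebesgue measure is determined by its values on half-open intervals, and a shift moves both
   endpoints by the same amount. *)
have mE : forall A, measurable A ->
    leb A = pushforward leb (fun x => x + h : measurableTypeR R) A.
  apply: (@lebesgue_measure_unique R
    (pushforward leb (fun x => x + h : measurableTypeR R))) => _ [[a b] _ <-] /=.
  rewrite /pushforward.
  have -> : (fun x => x + h) @^-1` `]a, b] = `]a - h, b - h]%classic.
    apply/seteqP; split=> x /=; rewrite !in_itv /= => /andP[? ?]; apply/andP; split; lra.
  rewrite !lebesgue_measure_itv /= !lte_fin ltrD2r.
  by case: ifP => // _; rewrite -!EFinB; congr EFin; lra.
rewrite [RHS](eq_measure_integral (pushforward leb (fun x => x + h : measurableTypeR R))); last first.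
  by move=> A mA _; exact: mE.
by rewrite (@ge0_integral_pushforward _ _ _ _ _ _ ms).
Qed.

Lemma ge0_integral_RnS n (f : Rn R n.+1 -> \bar R) :
  measurable_fun setT f -> (forall x, 0 <= f x)%E ->
  (\int[mu n.+1]_x f x = \int[leb]_a \int[mu n]_y f (Defs.cons_tuple (a, y)))%E.
Proof.
move=> mf f0.
have mc := @measurable_cons_tuple _ (measurableTypeR R) n.
rewrite /lebesgue_Rn /= ge0_integral_pushforward//.
rewrite preimage_setT (@fubini_tonelli1 _ _ _ _ _ leb (mu n)) //.
- exact: measurableT_comp mf mc.
- by move=> x /=; exact: f0.
Qed.

Lemma measurable_RnS_section n (f : Rn R n.+1 -> \bar R) :
  measurable_fun setT f -> (forall x, 0 <= f x)%E ->
  measurable_fun setT (fun a : measurableTypeR R => \int[mu n]_y f (Defs.cons_tuple (a, y)))%E.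
Proof.
move=> mf f0.
have mc := @measurable_cons_tuple _ (measurableTypeR R) n.
apply: (@measurable_fun_fubini_tonelli_F _ _ _ _ _ (mu n) (f \o @Defs.cons_tuple _ _ n)).
  exact: measurableT_comp mf mc.
by move=> x /=; exact: f0.
Qed.

Lemma integral_Rn0 (f : Rn R 0 -> \bar R) : (\int[mu 0]_x f x = f [tuple])%E.
Proof.
rewrite /lebesgue_Rn /= integral_dirac //=; first by rewrite diracT mul1e.
move=> _ B mB; rewrite setTI.
(* R^0 is a single point, so a preimage is everything or empty. *)
have [fB|fB] := pselect (B (f [tuple])).
  have -> : f @^-1` B = setT.
    by apply/seteqP; split => // x _ /=; rewrite tuple0.
  exact: measurableT.
have -> : f @^-1` B = set0.
  by apply/seteqP; split => // x /=; rewrite tuple0.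
exact: measurable0.
Qed.

Lemma measurable_coord n (i : 'I_n) :
  measurable_fun [set: Rn R n] (fun x => tnth x i : R).
Proof. exact: (@measurable_tnth _ (measurableTypeR R) n i). Qed.

Lemma measurable_prod_coord n (f : 'I_n -> R -> R) :
  (forall i, measurable_fun setT (f i : measurableTypeR R -> R)) ->
  measurable_fun [set: Rn R n] (fun x => \prod_(i < n) f i (tnth x i)).
Proof.
move=> mf; apply: measurable_prod => i _.
exact: measurableT_comp (mf i) (measurable_coord i).
Qed.

(** Tonelli, one coordinate at a time. It serves both the integrable majorant [decay] and the
    shifted Gaussians. *)
Lemma integral_prod n (f : 'I_n -> R -> R) (c : 'I_n -> R) :
  (forall i, measurable_fun setT (f i : measurableTypeR R -> R)) ->
  (forall i x, 0 <= f i x) ->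
  (forall i, \int[leb]_x (f i x)%:E = (c i)%:E)%E ->
  (\int[mu n]_x (\prod_(i < n) f i (tnth x i))%:E = (\prod_(i < n) c i)%:E)%E.
Proof.
elim: n f c => [|n IH] f c mf f0 fc.
  by rewrite integral_Rn0 !big_ord0.
have mp := measurable_prod_coord mf.
rewrite ge0_integral_RnS; last 2 first.
- exact/measurable_EFinP.
- by move=> x; rewrite lee_fin prodr_ge0.
have E1 a : (\int[mu n]_y (\prod_(i < n.+1) f i (tnth (Defs.cons_tuple (a, y)) i))%:E =
    (\prod_(i < n) c (lift ord0 i))%:E * (f ord0 a)%:E)%E.
  under eq_integral => y _.
    rewrite big_ord_recl EFinM.
    have -> : tnth (Defs.cons_tuple (a, y)) ord0 = a by rewrite (tnth_nth a).
    under eq_bigr => i _.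
      have -> : tnth (Defs.cons_tuple (a, y)) (lift ord0 i) = tnth y i by rewrite tnthS.
    over.
    over.
  rewrite ge0_integralZl //; last 3 first.
  - by apply/measurable_EFinP; apply: (@measurable_prod_coord n (fun i => f (lift ord0 i))) => i; exact: mf.
  - by move=> x _; rewrite lee_fin prodr_ge0.
  - by rewrite lee_fin.
  rewrite (IH (fun i => f (lift ord0 i)) (fun i => c (lift ord0 i))) //.
  by rewrite muleC.
under eq_integral do rewrite E1.
rewrite ge0_integralZl //; last 3 first.
- by apply/measurable_EFinP; exact: mf.
- by move=> x _; rewrite lee_fin.
- rewrite lee_fin prodr_ge0 // => i _.
  by rewrite -lee_fin -fc integral_ge0 // => x _; rewrite lee_fin.
by rewrite fc -EFinM big_ord_recl mulrC.
Qed.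

Lemma tnth_shift n (x : Rn R n) i h j :
  tnth (shift_coord x i h) j = tnth x j + (if j == i then h else 0).
Proof. by rewrite /shift_coord tnth_mktuple. Qed.

Lemma measurable_shift_coord n (i : 'I_n) (h : R) :
  measurable_fun [set: Rn R n] (fun x => shift_coord x i h : Rn R n).
Proof.
apply/measurable_fun_tnthP => j.
rewrite (_ : _ \o _ = fun x : Rn R n => (tnth x j : R) + (if j == i then h else 0)); last first.
  by apply/funext => x /=; rewrite tnth_shift.
by apply: measurable_funD; [exact: measurable_coord|exact: measurable_cst].
Qed.

Lemma ge0_integral_shift_coord n (i : 'I_n) (h : R) (f : Rn R n -> \bar R) :
  measurable_fun setT f -> (forall x, 0 <= f x)%E ->
  (\int[mu n]_x f (shift_coord x i h) = \int[mu n]_x f x)%E.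
Proof.
elim: n i f => [[]//|n IH] i f mf f0.
have mfs : measurable_fun setT (fun x : Rn R n.+1 => f (shift_coord x i h)).
  exact: measurableT_comp mf (measurable_shift_coord i h).
rewrite ge0_integral_RnS // ge0_integral_RnS //.
have mc := @measurable_cons_tuple _ (measurableTypeR R) n.
have [i0|[j ij]] : i = ord0 \/ exists j, i = lift ord0 j.
  by case: (unliftP ord0 i) => [j ->|->]; [right; exists j|left].
- subst i.
  rewrite -[RHS](@ge0_integral_shift h); last 2 first.
  + exact: measurable_RnS_section.
  + by move=> a; apply: integral_ge0.
  apply: eq_integral => a _; apply: eq_integral => y _; congr f.
  apply: eq_from_tnth => k; rewrite tnth_shift.
  case: (unliftP ord0 k) => [k' ->|->]; first by rewrite !tnthS addr0.
  by rewrite !(tnth_nth 0) /=.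
- apply: eq_integral => a _.
  rewrite -[RHS](IH j (fun y => f (Defs.cons_tuple (a, y)))); last 2 first.
  + apply: measurableT_comp mf _; apply: measurableT_comp mc _.
    exact: measurable_pair1.
  + by [].
  apply: eq_integral => y _; congr f; apply: eq_from_tnth => k.
  rewrite tnth_shift ij.
  case: (unliftP ord0 k) => [k' ->|->].
    by rewrite !tnthS tnth_shift (inj_eq (@lift_inj _ _)).
  by rewrite !(tnth_nth 0) /= addr0.
Qed.

(** Differentiating this invariance in h is how the integral of a partial derivative is shown to
    vanish. *)
Lemma integral_shift_coord n (i : 'I_n) (h : R) (f : Rn R n -> \bar R) :
  measurable_fun setT f ->
  (\int[mu n]_x f (shift_coord x i h) = \int[mu n]_x f x)%E.
Proof.
move=> mf; rewrite integralE [RHS]integralE.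
have H1 := @ge0_integral_shift_coord _ i h f^\+%E (measurable_funepos mf) (funepos_ge0 f).
have H2 := @ge0_integral_shift_coord _ i h f^\-%E (measurable_funeneg mf) (funeneg_ge0 f).
by rewrite -H1 -H2; congr (_ - _)%E; apply: eq_integral => x _; by rewrite ?funeposE ?funenegE.
Qed.

End integration_on_Rn.

(** * Partial derivatives of complex-valued functions *)

Section complex_parts.
Context {R : realType}.
Implicit Types a b : R[i].

Lemma cReM a b : complex.Re (a * b) = complex.Re a * complex.Re b - complex.Im a * complex.Im b.
Proof. by case: a; case: b. Qed.

Lemma cImM a b : complex.Im (a * b) = complex.Re a * complex.Im b + complex.Im a * complex.Re b.
Proof. by case: a; case: b => ? ? ? ? /=. Qed.

Lemma cReD a b : complex.Re (a + b) = complex.Re a + complex.Re b.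
Proof. by case: a; case: b. Qed.

Lemma cImD a b : complex.Im (a + b) = complex.Im a + complex.Im b.
Proof. by case: a; case: b. Qed.

Lemma cReN a : complex.Re (- a) = - complex.Re a.
Proof. by case: a. Qed.

Lemma cImN a : complex.Im (- a) = - complex.Im a.
Proof. by case: a. Qed.

Lemma Rec (x : R) : complex.Re x%:C = x. Proof. by []. Qed.
Lemma Imc (x : R) : complex.Im x%:C = 0. Proof. by []. Qed.

Lemma cReJ a : complex.Re a^*%C = complex.Re a. Proof. by case: a. Qed.
Lemma cImJ a : complex.Im a^*%C = - complex.Im a. Proof. by case: a. Qed.

Lemma cJM a b : (a * b)^*%C = a^*%C * b^*%C.
Proof. exact: (rmorphM (@conjc R)). Qed.

Definition imag (t : R) : R[i] := 0 +i* t.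
Lemma Re_imag t : complex.Re (imag t) = 0. Proof. by []. Qed.
Lemma Im_imag t : complex.Im (imag t) = t. Proof. by []. Qed.

(* The kernel exp(- i t) of the Fourier transform. *)
Definition cis (t : R) : R[i] := cos t -i* sin t.
Lemma Re_cis t : complex.Re (cis t) = cos t. Proof. by []. Qed.
Lemma Im_cis t : complex.Im (cis t) = - sin t. Proof. by []. Qed.

Lemma Re0 : complex.Re (0 : R[i]) = 0. Proof. by []. Qed.
Lemma Im0 : complex.Im (0 : R[i]) = 0. Proof. by []. Qed.
Lemma Re1 : complex.Re (1 : R[i]) = 1. Proof. by []. Qed.
Lemma Im1 : complex.Im (1 : R[i]) = 0. Proof. by []. Qed.

Definition cpartsE := (cReM, cImM, cReD, cImD, cReN, cImN, Rec, Imc, cReJ, cImJ,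
  Re_imag, Im_imag, Re_cis, Im_cis, Re0, Im0, Re1, Im1).

Lemma complex_ext a b :
  complex.Re a = complex.Re b -> complex.Im a = complex.Im b -> a = b.
Proof. by case: a; case: b => ? ? ? ? /= -> ->. Qed.

Lemma normc_sq a : normc a ^+ 2 = complex.Re a ^+ 2 + complex.Im a ^+ 2.
Proof. by case: a => x y /=; rewrite sqr_sqrtr // addr_ge0 ?sqr_ge0. Qed.

Lemma normc_ge0 a : 0 <= normc a.
Proof. by case: a => x y /=; rewrite sqrtr_ge0. Qed.

Lemma normc_real (x : R) : normc x%:C = `|x|.
Proof. by rewrite /= expr0n /= addr0 sqrtr_sqr. Qed.

Lemma ler_Re_normc a : `|complex.Re a| <= normc a.
Proof.
rewrite -(@ler_pXn2r _ 2) ?nnegrE ?normc_ge0 // normc_sq.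
by rewrite real_normK ?num_real // lerDl sqr_ge0.
Qed.

Lemma ler_Im_normc a : `|complex.Im a| <= normc a.
Proof.
rewrite -(@ler_pXn2r _ 2) ?nnegrE ?normc_ge0 // normc_sq.
by rewrite real_normK ?num_real // lerDr sqr_ge0.
Qed.

Lemma normc_le_parts a : normc a <= `|complex.Re a| + `|complex.Im a|.
Proof.
rewrite -(@ler_pXn2r _ 2) ?nnegrE ?normc_ge0 ?addr_ge0 // normc_sq.
rewrite sqrrD !real_normK ?num_real // -addrA (addrC (_ *+ 2)) addrA lerDl.
by rewrite mulrn_wge0 // mulr_ge0.
Qed.

Lemma normcJ a : normc a^*%C = normc a.
Proof. by case: a => x y /=; rewrite sqrrN. Qed.

Lemma normc_cis (t : R) : normc (cis t) = 1.
Proof. by rewrite /= sqrrN cos2Dsin2 sqrtr1. Qed.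

End complex_parts.

Section dot_product.
Context {R : realType} {n : nat}.
Implicit Types x y : Rn R n.

Lemma dotC x y : dot x y = dot y x.
Proof. by rewrite /dot; apply: eq_bigr => i _; rewrite mulrC. Qed.

Lemma dot_ge0 x : 0 <= dot x x.
Proof. by rewrite /dot sumr_ge0 // => i _; rewrite -expr2 sqr_ge0. Qed.

Lemma enorm_ge0 x : 0 <= enorm x.
Proof. exact: sqrtr_ge0. Qed.

Lemma enorm_sq x : enorm x ^+ 2 = dot x x.
Proof. by rewrite /enorm sqr_sqrtr // dot_ge0. Qed.

Lemma coord_sq_le_dot x i : (tnth x i : R) ^+ 2 <= dot x x.
Proof.
rewrite /dot (bigD1 i) //= expr2 lerDl sumr_ge0 // => j _.
by rewrite -expr2 sqr_ge0.
Qed.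

Lemma coord_le_enorm x i : `|tnth x i : R| <= enorm x.
Proof.
rewrite -(@ler_pXn2r _ 2) ?nnegrE ?enorm_ge0 // enorm_sq real_normK ?num_real //.
exact: coord_sq_le_dot.
Qed.

Lemma dot_shiftl x y i h : dot (shift_coord x i h) y = dot x y + h * (tnth y i : R).
Proof.
rewrite /dot (bigD1 i) //= [in RHS](bigD1 i) //= tnth_shift eqxx mulrDl -!addrA.
congr (_ + _); rewrite addrC; congr (_ + _).
by apply: eq_bigr => j /negbTE ji; rewrite tnth_shift ji addr0.
Qed.

Lemma dot_shift_sq x i h : dot (shift_coord x i h) (shift_coord x i h) =
  dot x x + 2 * h * (tnth x i : R) + h ^+ 2.
Proof.
rewrite dot_shiftl dotC dot_shiftl tnth_shift eqxx; ring.
Qed.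

Lemma shift_coordD x i h k :
  shift_coord (shift_coord x i h) i k = shift_coord x i (h + k).
Proof.
apply: eq_from_tnth => j; rewrite !tnth_shift; case: ifP => _; last by rewrite !addr0.
by rewrite addrA.
Qed.

Lemma shift_coord0 x i : shift_coord x i 0 = x.
Proof. by apply: eq_from_tnth => j; rewrite tnth_shift; case: ifP; rewrite addr0. Qed.

Lemma measurable_dot_sq : measurable_fun [set: Rn R n] (fun x => dot x x).
Proof.
by rewrite /dot; apply: measurable_sum => i; apply: measurable_funM; exact: measurable_coord.
Qed.

Lemma measurable_enorm : measurable_fun [set: Rn R n] (@enorm R n).
Proof.
rewrite /enorm.
rewrite (_ : (fun x => _) = (@powR R ^~ (2^-1)) \o (fun x => dot x x)); last first.
  by apply/funext => x /=; rewrite powR12_sqrt // dot_ge0.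
exact: measurableT_comp (measurable_powR _) measurable_dot_sq.
Qed.

End dot_product.

Section partial_derivatives.
Context {R : realType} {n : nat}.
Notation E := (Rn R n).
Notation C := (R[i]).
Implicit Types (f g : E -> C) (x : E) (i : 'I_n).

(** Existence and value in one relation, so that the rules of calculus compose; [partial] by itself
    has a default value where the derivative fails to exist. *)
Definition is_pd i f x (d : C) : Prop :=
  is_derive (0 : R) (1 : R) (fun h : R => complex.Re (f (shift_coord x i h))) (complex.Re d) /\
  is_derive (0 : R) (1 : R) (fun h : R => complex.Im (f (shift_coord x i h))) (complex.Im d).

Lemma is_pd_has i f x d : is_pd i f x d -> has_partial i f x.
Proof. by move=> [[? ?] [? ?]]. Qed.

Lemma is_pd_partial i f x d : is_pd i f x d -> partial i f x = d.
Proof.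
move=> [[_ d1] [_ d2]]; rewrite /partial !derive1E d1 d2.
by case: d {d1 d2}.
Qed.

Lemma has_partial_is_pd i f x : has_partial i f x -> is_pd i f x (partial i f x).
Proof. by move=> [d1 d2]; split; rewrite /partial /= derive1E; apply: DeriveDef. Qed.

Lemma is_pd_cst i c x : is_pd i (fun=> c) x 0.
Proof. by split => /=; exact: is_derive_cst. Qed.

Lemma is_pdD i f g x d e : is_pd i f x d -> is_pd i g x e ->
  is_pd i (fun x => f x + g x) x (d + e).
Proof.
move=> [f1 f2] [g1 g2]; split; rewrite cpartsE.
  rewrite (_ : (fun h => _) = (fun h => complex.Re (f (shift_coord x i h))) +
    (fun h => complex.Re (g (shift_coord x i h)))); first exact: is_deriveD.
  by apply/funext => h; rewrite cpartsE.
rewrite (_ : (fun h => _) = (fun h => complex.Im (f (shift_coord x i h))) +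
    (fun h => complex.Im (g (shift_coord x i h)))); first exact: is_deriveD.
by apply/funext => h; rewrite cpartsE.
Qed.

Lemma is_pdM i f g x d e : is_pd i f x d -> is_pd i g x e ->
  is_pd i (fun x => f x * g x) x (d * g x + f x * e).
Proof.
move=> [f1 f2] [g1 g2]; split.
  rewrite (_ : (fun h => _) = (fun h => complex.Re (f (shift_coord x i h))) *
    (fun h => complex.Re (g (shift_coord x i h))) -
    (fun h => complex.Im (f (shift_coord x i h))) *
    (fun h => complex.Im (g (shift_coord x i h)))); last first.
    by apply/funext => h; rewrite cpartsE.
  have := is_deriveB (is_deriveM f1 g1) (is_deriveM f2 g2).
  move=> /is_derive_eq; apply; rewrite !shift_coord0 !cpartsE /GRing.scale /=; ring.
rewrite (_ : (fun h => _) = (fun h => complex.Re (f (shift_coord x i h))) *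
    (fun h => complex.Im (g (shift_coord x i h))) +
    (fun h => complex.Im (f (shift_coord x i h))) *
    (fun h => complex.Re (g (shift_coord x i h)))); last first.
  by apply/funext => h; rewrite cpartsE.
have := is_deriveD (is_deriveM f1 g2) (is_deriveM f2 g1).
move=> /is_derive_eq; apply; rewrite !shift_coord0 !cpartsE /GRing.scale /=; ring.
Qed.

Lemma is_pdJ i f x d : is_pd i f x d -> is_pd i (fun x => (f x)^*%C) x d^*%C.
Proof.
move=> [f1 f2]; split; rewrite cpartsE.
  by under eq_fun do rewrite cpartsE.
rewrite (_ : (fun h => _) = - (fun h => complex.Im (f (shift_coord x i h)))).
  exact: is_deriveN.
by apply/funext => h; rewrite cpartsE.
Qed.

Lemma is_derive_line (a b : R) :
  is_derive (0 : R) (1 : R) (fun h : R => a + h * b) b.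
Proof.
rewrite (_ : (fun h => _) = cst a + (fun h : R => h) * cst b).
  have := is_deriveD (is_derive_cst a (0:R) (1:R))
    (is_deriveM (is_derive_id (0:R) (1:R)) (is_derive_cst b (0:R) (1:R))).
  by move=> /is_derive_eq; apply; rewrite /GRing.scale /=; ring.
by apply/funext => h.
Qed.

Lemma is_pd_coord i j x :
  is_pd i (fun x => (tnth x j : R)%:C) x (i == j)%:R%:C.
Proof.
split => /=; last exact: is_derive_cst.
rewrite (_ : (fun h => _) = (fun h : R => (tnth x j : R) + h * (i == j)%:R)).
  exact: is_derive_line.
apply/funext => h; rewrite tnth_shift eq_sym; case: (i == j); by rewrite ?mulr1 ?mulr0.
Qed.

Lemma is_pd_cis i (xi : E) x :
  is_pd i (fun x => cis (dot x xi)) x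
    (imag (- (tnth xi i : R)) * cis (dot x xi)).
Proof.
have dl := is_derive_line (dot x xi) (tnth xi i : R).
have E0 : dot x xi + 0 * (tnth xi i : R) = dot x xi by rewrite mul0r addr0.
split; rewrite !cpartsE.
  rewrite (_ : (fun h => _) = cos \o (fun h : R => dot x xi + h * (tnth xi i : R))).
    have := @is_derive1_comp _ cos _ 0 _ _ (is_derive_cos _) dl.
    by rewrite E0 => /is_derive_eq; apply; ring.
  by apply/funext => h /=; rewrite dot_shiftl.
rewrite (_ : (fun h => _) = - (sin \o (fun h : R => dot x xi + h * (tnth xi i : R)))).
  have := is_deriveN (@is_derive1_comp _ sin _ 0 _ _ (is_derive_sin _) dl).
  by rewrite E0 => /is_derive_eq; apply; ring.
by apply/funext => h /=; rewrite dot_shiftl.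
Qed.

Definition gaussian (c : R) : E -> C := fun x => (expR (- (c * dot x x)))%:C.

Lemma is_pd_gaussian i c x :
  is_pd i (gaussian c) x ((- (2 * c * (tnth x i : R)))%:C * gaussian c x).
Proof.
pose v : C := (- (2 * c * (tnth x i : R)))%:C * gaussian c x.
have vRe : complex.Re v = - (2 * c * (tnth x i : R)) * expR (- (c * dot x x)).
  by rewrite /v !cpartsE; ring.
have vIm : complex.Im v = 0 by rewrite /v !cpartsE; ring.
split; last by rewrite -/v vIm; exact: is_derive_cst.
rewrite -/v vRe.
rewrite (_ : (fun h => _) = expR \o (fun h : R => - (c * dot x x) +
    (h * (- (2 * c * (tnth x i : R))) + h * (h * - c)))); last first.
  apply/funext => h /=; rewrite dot_shift_sq; congr expR; ring.
have d3 : is_derive (0:R) (1:R) (fun h : R => - (c * dot x x) +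
    (h * (- (2 * c * (tnth x i : R))) + h * (h * - c))) (- (2 * c * (tnth x i : R))).
  rewrite (_ : (fun h => _) = (fun h : R => - (c * dot x x) + h * (- (2 * c * (tnth x i : R)))) +
    (id : R -> R) * (fun h : R => 0 + h * - c)); last first.
    by apply/funext => h; rewrite !fctE; ring.
  have dl := is_derive_line (- (c * dot x x)) (- (2 * c * (tnth x i : R))).
  have := is_deriveD dl (is_deriveM (is_derive_id (0:R) (1:R)) (is_derive_line 0 (- c))).
  by move=> /is_derive_eq; apply; rewrite /GRing.scale /=; ring.
have := @is_derive1_comp _ expR _ 0 _ _ (is_derive_expR _) d3.
by rewrite !mul0r !addr0 => /is_derive_eq; apply; rewrite mulrC.
Qed.

(** A smooth approximation of the indicator of x_j > a, used in place of compactly supported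
    cutoffs. Its derivative k L (1 - L) is a polynomial in L, so the functions generated by L are
    stable under differentiation. *)
Definition logistic (k a : R) (j : 'I_n) : E -> C :=
  fun x => (1 + expR (- (k * ((tnth x j : R) - a))))^-1%:C.

Lemma is_pd_logistic i k a j x : is_pd i (logistic k a j) x
  (((i == j)%:R * k)%:C * (logistic k a j x * (1 - logistic k a j x))).
Proof.
have Hpos (y : R) : 0 < 1 + expR y by rewrite ltr_wpDr // expR_ge0.
pose e := expR (- (k * ((tnth x j : R) - a))).
pose v : C := ((i == j)%:R * k)%:C * (logistic k a j x * (1 - logistic k a j x)).
have vRe : complex.Re v = (i == j)%:R * k * ((1 + e)^-1 * (1 - (1 + e)^-1)).
  by rewrite /v !cpartsE -/e; ring.
have vIm : complex.Im v = 0 by rewrite /v !cpartsE; ring.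
split; last by rewrite -/v vIm; exact: is_derive_cst.
rewrite -/v vRe.
rewrite (_ : (fun h => _) = (fun h : R => (1 + expR (- (k * ((tnth x j : R) - a)) +
    h * - (k * (i == j)%:R)))^-1)); last first.
  apply/funext => h /=; rewrite tnth_shift eq_sym; congr ((1 + expR _)^-1).
  by case: (i == j); rewrite /= ?addr0; ring.
have dl := is_derive_line (- (k * ((tnth x j : R) - a))) (- (k * (i == j)%:R)).
have d2 := is_deriveD (is_derive_cst (1:R) (0:R) (1:R))
  (@is_derive1_comp _ expR _ 0 _ _ (is_derive_expR _) dl).
have := @is_deriveV _ _ 0 _ _ _ d2.
have Ee : expR (- (k * ((tnth x j : R) - a)) + 0 * - (k * (i == j)%:R)) = e.
  by rewrite mul0r addr0.
rewrite /= !fctE /= Ee => /(_ (lt0r_neq0 (Hpos _))) /is_derive_eq; apply.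
have := lt0r_neq0 (Hpos (- (k * ((tnth x j : R) - a)))); rewrite -/e => e0.
by rewrite /GRing.scale /=; field.
Qed.

End partial_derivatives.

(** * Schwartz functions *)

Section smooth_classes.
Context {R : realType} {n : nat}.
Notation E := (Rn R n).
Notation C := (R[i]).
Implicit Types (f g m : E -> C) (D : (E -> C) -> Prop) (x : E) (i : 'I_n).

(* A coinductive predicate, encoded by an invariant class P: f has partial derivatives of all
   orders, and all of them are in D. *)
Definition smooth_in D f := exists P : (E -> C) -> Prop, P f /\
  forall g, P g -> D g /\ forall i, exists2 g', P g' & forall x, is_pd i g x (g' x).

Definition rapid f := forall k, exists M : R, forall x,
  (1 + enorm x) ^+ k * normc (f x) <= M.

Definition slow f := exists (k : nat) (M : R), forall x,
  normc (f x) <= M * (1 + enorm x) ^+ k.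

Lemma enorm1_ge1 x : 1 <= 1 + enorm x.
Proof. by rewrite lerDl enorm_ge0. Qed.

Lemma enorm1_gt0 x : 0 < 1 + enorm x.
Proof. exact: lt_le_trans ltr01 (enorm1_ge1 x). Qed.

Lemma smooth_in_base D f : smooth_in D f -> D f.
Proof. by move=> [P [Pf PD]]; exact: (PD _ Pf).1. Qed.

Lemma smooth_in_pd D f i : smooth_in D f ->
  smooth_in D (partial i f) /\ forall x, is_pd i f x (partial i f x).
Proof.
move=> [P [Pf PD]]; have [_ /(_ i) [g' Pg' dg']] := PD _ Pf.
have -> : partial i f = g' by apply/funext => x; exact: is_pd_partial.
by split => //; exists P.
Qed.

(** From left to right the invariant class is that of all iterated partial derivatives of f. In the
    form on the right, closure properties follow by exhibiting a class, without induction on lists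
    of derivatives. *)
Lemma schwartzP f : schwartz f <-> smooth_in rapid f.
Proof.
split=> [[dif dec]|[P [Pf PD]]].
  exists (fun g => exists a, g = partials a f); split; first by exists [::].
  move=> _ [a ->]; split; first exact: dec.
  move=> i; exists (partial i (partials a f)); first by exists (i :: a).
  by move=> x; apply: has_partial_is_pd; exact: dif.
have PP a : P (partials a f).
  elim: a => [//|i a IH] /=; have [_ /(_ i) [g' Pg' dg']] := PD _ IH.
  have -> // : partial i (partials a f) = g'.
  by apply/funext => x; exact: is_pd_partial.
split=> [a i x|a k]; last exact: (PD _ (PP a)).1.
have [_ /(_ i) [g' Pg' dg']] := PD _ (PP a).
exact: is_pd_has (dg' x).
Qed.

Lemma schwartz_pd f i x : schwartz f -> is_pd i f x (partial i f x).
Proof. by move=> /schwartzP /(smooth_in_pd i) []. Qed.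

Lemma schwartz_partial f i : schwartz f -> schwartz (partial i f).
Proof. by move=> /schwartzP /(smooth_in_pd i) [/schwartzP]. Qed.

Lemma schwartz_rapid f : schwartz f -> rapid f.
Proof. by move=> /schwartzP /smooth_in_base. Qed.

(** The invariant class for a product: by the Leibniz rule, derivatives of a product are sums of
    products. *)
Inductive sums_of_products (P1 P2 : (E -> C) -> Prop) : (E -> C) -> Prop :=
| sop_mul m f : P1 m -> P2 f -> sums_of_products P1 P2 (fun x => m x * f x)
| sop_add f g : sums_of_products P1 P2 f -> sums_of_products P1 P2 g ->
    sums_of_products P1 P2 (fun x => f x + g x).

Lemma smooth_in_mul D1 D2 D3 m f :
  (forall m f, D1 m -> D2 f -> D3 (fun x => m x * f x)) ->
  (forall f g, D3 f -> D3 g -> D3 (fun x => f x + g x)) ->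
  smooth_in D1 m -> smooth_in D2 f -> smooth_in D3 (fun x => m x * f x).
Proof.
move=> DM DD [P1 [P1m PD1]] [P2 [P2f PD2]].
exists (sums_of_products P1 P2); split; first exact: sop_mul.
move=> g; elim=> [{P1m P2f}m' f' P1m P2f|g1 g2 _ [D3g1 d1] _ [D3g2 d2]].
  have [D1m dm] := PD1 _ P1m; have [D2f df] := PD2 _ P2f.
  split=> [|i]; first exact: DM.
  have [m1 Pm1 dm1] := dm i; have [f1 Pf1 df1] := df i.
  exists (fun x => m1 x * f' x + m' x * f1 x).
    by apply: sop_add; exact: sop_mul.
  by move=> x; exact: is_pdM.
split=> [|i]; first exact: DD.
have [g1' P1' dg1] := d1 i; have [g2' P2' dg2] := d2 i.
exists (fun x => g1' x + g2' x); first exact: sop_add.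
by move=> x; exact: is_pdD.
Qed.

Lemma smooth_in_add D f g :
  (forall f g, D f -> D g -> D (fun x => f x + g x)) ->
  smooth_in D f -> smooth_in D g -> smooth_in D (fun x => f x + g x).
Proof.
move=> DD [P1 [P1f PD1]] [P2 [P2g PD2]].
exists (fun h => exists f g, [/\ P1 f, P2 g & h = fun x => f x + g x]).
split; first by exists f, g.
move=> _ [f' [g' [Pf Pg ->]]].
have [Df df] := PD1 _ Pf; have [Dg dg] := PD2 _ Pg.
split=> [|i]; first exact: DD.
have [f1 Pf1 df1] := df i; have [g1 Pg1 dg1] := dg i.
exists (fun x => f1 x + g1 x); first by exists f1, g1.
by move=> x; exact: is_pdD.
Qed.

Lemma smooth_inJ D f : (forall f, D f -> D (fun x => (f x)^*%C)) ->
  smooth_in D f -> smooth_in D (fun x => (f x)^*%C).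
Proof.
move=> DJ [P [Pf PD]].
exists (fun g => exists2 f, P f & g = fun x => (f x)^*%C); split; first by exists f.
move=> _ [g Pg ->]; have [Dg dg] := PD _ Pg.
split=> [|i]; first exact: DJ.
have [g1 Pg1 dg1] := dg i; exists (fun x => (g1 x)^*%C); first by exists g1.
by move=> x; exact: is_pdJ.
Qed.

(** The invariant class for multipliers: once the first derivatives of the generators lie in the
    algebra, so do all derivatives of all its elements. *)
Inductive algebra_gen (G : (E -> C) -> Prop) : (E -> C) -> Prop :=
| ag_cst c : algebra_gen G (fun=> c)
| ag_gen f : G f -> algebra_gen G f
| ag_add f g : algebra_gen G f -> algebra_gen G g -> algebra_gen G (fun x => f x + g x)
| ag_mul f g : algebra_gen G f -> algebra_gen G g -> algebra_gen G (fun x => f x * g x).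

Lemma slow_bound f : slow f -> exists (k : nat) (M : R), 0 <= M /\ forall x,
  normc (f x) <= M * (1 + enorm x) ^+ k.
Proof.
move=> [k [M H]]; exists k, `|M|; split => // x.
apply: le_trans (H x) _; apply: ler_wpM2r; last exact: ler_norm.
by rewrite exprn_ge0 // ltW // enorm1_gt0.
Qed.

Lemma slow_cst c : slow (fun=> c).
Proof. by exists 0, (normc c) => x; rewrite expr0 mulr1. Qed.

Lemma slow_add f g : slow f -> slow g -> slow (fun x => f x + g x).
Proof.
move=> /slow_bound [k [M [M0 Hf]]] /slow_bound [l [N [N0 Hg]]].
exists (k + l)%N, (M + N) => x.
apply: le_trans (le_normcD _ _) _; rewrite mulrDl; apply: lerD.
  apply: le_trans (Hf x) _; apply: ler_wpM2l => //.
  by rewrite ler_weXn2l ?enorm1_ge1 // leq_addr.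
apply: le_trans (Hg x) _; apply: ler_wpM2l => //.
by rewrite ler_weXn2l ?enorm1_ge1 // leq_addl.
Qed.

Lemma slow_mul f g : slow f -> slow g -> slow (fun x => f x * g x).
Proof.
move=> /slow_bound [k [M [M0 Hf]]] /slow_bound [l [N [N0 Hg]]].
exists (k + l)%N, (M * N) => x; rewrite normcM exprD mulrACA.
by apply: ler_pM => //; exact: normc_ge0.
Qed.

Lemma slowJ f : slow f -> slow (fun x => (f x)^*%C).
Proof. by move=> [k [M H]]; exists k, M => x; rewrite normcJ. Qed.

Lemma rapid_add f g : rapid f -> rapid g -> rapid (fun x => f x + g x).
Proof.
move=> Hf Hg k; have [M HM] := Hf k; have [N HN] := Hg k.
exists (M + N) => x; apply: le_trans (lerD (HM x) (HN x)); rewrite -mulrDr.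
by apply: ler_wpM2l; [rewrite exprn_ge0 // ltW // enorm1_gt0|exact: le_normcD].
Qed.

Lemma rapid_mul f g : slow f -> rapid g -> rapid (fun x => f x * g x).
Proof.
move=> /slow_bound [k [M [M0 Hf]]] Hg l; have [N HN] := Hg (l + k)%N.
exists (M * N) => x; rewrite normcM.
apply: (@le_trans _ _ (M * ((1 + enorm x) ^+ (l + k) * normc (g x)))); last first.
  by apply: ler_wpM2l => //; exact: HN.
rewrite mulrA mulrA; apply: ler_wpM2r; first exact: normc_ge0.
rewrite exprD mulrCA; apply: ler_wpM2l; last exact: Hf.
by rewrite exprn_ge0 // ltW // enorm1_gt0.
Qed.

Lemma rapidJ f : rapid f -> rapid (fun x => (f x)^*%C).
Proof. by move=> H k; have [M HM] := H k; exists M => x; rewrite normcJ. Qed.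

Lemma smooth_slow_gen (G : (E -> C) -> Prop) f :
  (forall g, G g -> slow g /\
     forall i, exists2 g', algebra_gen G g' & forall x, is_pd i g x (g' x)) ->
  algebra_gen G f -> smooth_in slow f.
Proof.
move=> HG Gf; exists (algebra_gen G); split => // g {Gf}.
elim=> [c|{}f Gf|{}f {}g Gf [Sf df] Gg [Sg dg]|{}f {}g Gf [Sf df] Gg [Sg dg]].
- split=> [|i]; first exact: slow_cst.
  by exists (fun=> 0) => [|x]; [exact: ag_cst|exact: is_pd_cst].
- exact: HG.
- split=> [|i]; first exact: slow_add.
  have [f1 Gf1 df1] := df i; have [g1 Gg1 dg1] := dg i.
  exists (fun x => f1 x + g1 x); first exact: ag_add.
  by move=> x; exact: is_pdD.
split=> [|i]; first exact: slow_mul.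
have [f1 Gf1 df1] := df i; have [g1 Gg1 dg1] := dg i.
exists (fun x => f1 x * g x + f x * g1 x); first by apply: ag_add; exact: ag_mul.
by move=> x; exact: is_pdM.
Qed.

Notation smooth_slow := (smooth_in slow).

Lemma smooth_slow_cst c : smooth_slow (fun=> c).
Proof. by apply: (@smooth_slow_gen (fun=> False)) => //; exact: ag_cst. Qed.

Lemma smooth_slow_add f g : smooth_slow f -> smooth_slow g ->
  smooth_slow (fun x => f x + g x).
Proof. by apply: smooth_in_add; exact: slow_add. Qed.

Lemma smooth_slow_mul f g : smooth_slow f -> smooth_slow g ->
  smooth_slow (fun x => f x * g x).
Proof. by apply: smooth_in_mul; [exact: slow_mul|exact: slow_add]. Qed.

Lemma smooth_slow_coord j : smooth_slow (fun x => (tnth x j : R)%:C).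
Proof.
apply: (@smooth_slow_gen (fun g => g = fun x => (tnth x j : R)%:C)); last exact: ag_gen.
move=> _ ->; split=> [|i].
  exists 1, 1 => x; rewrite mul1r expr1 normc_real.
  by apply: le_trans (coord_le_enorm _ _) _; rewrite lerDr.
exists (fun=> (i == j)%:R%:C); first exact: ag_cst.
by move=> x; exact: is_pd_coord.
Qed.

Lemma smooth_slow_cis (xi : E) : smooth_slow (fun x => cis (dot x xi)).
Proof.
apply: (@smooth_slow_gen (fun g => g = fun x => cis (dot x xi))); last exact: ag_gen.
move=> _ ->; split=> [|i].
  by exists 0, 1 => x; rewrite expr0 mul1r normc_cis.
exists (fun x => imag (- (tnth xi i : R)) * cis (dot x xi)).
  by apply: (ag_mul (ag_cst _ _)); exact: ag_gen.
by move=> x; exact: is_pd_cis.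
Qed.

Lemma smooth_slow_logistic k a j : smooth_slow (logistic k a j).
Proof.
apply: (@smooth_slow_gen (fun g => g = logistic k a j)); last exact: ag_gen.
move=> _ ->; split=> [|i].
  exists 0, 1 => x; rewrite expr0 mul1r normc_real ger0_norm ?invr_ge0 ?addr_ge0 ?expR_ge0 //.
  by rewrite invf_le1 ?lerDl ?expR_ge0 // ltr_wpDr // expR_ge0.
exists (fun x => ((i == j)%:R * k)%:C * (logistic k a j x * (1 + (- 1) * logistic k a j x))).
  apply: (ag_mul (ag_cst _ _)); apply: ag_mul; first exact: ag_gen.
  apply: (ag_add (ag_cst _ _)); apply: (ag_mul (ag_cst _ _)); exact: ag_gen.
by move=> x; rewrite mulN1r; exact: is_pd_logistic.
Qed.

Lemma smooth_slow_dot : smooth_slow (fun x => (dot x x)%:C).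
Proof.
rewrite (_ : (fun x => _) = fun x => \sum_(i < n) (tnth x i : R)%:C * (tnth x i : R)%:C).
  elim: (index_enum _) => [|i r IH].
    by under eq_fun do rewrite big_nil; exact: smooth_slow_cst.
  under eq_fun do rewrite big_cons.
  by apply: smooth_slow_add IH; apply: smooth_slow_mul; exact: smooth_slow_coord.
by apply/funext => x; rewrite /dot rmorph_sum; apply: eq_bigr => i _; rewrite rmorphM.
Qed.

Lemma schwartz_slow_mul m f : smooth_slow m -> schwartz f -> schwartz (fun x => m x * f x).
Proof.
move=> sm /schwartzP sf; apply/schwartzP.
by apply: smooth_in_mul sm sf; [exact: rapid_mul|exact: rapid_add].
Qed.

Lemma schwartz_add f g : schwartz f -> schwartz g -> schwartz (fun x => f x + g x).
Proof.
move=> /schwartzP sf /schwartzP sg; apply/schwartzP.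
by apply: smooth_in_add sf sg; exact: rapid_add.
Qed.

Lemma schwartzJ f : schwartz f -> schwartz (fun x => (f x)^*%C).
Proof. by move=> /schwartzP sf; apply/schwartzP; apply: smooth_inJ sf; exact: rapidJ. Qed.

Lemma schwartz_scale c f : schwartz f -> schwartz (fun x => c * f x).
Proof. by apply: schwartz_slow_mul; exact: smooth_slow_cst. Qed.

Lemma polynomial_le_exp (k : nat) (c : R) : 0 < c ->
  exists M : R, forall y : R, 0 <= y -> (1 + y) ^+ k * expR (- (c * y)) <= M.
Proof.
move=> c0; case: k => [|k].
  exists 1 => y y0; rewrite expr0 mul1r -expR0 ler_expR oppr_le0 mulr_ge0 // ltW //.
(* K is chosen so that 1 + y <= K (1 + c y / (k + 1)); the last factor is at most exp(c y / (k +
   1)), whose power k + 1 is exp(c y). *)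
set K := Num.max 1 (k.+1%:R / c); exists (K ^+ k.+1) => y y0.
rewrite expRN ler_pdivrMr ?expR_gt0 //.
have -> : c * y = (c * y / k.+1%:R) *+ k.+1.
  by rewrite -mulr_natr divfK // pnatr_eq0.
rewrite -mulr_natl expRM_natl -exprMn lerXn2r ?nnegrE ?addr_ge0 //.
  by rewrite mulr_ge0 ?expR_ge0 // le_max ler01.
apply: (@le_trans _ _ (K * (1 + c * y / k.+1%:R))); last first.
  by apply: ler_wpM2l; [rewrite le_max ler01|exact: expR_ge1Dx].
rewrite mulrDr mulr1; apply: lerD; first by rewrite le_max lexx.
rewrite (_ : K * (c * y / k.+1%:R) = (K / (k.+1%:R / c)) * y); last first.
  by rewrite invf_div !mulrA (mulrAC _ y).
by apply: ler_peMl => //; rewrite ler_pdivlMr ?divr_gt0 // mul1r le_max lexx orbT.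
Qed.

Lemma rapid_gaussian c : 0 < c -> rapid (gaussian c : E -> C).
Proof.
move=> c0 k; have [M HM] := polynomial_le_exp k c0.
(* 1 + r <= 2 (1 + r^2) passes from powers of the norm to powers of its square, on which the
   Gaussian depends. *)
exists (2 ^+ k * M) => x; rewrite normc_real ger0_norm ?expR_ge0 //.
apply: (@le_trans _ _ (2 ^+ k * ((1 + dot x x) ^+ k * expR (- (c * dot x x))))); last first.
  by apply: ler_wpM2l; [rewrite exprn_ge0|exact: HM (dot_ge0 x)].
rewrite mulrA -exprMn; apply: ler_wpM2r; first exact: expR_ge0.
rewrite lerXn2r ?nnegrE //.
- by rewrite ltW // enorm1_gt0.
- by rewrite mulr_ge0 // addr_ge0 // dot_ge0.
- rewrite -enorm_sq; have := sqr_ge0 (enorm x - 1); have := enorm_ge0 x; nra.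
Qed.

Lemma schwartz_gaussian c : 0 < c -> schwartz (gaussian c : E -> C).
Proof.
move=> c0; apply/schwartzP.
(* Differentiating p times the Gaussian gives another multiplier times the same Gaussian. *)
exists (fun g => exists2 p, smooth_slow p & g = fun x => p x * gaussian c x); split.
  exists (fun=> 1); first exact: smooth_slow_cst.
  by apply/funext => x; rewrite mul1r.
move=> _ [p sp ->]; split=> [|i].
  by apply: rapid_mul; [exact: smooth_in_base sp|exact: rapid_gaussian].
have [sp' dp] := smooth_in_pd i sp.
exists (fun x => (partial i p x + p x * ((- (2 * c))%:C * (tnth x i : R)%:C)) * gaussian c x).
  exists (fun x => partial i p x + p x * ((- (2 * c))%:C * (tnth x i : R)%:C)) => //.
  apply: smooth_slow_add => //; apply: smooth_slow_mul => //.
  by apply: smooth_slow_mul; [exact: smooth_slow_cst|exact: smooth_slow_coord].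
move=> x; have := is_pdM (dp x) (is_pd_gaussian i c x).
rewrite (_ : (- (2 * c * (tnth x i : R)))%:C = (- (2 * c))%:C * (tnth x i : R)%:C).
  move=> H; apply: (eq_ind _ (is_pd i _ x) H).
  move: (_%:C) (_%:C) (gaussian c x) => a b g. ring.
by rewrite -rmorphM mulNr.
Qed.

End smooth_classes.
Notation smooth_slow := (smooth_in slow).

(** * Lipschitz functions and their measurability *)

Section lipschitz_functions.
Context {R : realType} {n : nat}.
Notation E := (Rn R n).

Lemma is_derive_shift (G : R -> R) (a d : R) :
  is_derive (0 : R) (1 : R) (fun h => G (a + h)) d -> is_derive a (1 : R) G d.
Proof.
move=> dG.
rewrite (_ : G = (fun h => G (a + h)) \o (fun t : R => - a + t * 1)); last first.
  by apply/funext => t /=; congr G; ring.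
have dl : is_derive a (1:R) (fun t : R => - a + t * 1) 1.
  rewrite (_ : (fun t => _) = cst (- a) + (id : R -> R)).
    by have /is_derive_eq := is_deriveD (is_derive_cst (- a) a (1:R)) (is_derive_id a (1:R));
      apply; rewrite add0r.
  by apply/funext => t; rewrite !fctE; ring.
have dG' : is_derive (- a + a * 1) (1:R) (fun h => G (a + h)) d.
  by rewrite mulr1 addNr.
by have := @is_derive1_comp _ _ _ a _ _ dG' dl; rewrite mulr1.
Qed.

Lemma derivative_bound_lipschitz (G G' : R -> R) (L : R) :
  (forall t, is_derive t (1 : R) G (G' t)) -> (forall t, `|G' t| <= L) ->
  forall a b, `|G b - G a| <= L * `|b - a|.
Proof.
move=> dG bG a b.
wlog ab : a b / a <= b => [H|].
  have [/H //|/ltW /H] := leP a b.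
  by rewrite (distrC (G a)) (distrC a).
have cG : {within `[a, b], continuous G}.
  apply: derivable_within_continuous => t _; by have [] := dG t.
have [c _ ->] := @MVT_segment _ G G' a b ab (fun t _ => dG t) cG.
by rewrite normrM; apply: ler_wpM2r.
Qed.

(** A partial derivative is taken at h = 0 only; taken at every point of the line, it yields the
    derivative at every h. *)
Lemma line_derive (g : E -> R) i x (d : R -> R) :
  (forall h, is_derive (0 : R) (1 : R) (fun k => g (shift_coord (shift_coord x i h) i k)) (d h)) ->
  forall h, is_derive h (1 : R) (fun h => g (shift_coord x i h)) (d h).
Proof.
move=> H h; apply: is_derive_shift.
by rewrite (_ : (fun k => _) = (fun k => g (shift_coord (shift_coord x i h) i k))) //;
  apply/funext => k; rewrite shift_coordD.
Qed.

Lemma partials_bounded_lipschitz (g : E -> R) (g' : 'I_n -> E -> R) (L : R) :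
  (forall i x, is_derive (0 : R) (1 : R) (fun h => g (shift_coord x i h)) (g' i x)) ->
  (forall i x, `|g' i x| <= L) ->
  forall x y, `|g y - g x| <= L * \sum_(i < n) `|(tnth y i : R) - (tnth x i : R)|.
Proof.
move=> dg bg x y.
have H1 z i h : `|g (shift_coord z i h) - g z| <= L * `|h|.
  have := @derivative_bound_lipschitz (fun h => g (shift_coord z i h))
    (fun h => g' i (shift_coord z i h)) L _ _ 0 h.
  rewrite shift_coord0 subr0; apply; last by move=> t; exact: bg.
  by apply: line_derive => k; exact: dg.
(* A path from x to y that changes one coordinate at a time: z k agrees with y on the first k
   coordinates and with x on the others. *)
pose z (k : nat) : E := [tuple if (j < k)%N then tnth y j else tnth x j | j < n].
have Hz k : (k <= n)%N -> `|g (z k) - g x| <=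
    L * \sum_(i < n | (i < k)%N) `|(tnth y i : R) - (tnth x i : R)|.
  elim: k => [_|k IH kn].
    rewrite (_ : z 0 = x) ?subrr ?normr0; last first.
      by apply: eq_from_tnth => j; rewrite tnth_mktuple.
    by rewrite big_pred0 ?mulr0 // => i.
  pose ik := Ordinal kn.
  have zS : z k.+1 = shift_coord (z k) ik ((tnth y ik : R) - (tnth x ik : R)).
    apply: eq_from_tnth => j; rewrite tnth_shift !tnth_mktuple ltnS leq_eqVlt.
    have -> : (j == k :> nat) = (j == ik) by [].
    case: eqP => [->|_] /=; last by case: ifP; rewrite addr0.
    by rewrite ltnn addrC subrK.
  rewrite (bigD1 ik) //= mulrDr.
  rewrite (eq_bigl (fun i : 'I_n => (i < k)%N)); last first.
    by move=> i; rewrite ltnS ltn_neqAle andbC.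
  rewrite zS -(subrK (g (z k)) (g (shift_coord _ _ _))) -addrA.
  apply: le_trans (ler_normD _ _) _; apply: lerD; first exact: H1.
  exact: IH (ltnW kn).
have := Hz n (leqnn n).
rewrite (_ : z n = y); last by apply: eq_from_tnth => j; rewrite tnth_mktuple ltn_ord.
by rewrite (eq_bigl xpredT) // => i; rewrite ltn_ord.
Qed.

(** R^n is cut into cubes of side 1 / (k + 1): [cell] is the integer index of the cube that contains
    a point, [grid] the lower corner of the cube with a given index. *)
Definition grid (k : nat) (z : n.-tuple int) : E := [tuple (tnth z j)%:~R / k.+1%:R | j < n].
Definition cell (k : nat) (x : E) : n.-tuple int :=
  [tuple Num.floor (k.+1%:R * (tnth x j : R)) | j < n].

Lemma measurable_cell k z : measurable (cell k @^-1` [set z]).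
Proof.
have -> : cell k @^-1` [set z] = \bigcap_(j in [set: 'I_n])
    (fun x : E => (tnth x j : R)) @^-1`
      `[(tnth z j)%:~R / k.+1%:R, ((tnth z j)%:~R + 1) / k.+1%:R[%classic.
  have k0 : 0 < k.+1%:R :> R by rewrite ltr0n.
  apply/seteqP; split => [x /= <- j _ /=|x H /=].
    rewrite tnth_mktuple in_itv /= ler_pdivrMr // ltr_pdivlMr // mulrC.
    by rewrite Num.Theory.floor_le /= -intrD1 floorD1_gt.
  apply: eq_from_tnth => j; rewrite tnth_mktuple.
  have /= := H j I; rewrite in_itv /= ler_pdivrMr // ltr_pdivlMr // mulrC => /andP[h1 h2].
  by apply: floor_def; rewrite h1 /= intrD.
apply: fin_bigcap_measurable => // j _.
rewrite -[X in measurable X]setTI.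
exact: measurable_coord.
Qed.

(** g is the pointwise limit of the functions that freeze it at the corner of each cube. These have
    countably many values, each taken on a union of measurable cubes. *)
Lemma lipschitz_measurable (g : E -> R) (L : R) :
  (forall x y, `|g y - g x| <= L * \sum_(i < n) `|(tnth y i : R) - (tnth x i : R)|) ->
  measurable_fun [set: E] g.
Proof.
move=> Lg; pose h k x := g (grid k (cell k x)).
apply: (@measurable_fun_cvg _ _ _ _ h) => [k|x _].
- move=> _ Y mY; rewrite setTI.
  (* Integer tuples are countable, so the preimage is a countable union of cells, enumerated by
     [unpickle]. *)
  have -> : h k @^-1` Y = \bigcup_m (if unpickle m is Some z then
      (if `[< Y (g (grid k z)) >] then cell k @^-1` [set z] else set0) else set0).
    apply/seteqP; split => [x /= Yx|x [m _]].
      by exists (pickle (cell k x)) => //; rewrite pickleK; case: asboolP.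
    case: unpickle => // z; case: asboolP => // Yz /= xz.
    by rewrite /h xz.
  apply: bigcupT_measurable => m; case: unpickle => [z|]; last exact: measurable0.
  by case: asboolP => _; [exact: measurable_cell|exact: measurable0].
- have H k : `|h k x - g x| <= `|L| * n%:R / k.+1%:R.
    have k0 : 0 < k.+1%:R :> R by rewrite ltr0n.
    have k1 : 0 <= k.+1%:R^-1 :> R by rewrite invr_ge0.
    apply: le_trans (Lg _ _) _; rewrite -mulrA.
    apply: (@le_trans _ _ (`|L| * \sum_(i < n) `|(tnth (grid k (cell k x)) i : R) - (tnth x i : R)|)).
      by apply: ler_wpM2r (ler_norm _); exact: sumr_ge0.
    apply: ler_wpM2l => //.
    apply: (@le_trans _ _ (\sum_(i < n) k.+1%:R^-1)); last first.
      by rewrite sumr_const card_ord mulr_natl.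
    apply: ler_sum => i _; rewrite !tnth_mktuple.
    have h1 := Num.Theory.floor_le (k.+1%:R * (tnth x i : R)).
    have h2 := floorD1_gt (k.+1%:R * (tnth x i : R)); rewrite intrD in h2.
    rewrite -[X in _ - X](mulKf (lt0r_neq0 k0)) mulrC -mulrBr normrM ger0_norm //.
    apply: ler_piMr => //.
    by rewrite ler_norml; lra.
  apply/cvgrPdist_le => e e0.
  have C0 : (fun k : nat => `|L| * n%:R / k.+1%:R) @ \oo --> (0 : R).
    rewrite -(mulr0 (`|L| * n%:R)); apply: cvgM; first exact: cvg_cst.
    exact: cvg_harmonic.
  have /cvgrPdist_le /(_ e e0) := C0.
  apply: filterS => k; rewrite sub0r normrN => He.
  by rewrite distrC; apply: le_trans (H k) (le_trans (ler_norm _) He).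
Qed.

End lipschitz_functions.

(** * An integrable majorant on R^n and integration by parts *)

Section decay.
Context {R : realType}.
Notation leb := (@lebesgue_measure R).

Definition decay1 (x : R) : R := (1 + `|x|)^-1 ^+ 2.

Lemma decay1_gt0 x : 0 < decay1 x.
Proof. by rewrite exprn_gt0 // invr_gt0 ltr_pwDl. Qed.

Lemma continuous_decay1 : continuous decay1.
Proof.
move=> x.
have c1 : {for x, continuous (fun x : R => (1 + `|x|)^-1)}.
  apply: continuousV; first by rewrite gt_eqF // ltr_pwDl.
  by apply: continuousD; [exact: cst_continuous|exact: norm_continuous].
exact: (continuousM c1 c1).
Qed.

Lemma measurable_decay1 : measurable_fun setT (decay1 : measurableTypeR R -> R).
Proof. exact: continuous_measurable_fun continuous_decay1. Qed.

Lemma is_derive_ninv (x : R) : 0 <= x ->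
  is_derive x (1 : R) (fun t : R => - (1 + t)^-1) (decay1 x).
Proof.
move=> x0.
have d1 : is_derive x (1:R) (fun t : R => 1 + t) 1.
  by have /is_derive_eq := is_deriveD (is_derive_cst (1:R) x (1:R)) (is_derive_id x (1:R));
    apply; rewrite add0r.
have x1 : 1 + x != 0 by rewrite gt_eqF // ltr_pwDl.
have := is_deriveN (is_deriveV x1 d1); move=> /is_derive_eq; apply.
by rewrite /decay1 ger0_norm // scaleNr opprK exprVn /GRing.scale /= mulr1.
Qed.

Lemma integral_decay1 : (\int[leb]_x (decay1 x)%:E = 2%:E)%E.
Proof.
rewrite ge0_symfun_integralT /=; last 3 first.
- by move=> x; exact: ltW (decay1_gt0 x).
- exact: continuous_decay1.
- by move=> x /=; rewrite /decay1 normrN.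
rewrite (_ : [set x | _] = `[0, +oo[%classic); last first.
  by apply/seteqP; split => x/=; rewrite in_itv/= andbT.
(* By symmetry the integral is twice that over [0, +oo[, where - 1 / (1 + t) is an antiderivative
   running from - 1 to 0. *)
rewrite (@ge0_continuous_FTC2y _ decay1 (fun t => - (1 + t)^-1) 0 0).
- by rewrite addr0 invr1 EFinN sub0e oppeK mule1.
- by move=> x _; exact: ltW (decay1_gt0 x).
- by apply: continuous_subspaceT; exact: continuous_decay1.
- rewrite -oppr0; apply: cvgN; apply/gtr0_cvgV0; last exact: cvg_addrl.
  by near=> x; rewrite ltr_pwDl //; near: x; exact: nbhs_pinfty_ge.
- by move=> x x0; have [] := is_derive_ninv (ltW x0).
- apply: cvg_at_right_filter; apply: (@differentiable_continuous _ _ _ 0 (fun t : R => - (1 + t)^-1)).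
  by apply/derivable1_diffP; have [] := is_derive_ninv (lexx 0).
- move=> x; rewrite in_itv /= andbT => x0; rewrite derive1E.
  by have [_ ->] := is_derive_ninv (ltW x0).
Unshelve. all: by end_near. Qed.

End decay.

Section decay_Rn.
Context {R : realType} {n : nat}.
Notation E := (Rn R n).
Notation mu := (lebesgue_Rn R n).
Notation C := (R[i]).

(** A product of one-variable weights instead of a radial one, so that its integral is a product of
    one-dimensional integrals. *)
Definition decay (x : E) : R := \prod_(i < n) decay1 (tnth x i).

Lemma decay_gt0 x : 0 < decay x.
Proof. by apply: prodr_gt0 => i _; exact: decay1_gt0. Qed.

Lemma measurable_decay : measurable_fun setT decay.
Proof. exact: (@measurable_prod_coord _ n (fun=> decay1) (fun=> measurable_decay1)). Qed.

Lemma integrable_decay : mu.-integrable setT (fun x => (decay x)%:E).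
Proof.
apply/integrableP; split; first by apply/measurable_EFinP; exact: measurable_decay.
under eq_integral => x _ do rewrite gee0_abs ?lee_fin ?ltW ?decay_gt0 //.
rewrite (integral_prod (f := fun=> decay1) (c := fun=> 2)) ?ltry //.
- by move=> i; exact: measurable_decay1.
- by move=> i x; exact: ltW (decay1_gt0 x).
- by move=> i; exact: integral_decay1.
Qed.

Lemma decay_integrable (g : E -> R) (M : R) : measurable_fun setT g ->
  (forall x, `|g x| <= M * decay x) -> mu.-integrable setT (EFin \o g).
Proof.
move=> mg bg.
apply: (@le_integrable _ _ _ _ _ _ _ (fun x => M%:E * (decay x)%:E)%E) => //.
- exact/measurable_EFinP.
- move=> x _; rewrite /= lee_fin; apply: le_trans (bg x) _; exact: ler_norm.
- by apply: integrableZl => //; exact: integrable_decay.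
Qed.

(** Each of the n factors costs (1 + |x_i|)^2, which is at most (1 + |x|)^2; hence the exponent 2
    n. *)
Lemma decay_enorm (x : E) : 1 <= (1 + enorm x) ^+ (2 * n) * decay x.
Proof.
rewrite exprM -[X in _ ^+ X](card_ord n) -prodr_const /decay -big_split /=.
elim/big_ind : _ => // [a b a1 b1|i _]; first by rewrite -[1]mulr1 ler_pM.
rewrite /decay1 -exprMn exprn_ege1 // ler_pdivlMr ?ltr_pwDl // mul1r.
by rewrite lerD2l coord_le_enorm.
Qed.

Lemma rapid_decay (f : E -> C) k : rapid f -> exists2 M : R, 0 <= M &
  forall x, (1 + enorm x) ^+ k * normc (f x) <= M * decay x.
Proof.
move=> /(_ (2 * n + k)%N) [M HM]; exists `|M| => // x.
have d0 := decay_gt0 x; have e0 := enorm1_gt0 x.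
apply: (@le_trans _ _ (((1 + enorm x) ^+ (2 * n) * decay x) * ((1 + enorm x) ^+ k * normc (f x)))).
  apply: ler_peMl (decay_enorm x).
  by rewrite mulr_ge0 ?normc_ge0 // exprn_ge0 // ltW.
rewrite mulrAC mulrA -exprD; apply: ler_wpM2r; first exact: ltW.
exact: le_trans (HM x) (ler_norm _).
Qed.

(** Since 1 + |a| <= 2 (1 + |a + h|) for |h| <= 1, one majorant serves all small shifts, as is
    needed to differentiate under the integral. *)
Lemma decay_shift i (h : R) (x : E) : `|h| <= 1 -> decay (shift_coord x i h) <= 4 * decay x.
Proof.
move=> h1; rewrite /decay (bigD1 i) //= [in leRHS](bigD1 i) //= mulrA.
rewrite (eq_bigr (fun j => decay1 (tnth x j))); last first.
  by move=> j /negbTE ji; rewrite tnth_shift ji addr0.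
apply: ler_wpM2r; first by apply: prodr_ge0 => j _; exact: ltW (decay1_gt0 _).
rewrite tnth_shift eqxx /decay1.
set a := (tnth x i : R).
have a0 : 0 < 1 + `|a| by rewrite ltr_pwDl.
have b0 : 0 < 1 + `|a + h| by rewrite ltr_pwDl.
rewrite (_ : 4 = 2 ^+ 2); last by ring.
rewrite -exprMn lerXn2r ?nnegrE ?mulr_ge0 ?invr_ge0 ?(ltW a0) ?(ltW b0) //.
rewrite ler_pdivlMr // ler_pdivrMl //.
have : `|a| <= `|a + h| + `|h|.
  by rewrite -{1}(addrK h a) -[`|h|]normrN; exact: ler_normD.
by have := normr_ge0 (a + h); lra.
Qed.

(** The first partial derivatives are bounded, so both parts of f are Lipschitz. *)
Lemma schwartz_measurable (f : E -> C) : schwartz f -> cmeasurable f.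
Proof.
move=> sf.
have [L HL] : exists L : R, forall i x, normc (partial i f x) <= L.
  have /choice[M HM] : forall i : 'I_n, exists M : R, forall x, normc (partial i f x) <= M.
    move=> i; have [M HM] := schwartz_rapid (schwartz_partial i sf) 0%N.
    by exists M => x; have := HM x; rewrite expr0 mul1r.
  exists (\sum_i `|M i|) => i x; apply: le_trans (HM i x) _.
  by rewrite (bigD1 i) //=; apply: le_trans (ler_norm _) _; rewrite lerDl sumr_ge0.
have dR i x := (schwartz_pd i x sf).1.
have dI i x := (schwartz_pd i x sf).2.
split.
- apply: (@lipschitz_measurable _ _ _ L); apply: partials_bounded_lipschitz dR _.
  by move=> i x; exact: le_trans (ler_Re_normc _) (HL i x).
- apply: (@lipschitz_measurable _ _ _ L); apply: partials_bounded_lipschitz dI _.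
  by move=> i x; exact: le_trans (ler_Im_normc _) (HL i x).
Qed.

Lemma decay_cintegrable (f : E -> C) (M : R) : cmeasurable f ->
  (forall x, normc (f x) <= M * decay x) -> cintegrable f.
Proof.
move=> [m1 m2] H; split; apply: (@decay_integrable _ M) => // x.
  exact: le_trans (ler_Re_normc _) (H x).
exact: le_trans (ler_Im_normc _) (H x).
Qed.

Lemma schwartz_cintegrable (f : E -> C) : schwartz f -> cintegrable f.
Proof.
move=> sf; have [M _ HM] := rapid_decay 0 (schwartz_rapid sf).
apply: (@decay_cintegrable _ M); first exact: schwartz_measurable.
by move=> x; have := HM x; rewrite expr0 mul1r.
Qed.

Lemma Re_cintegral (f : E -> C) :
  complex.Re (cintegral f) = \int[mu]_x complex.Re (f x).
Proof. by []. Qed.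

Lemma Im_cintegral (f : E -> C) :
  complex.Im (cintegral f) = \int[mu]_x complex.Im (f x).
Proof. by []. Qed.

Lemma cintegralD (f g : E -> C) : cintegrable f -> cintegrable g ->
  cintegral (fun x => f x + g x) = cintegral f + cintegral g.
Proof.
move=> [f1 f2] [g1 g2].
apply: complex_ext; [rewrite cReD|rewrite cImD];
  rewrite ?Re_cintegral ?Im_cintegral -RintegralD //;
  by apply: eq_Rintegral => x _; rewrite (cReD, cImD).
Qed.

Lemma cintegrableD (f g : E -> C) : cintegrable f -> cintegrable g ->
  cintegrable (fun x => f x + g x).
Proof.
move=> [f1 f2] [g1 g2]; split.
  rewrite (_ : (fun x => _) = (fun x => (complex.Re (f x))%:E + (complex.Re (g x))%:E)%E).
    exact: integrableD.
  by apply/funext => x; rewrite cpartsE.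
rewrite (_ : (fun x => _) = (fun x => (complex.Im (f x))%:E + (complex.Im (g x))%:E)%E).
  exact: integrableD.
by apply/funext => x; rewrite cpartsE.
Qed.

Lemma cintegrableZ (c : C) (f : E -> C) : cintegrable f -> cintegrable (fun x => c * f x).
Proof.
move=> [f1 f2]; split.
  rewrite (_ : (fun x => _) = (fun x => (complex.Re c)%:E * (complex.Re (f x))%:E -
     (complex.Im c)%:E * (complex.Im (f x))%:E)%E).
    by apply: integrableB => //; exact: integrableZl.
  by apply/funext => x; rewrite cpartsE.
rewrite (_ : (fun x => _) = (fun x => (complex.Re c)%:E * (complex.Im (f x))%:E +
     (complex.Im c)%:E * (complex.Re (f x))%:E)%E).
  by apply: integrableD => //; exact: integrableZl.
by apply/funext => x; rewrite cpartsE.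
Qed.

Lemma cintegralZ (c : C) (f : E -> C) : cintegrable f ->
  cintegral (fun x => c * f x) = c * cintegral f.
Proof.
move=> [f1 f2].
have Zl (g : E -> R) r : mu.-integrable setT (fun x => (g x)%:E) ->
    mu.-integrable setT (EFin \o (fun x => r * g x)).
  move=> ig; rewrite (_ : _ \o _ = (fun x => r%:E * (g x)%:E)%E).
    exact: integrableZl.
  by apply/funext => x.
apply: complex_ext; [rewrite cReM|rewrite cImM];
  rewrite !Re_cintegral !Im_cintegral -!RintegralZl //.
  rewrite -RintegralB //; [|exact: Zl|exact: Zl].
  by apply: eq_Rintegral => x _; rewrite cpartsE.
rewrite -RintegralD //; [|exact: Zl|exact: Zl].
by apply: eq_Rintegral => x _; rewrite cpartsE.
Qed.

Lemma cintegralJ (f : E -> C) : cintegrable f ->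
  cintegral (fun x => (f x)^*%C) = (cintegral f)^*%C.
Proof.
move=> [f1 f2]; apply: complex_ext; [rewrite cReJ|rewrite cImJ]; rewrite ?Re_cintegral ?Im_cintegral.
  by apply: eq_Rintegral => x _; rewrite cpartsE.
rewrite -mulN1r -RintegralZl //.
by apply: eq_Rintegral => x _; rewrite cpartsE mulN1r.
Qed.

Lemma eq_cintegral (f g : E -> C) : (forall x, f x = g x) -> cintegral f = cintegral g.
Proof. by move=> /funext ->. Qed.

Lemma cmeasurableM (f g : E -> C) : cmeasurable f -> cmeasurable g ->
  cmeasurable (fun x => f x * g x).
Proof.
move=> [f1 f2] [g1 g2]; split.
  by under eq_fun do rewrite cpartsE; apply: measurable_funB; exact: measurable_funM.
by under eq_fun do rewrite cpartsE; apply: measurable_funD; exact: measurable_funM.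
Qed.

Lemma differentiation_under_line (F F' : R -> E -> R) (G : E -> R) :
  (forall h, mu.-integrable setT (EFin \o F h)) ->
  (forall h x, is_derive h (1 : R) (fun h => F h x) (F' h x)) ->
  (forall x, 0 <= G x) -> mu.-integrable setT (EFin \o G) ->
  (forall h x, `|h| <= 1 -> `|F' h x| <= G x) ->
  is_derive (0 : R) (1 : R) (fun h => \int[mu]_x F h x) (\int[mu]_x F' 0 x).
Proof.
move=> iF dF G0 iG bG.
(* G dominates only for |h| <= 1, so the theorem on parameter integrals is applied on ]-1, 1[. *)
have I0 : [set` `]-1, 1[%R] (0 : R) by rewrite /= in_itv /= oppr_lt0 !ltr01.
have D1 x y : partial1of2 F x y = F' x y.
  by rewrite /partial1of2 derive1E; have [_ ->] := dF x y.
have der x y : [set` `]-1, 1[%R] x -> [set: E] y -> derivable (F ^~ y) x 1.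
  by move=> _ _; have [] := dF x y.
have bd x y : [set` `]-1, 1[%R] x -> [set: E] y -> `|partial1of2 F x y| <= G y.
  rewrite /= in_itv /= => /andP[/ltW x1 /ltW x2] _; rewrite D1; apply: bG.
  by rewrite ler_norml x1 x2.
apply: DeriveDef.
  exact: (derivable_under_integral measurableT I0 (fun x _ => iF x) der G0 iG bd).
rewrite -derive1E (differentiation_under_integral measurableT I0 (fun x _ => iF x) der G0 iG bd).
by apply: eq_Rintegral => x _; rewrite D1.
Qed.

(** The integral of x |-> f (x + h e_i) is constant in h; its derivative at h = 0, taken under the
    integral, is the left-hand side. *)
Lemma integral_partial_Re (f : E -> C) i : schwartz f ->
  (\int[mu]_x complex.Re (partial i f x) = 0)%R.
Proof.
move=> sf; have [M M0 HM] := rapid_decay 0 (schwartz_rapid (schwartz_partial i sf)).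
have [mR _] := schwartz_measurable sf.
have [iR _] := schwartz_cintegrable sf.
have E1 h : \int[mu]_x complex.Re (f (shift_coord x i h)) = \int[mu]_x complex.Re (f x).
  rewrite /Rintegral (@integral_shift_coord _ _ i h (fun x => (complex.Re (f x))%:E)) //.
  exact/measurable_EFinP.
have iS h : mu.-integrable setT (EFin \o (fun x => complex.Re (f (shift_coord x i h)))).
  have ms := @measurable_shift_coord R n i h.
  apply/integrableP; split.
    by apply/measurable_EFinP; exact: measurableT_comp mR ms.
  have /integrableP[_] := iR.
  rewrite -(@integral_shift_coord _ _ i h (fun x => `|(complex.Re (f x))%:E|)%E) //.
  by apply: measurableT_comp => //; exact/measurable_EFinP.
have D0 := @differentiation_under_line
  (fun h x => complex.Re (f (shift_coord x i h)))
  (fun h x => complex.Re (partial i f (shift_coord x i h)))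
  (fun x => M * (4 * decay x)) iS.
have [| | | | _ D1] := D0.
- move=> h x; apply: (@line_derive _ _ (fun y => complex.Re (f y)) i x
    (fun h => complex.Re (partial i f (shift_coord x i h)))) => k.
  exact: (schwartz_pd i _ sf).1.
- by move=> x; rewrite !mulr_ge0 // ltW // decay_gt0.
- rewrite (_ : _ \o _ = fun x => ((M * 4)%:E * (decay x)%:E)%E).
    by apply: integrableZl => //; exact: integrable_decay.
  by apply/funext => x /=; rewrite mulrA EFinM.
- move=> h x h1; apply: le_trans (ler_Re_normc _) _.
  have := HM (shift_coord x i h); rewrite expr0 mul1r => /le_trans; apply.
  by apply: ler_wpM2l => //; exact: decay_shift.
have E2 : \int[mu]_x complex.Re (partial i f (shift_coord x i 0)) =
    \int[mu]_x complex.Re (partial i f x).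
  by apply: eq_Rintegral => x _; rewrite shift_coord0.
by move: D1; rewrite E2 => <-; under eq_fun do rewrite E1; rewrite derive_cst.
Qed.

Lemma cintegral_partial (f : E -> C) i : schwartz f -> cintegral (partial i f) = 0.
Proof.
move=> sf; apply: complex_ext => /=; first exact: integral_partial_Re.
(* The imaginary part of f is the real part of - i f. *)
have := integral_partial_Re i (schwartz_scale (imag (-1)) sf).
rewrite (_ : partial i (fun x => imag (-1) * f x) = fun x => imag (-1) * partial i f x).
  by under eq_Rintegral do rewrite !cpartsE mul0r mulN1r opprK add0r.
apply/funext => x; apply: is_pd_partial.
have := is_pdM (is_pd_cst i (imag (-1)) x) (schwartz_pd i x sf).
by rewrite mul0r add0r.
Qed.

End decay_Rn.

(** * The Fourier transform on Schwartz functions *)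

Section fourier_transform.
Context {R : realType} {n : nat}.
Notation E := (Rn R n).
Notation mu := (lebesgue_Rn R n).
Notation C := (R[i]).
Implicit Types (f g : E -> C) (x xi : E) (i : 'I_n).

Lemma fourierE f xi : fourier f xi = cintegral (fun x => f x * cis (dot x xi)).
Proof. by []. Qed.

Lemma schwartz_cis f xi : schwartz f -> schwartz (fun x => f x * cis (dot x xi)).
Proof.
move=> sf; under eq_fun do rewrite mulrC.
exact: schwartz_slow_mul (smooth_slow_cis xi) sf.
Qed.

Lemma schwartz_coord f i : schwartz f -> schwartz (fun x => imag (- (tnth x i : R)) * f x).
Proof.
move=> sf; rewrite (_ : (fun x => _) = fun x => imag (-1) * ((tnth x i : R)%:C * f x)).
  by apply: schwartz_scale; apply: schwartz_slow_mul => //; exact: smooth_slow_coord.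
apply/funext => x; rewrite mulrA; congr (_ * _).
by apply: complex_ext; rewrite !cpartsE; ring.
Qed.

Lemma schwartz_sum (r : seq 'I_n) (F : 'I_n -> E -> C) :
  (forall i, schwartz (F i)) -> schwartz (fun x => \sum_(i <- r) F i x).
Proof.
move=> sF; elim: r => [|i r IH].
  under eq_fun do rewrite big_nil.
  rewrite (_ : (fun=> 0) = fun x => 0 * gaussian 1 x); last first.
    by apply/funext => x; rewrite mul0r.
  by apply: schwartz_scale; exact: schwartz_gaussian.
by under eq_fun do rewrite big_cons; exact: schwartz_add.
Qed.

Lemma fourierD f g xi : schwartz f -> schwartz g ->
  fourier (fun x => f x + g x) xi = fourier f xi + fourier g xi.
Proof.
move=> sf sg; rewrite /fourier -cintegralD; last 2 first.
- exact: schwartz_cintegrable (schwartz_cis xi sf).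
- exact: schwartz_cintegrable (schwartz_cis xi sg).
by apply: eq_cintegral => x; rewrite mulrDl.
Qed.

Lemma fourierZ (c : C) f xi : schwartz f ->
  fourier (fun x => c * f x) xi = c * fourier f xi.
Proof.
move=> sf; rewrite /fourier -cintegralZ; last first.
  exact: schwartz_cintegrable (schwartz_cis xi sf).
by apply: eq_cintegral => x; rewrite mulrA.
Qed.

Lemma fourier_sum (r : seq 'I_n) (F : 'I_n -> E -> C) xi : (forall i, schwartz (F i)) ->
  fourier (fun x => \sum_(i <- r) F i x) xi = \sum_(i <- r) fourier (F i) xi.
Proof.
move=> sF; elim: r => [|i r IH].
  rewrite big_nil; under [X in fourier X _]eq_fun do rewrite big_nil.
  rewrite (_ : (fun=> 0) = fun x => 0 * gaussian 1 x); last first.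
    by apply/funext => x; rewrite mul0r.
  by rewrite fourierZ ?mul0r //; exact: schwartz_gaussian.
under [X in fourier X _]eq_fun do rewrite big_cons.
by rewrite big_cons fourierD ?IH //; exact: schwartz_sum.
Qed.

Lemma rapid_decay_Re f : rapid f -> exists2 M : R, 0 <= M &
  forall x, normc (f x) <= M * decay x.
Proof.
move=> rf; have [M M0 HM] := rapid_decay 0 rf; exists M => // x.
by have := HM x; rewrite expr0 mul1r.
Qed.

Lemma integrable_scale_decay (M : R) :
  mu.-integrable setT (EFin \o (fun x => M * decay x)).
Proof.
rewrite (_ : _ \o _ = fun x => (M%:E * (decay x)%:E)%E) //.
by apply: integrableZl => //; exact: integrable_decay.
Qed.

(** The factor 2 arises from bounding the real and the imaginary part separately. *)
Lemma normc_cintegral_le (g : E -> C) (h : E -> R) : cintegrable g ->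
  mu.-integrable setT (EFin \o h) -> (forall x, normc (g x) <= h x) ->
  normc (cintegral g) <= 2 * \int[mu]_x h x.
Proof.
move=> [g1 g2] ih gh; apply: le_trans (normc_le_parts _) _.
rewrite Re_cintegral Im_cintegral mulr_natl mulr2n; apply: lerD.
- apply: le_trans (le_normr_Rintegral measurableT g1) _.
  apply: le_Rintegral => //.
  + exact: integrable_norm g1.
  + by move=> x _; exact: le_trans (ler_Re_normc _) (gh x).
- apply: le_trans (le_normr_Rintegral measurableT g2) _.
  apply: le_Rintegral => //.
  + exact: integrable_norm g2.
  + by move=> x _; exact: le_trans (ler_Im_normc _) (gh x).
Qed.

Lemma fourier_bounded f : schwartz f -> exists M : R, forall xi, normc (fourier f xi) <= M.
Proof.
move=> sf; have [M _ HM] := rapid_decay_Re (schwartz_rapid sf).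
exists (2 * \int[mu]_x (M * decay x)) => xi.
apply: normc_cintegral_le; first exact: schwartz_cintegrable (schwartz_cis xi sf).
  exact: integrable_scale_decay.
by move=> x; rewrite normcM [normc (_ -i* _)%C]normc_cis mulr1.
Qed.

Lemma is_pd_fourier f i xi : schwartz f ->
  is_pd i (fourier f) xi (fourier (fun x => imag (- (tnth x i : R)) * f x) xi).
Proof.
move=> sf.
have [M M0 HM] := rapid_decay_Re (schwartz_rapid (schwartz_coord i sf)).
have pd x (eta : E) : is_pd i (fun eta => f x * cis (dot x eta)) eta
    (imag (- (tnth x i : R)) * f x * cis (dot x eta)).
  have := is_pdM (is_pd_cst i (f x) eta) (is_pd_cis i x eta).
  rewrite mul0r add0r mulrCA mulrA.
  by under [X in is_pd _ X]eq_fun do rewrite dotC; rewrite dotC.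
have bnd x (eta : E) : normc (imag (- (tnth x i : R)) * f x * cis (dot x eta)) <= M * decay x.
  by rewrite normcM normc_cis mulr1.
have ic eta := schwartz_cintegrable (schwartz_cis eta sf).
split.
(* Writing xi as its own shift by 0 exhibits the claimed value as the integral of the differentiated
   integrand at h = 0. *)
- rewrite Re_cintegral -{2 3}(shift_coord0 xi i).
  apply: (@differentiation_under_line _ _
    (fun h x => complex.Re (f x * cis (dot x (shift_coord xi i h))))
    (fun h x => complex.Re (imag (- (tnth x i : R)) * f x * cis (dot x (shift_coord xi i h))))
    (fun x => M * decay x)).
  + by move=> h; exact: (ic _).1.
  + move=> h x; apply: (@line_derive _ _ (fun eta => complex.Re (f x * cis (dot x eta))) i xi
      (fun h => complex.Re (imag (- (tnth x i : R)) * f x * cis (dot x (shift_coord xi i h))))) => k.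
    exact: (pd _ _).1.
  + by move=> x; rewrite mulr_ge0 // ltW // decay_gt0.
  + exact: integrable_scale_decay.
  + by move=> h x _; exact: le_trans (ler_Re_normc _) (bnd _ _).
- rewrite Im_cintegral -{2 3}(shift_coord0 xi i).
  apply: (@differentiation_under_line _ _
    (fun h x => complex.Im (f x * cis (dot x (shift_coord xi i h))))
    (fun h x => complex.Im (imag (- (tnth x i : R)) * f x * cis (dot x (shift_coord xi i h))))
    (fun x => M * decay x)).
  + by move=> h; exact: (ic _).2.
  + move=> h x; apply: (@line_derive _ _ (fun eta => complex.Im (f x * cis (dot x eta))) i xi
      (fun h => complex.Im (imag (- (tnth x i : R)) * f x * cis (dot x (shift_coord xi i h))))) => k.
    exact: (pd _ _).2.
  + by move=> x; rewrite mulr_ge0 // ltW // decay_gt0.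
  + exact: integrable_scale_decay.
  + by move=> h x _; exact: le_trans (ler_Im_normc _) (bnd _ _).
Qed.

(** Integration by parts: the partial derivative of f times the kernel has integral 0. *)
Lemma fourier_partial f i xi : schwartz f ->
  fourier (partial i f) xi = imag (tnth xi i : R) * fourier f xi.
Proof.
move=> sf.
have E1 : partial i (fun x => f x * cis (dot x xi)) =
    fun x => partial i f x * cis (dot x xi) + imag (- (tnth xi i : R)) * (f x * cis (dot x xi)).
  apply/funext => x; apply: is_pd_partial.
  have := is_pdM (schwartz_pd i x sf) (is_pd_cis i xi x).
  by rewrite mulrCA.
have := cintegral_partial i (schwartz_cis xi sf).
rewrite E1 cintegralD; last 2 first.
- exact: schwartz_cintegrable (schwartz_cis xi (schwartz_partial i sf)).
- by apply: cintegrableZ; exact: schwartz_cintegrable (schwartz_cis xi sf).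
rewrite cintegralZ; last exact: schwartz_cintegrable (schwartz_cis xi sf).
move=> /eqP; rewrite addr_eq0 => /eqP E2.
rewrite [LHS]E2 -mulNr; congr (_ * _).
by apply: complex_ext; rewrite !cpartsE; ring.
Qed.

Lemma fourier_laplacian f xi : schwartz f ->
  fourier (laplacian f) xi = - (dot xi xi)%:C * fourier f xi.
Proof.
move=> sf; rewrite /laplacian fourier_sum; last first.
  by move=> i; apply: schwartz_partial; exact: schwartz_partial.
rewrite /dot rmorph_sum -sumrN mulr_suml; apply: eq_bigr => i _.
rewrite fourier_partial; last exact: schwartz_partial.
rewrite fourier_partial // mulrA; congr (_ * _).
by apply: complex_ext; rewrite !cpartsE; ring.
Qed.

Lemma schwartz_laplacian f : schwartz f -> schwartz (laplacian f).
Proof.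
by move=> sf; apply: schwartz_sum => i; apply: schwartz_partial; exact: schwartz_partial.
Qed.

Lemma fourier_dot_bounded f k : schwartz f ->
  exists M : R, forall xi, (1 + dot xi xi) ^+ k * normc (fourier f xi) <= M.
Proof.
elim: k f => [|k IH] f sf.
  by have [M HM] := fourier_bounded sf; exists M => xi; rewrite expr0 mul1r.
(* The transform of f minus its Laplacian is 1 + |xi|^2 times that of f, which gains one power. *)
have sg : schwartz (fun x => f x + (- 1) * laplacian f x).
  by apply: schwartz_add => //; apply: schwartz_scale; exact: schwartz_laplacian.
have [M HM] := IH _ sg; exists M => xi; have := HM xi.
rewrite fourierD //; last by apply: schwartz_scale; exact: schwartz_laplacian.
rewrite fourierZ; last exact: schwartz_laplacian.
rewrite fourier_laplacian // mulN1r mulNr opprK -{1}[fourier f xi]mul1r -mulrDl.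
rewrite (_ : 1 + (dot xi xi)%:C = (1 + dot xi xi)%:C); last by rewrite rmorphD.
rewrite normcM normc_real ger0_norm ?addr_ge0 ?dot_ge0 //.
by rewrite exprSr mulrA.
Qed.

Lemma rapid_fourier f : schwartz f -> rapid (fourier f).
Proof.
move=> sf k; have [M HM] := fourier_dot_bounded k sf.
exists (2 ^+ k * M) => x.
apply: (@le_trans _ _ (2 ^+ k * ((1 + dot x x) ^+ k * normc (fourier f x)))); last first.
  by apply: ler_wpM2l; [rewrite exprn_ge0|exact: HM].
rewrite mulrA -exprMn; apply: ler_wpM2r; first exact: normc_ge0.
rewrite lerXn2r ?nnegrE //.
- by rewrite ltW // enorm1_gt0.
- by rewrite mulr_ge0 // addr_ge0 // dot_ge0.
- rewrite -enorm_sq; have := sqr_ge0 (enorm x - 1); have := enorm_ge0 x; nra.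
Qed.

Lemma schwartz_fourier f : schwartz f -> schwartz (fourier f).
Proof.
move=> sf; apply/schwartzP.
(* The transforms of all Schwartz functions form an invariant class: a derivative of a transform is
   the transform of - i x_j f. *)
exists (fun g => exists2 f, schwartz f & g = fourier f); split; first by exists f.
move=> _ [g sg ->]; split=> [|i]; first exact: rapid_fourier.
exists (fourier (fun x => imag (- (tnth x i : R)) * g x)).
  by exists (fun x => imag (- (tnth x i : R)) * g x) => //; exact: schwartz_coord.
by move=> xi; exact: is_pd_fourier.
Qed.

Lemma schwartz_dot f : schwartz f -> schwartz (fun x => (dot x x)%:C * f x).
Proof. by apply: schwartz_slow_mul; exact: smooth_slow_dot. Qed.

Lemma laplacian_fourier f xi : schwartz f ->
  laplacian (fourier f) xi = - fourier (fun x => (dot x x)%:C * f x) xi.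
Proof.
move=> sf.
have E1 i g : schwartz g -> partial i (fourier g) =
    fourier (fun x => imag (- (tnth x i : R)) * g x).
  by move=> sg; apply/funext => x; apply: is_pd_partial; exact: is_pd_fourier.
rewrite /laplacian.
have E2 i : partial i (partial i (fourier f)) xi =
    fourier (fun x => (- 1) * ((tnth x i : R)%:C * (tnth x i : R)%:C * f x)) xi.
  rewrite E1 // E1; last exact: schwartz_coord.
  congr fourier; apply/funext => x; rewrite mulrA [RHS]mulrA; congr (_ * _).
  by apply: complex_ext; rewrite !cpartsE; ring.
under eq_bigr do rewrite E2.
have s1 i : schwartz (fun x => (tnth x i : R)%:C * (tnth x i : R)%:C * f x).
  by apply: schwartz_slow_mul => //; apply: smooth_slow_mul; exact: smooth_slow_coord.
rewrite -fourier_sum; last by move=> i; exact: schwartz_scale.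
rewrite -[RHS]mulN1r -fourierZ; last exact: schwartz_dot.
congr fourier; apply/funext => x; rewrite -mulr_sumr -mulr_suml /dot rmorph_sum.
by congr (_ * (_ * _)); apply: eq_bigr => i _; rewrite rmorphM.
Qed.

(** The product bound makes every section integrable, not merely almost every one, so the inner
    real-valued integrals agree everywhere with the extended ones of Fubini's theorem. *)
Lemma Rintegral_fubini (a : E * E -> R) (M : R) : measurable_fun setT a ->
  (forall x y, `|a (x, y)| <= M * decay x * decay y) ->
  \int[mu]_x \int[mu]_y a (x, y) = \int[mu]_y \int[mu]_x a (x, y).
Proof.
move=> ma ba.
have i1 x : mu.-integrable setT (EFin \o (fun y => a (x, y))).
  apply: (@decay_integrable _ _ _ (M * decay x)); last exact: ba.
  exact: measurableT_comp ma (measurable_pair1 x).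
have i2 y : mu.-integrable setT (EFin \o (fun x => a (x, y))).
  apply: (@decay_integrable _ _ _ (M * decay y)).
    exact: measurableT_comp ma (measurable_pair2 y).
  by move=> x; rewrite mulrAC; exact: ba.
have mE : measurable_fun setT (fun z : E * E => (a z)%:E) by exact/measurable_EFinP.
have iP : (mu \x mu)%E.-integrable setT (fun z : E * E => (a z)%:E).
  apply/integrable12ltyP => //.
  apply: (@le_lt_trans _ _ (\int[mu]_x ((`|M| * \int[mu]_y decay y)%:E * (decay x)%:E)))%E; last first.
    rewrite integralZl //; last exact: integrable_decay.
    have /fineK <- := integrable_fin_num measurableT (@integrable_decay R n).
    by rewrite -EFinM ltry.
  apply: ge0_le_integral => //.
  - by move=> x _; apply: integral_ge0.
  - by apply: (@measurable_fun_fubini_tonelli_F _ _ _ _ _ mu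
      (fun z : E * E => `|(a z)%:E|)%E) => //; exact: measurableT_comp.
  - by apply/measurable_EFinP; apply: measurable_funM => //; exact: measurable_decay.
  move=> x _.
  have dI := integrable_scale_decay (`|M| * decay x).
  apply: (@le_trans _ _ (\int[mu]_y (`|M| * decay x * decay y)%:E)%E).
    apply: ge0_le_integral => //; first by have /integrable_abse /integrableP[] := i1 x.
      by case/integrableP : dI.
    move=> y _; rewrite lee_fin; apply: le_trans (ba x y) _.
    by rewrite -!mulrA; apply: ler_wpM2r (ler_norm _); rewrite mulr_ge0 // ltW // decay_gt0.
  under eq_integral do rewrite EFinM.
  rewrite integralZl //; last exact: integrable_decay.
  have /fineK <- := integrable_fin_num measurableT (@integrable_decay R n).
  by rewrite -!EFinM lee_fin mulrAC /Rintegral.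
have /(congr1 fine) := @Fubini _ _ _ _ _ mu mu _ iP.
rewrite /Rintegral => H.
rewrite (_ : (\int[mu]_x (fine (\int[mu]_y (a (x, y))%:E))%:E) =
  (\int[mu]_x \int[mu]_y (a (x, y))%:E))%E; last first.
  by apply: eq_integral => x _; rewrite fineK //; exact: (integrable_fin_num measurableT (i1 x)).
rewrite H; congr fine.
by apply: eq_integral => y _; rewrite fineK //; exact: (integrable_fin_num measurableT (i2 y)).
Qed.

Lemma measurable_dot2 : measurable_fun setT (fun z : E * E => dot z.1 z.2).
Proof.
rewrite /dot; apply: measurable_sum => i; apply: measurable_funM.
  exact: measurableT_comp (measurable_coord i) measurable_fst.
exact: measurableT_comp (measurable_coord i) measurable_snd.
Qed.

(** Both sides are iterated integrals of the kernel f(x) g(y) exp(- i x.y), in the two orders. *)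
Lemma fourier_multiplication f g : schwartz f -> schwartz g ->
  cintegral (fun y => fourier f y * g y) = cintegral (fun x => f x * fourier g x).
Proof.
move=> sf sg.
pose K (z : E * E) := f z.1 * g z.2 * cis (dot z.1 z.2).
have [Mf Mf0 Hf] := rapid_decay_Re (schwartz_rapid sf).
have [Mg Mg0 Hg] := rapid_decay_Re (schwartz_rapid sg).
have bK x y : normc (K (x, y)) <= Mf * Mg * decay x * decay y.
  rewrite /K !normcM normc_cis mulr1.
  rewrite (_ : Mf * Mg * decay x * decay y = (Mf * decay x) * (Mg * decay y)); last by ring.
  by apply: ler_pM => //; exact: normc_ge0.
have [mf1 mf2] := schwartz_measurable sf.
have [mg1 mg2] := schwartz_measurable sg.
have mc : measurable_fun setT (fun z : E * E => cos (dot z.1 z.2)).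
  apply: measurableT_comp measurable_dot2; exact: continuous_measurable_fun (@continuous_cos R).
have ms : measurable_fun setT (fun z : E * E => - sin (dot z.1 z.2)).
  apply: measurable_funN.
  apply: measurableT_comp measurable_dot2; exact: continuous_measurable_fun (@continuous_sin R).
have mf1' := measurableT_comp mf1 (@measurable_fst _ _ E E).
have mf2' := measurableT_comp mf2 (@measurable_fst _ _ E E).
have mg1' := measurableT_comp mg1 (@measurable_snd _ _ E E).
have mg2' := measurableT_comp mg2 (@measurable_snd _ _ E E).
have mK1 : measurable_fun setT (fun z => complex.Re (K z)).
  under eq_fun do rewrite !cpartsE.
  by apply: measurable_funB; apply: measurable_funM => //;
    [apply: measurable_funB|apply: measurable_funD]; apply: measurable_funM.
have mK2 : measurable_fun setT (fun z => complex.Im (K z)).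
  under eq_fun do rewrite !cpartsE.
  by apply: measurable_funD; apply: measurable_funM => //;
    [apply: measurable_funB|apply: measurable_funD]; apply: measurable_funM.
have E1 y : fourier f y * g y = cintegral (fun x => K (x, y)).
  rewrite mulrC -cintegralZ; last exact: schwartz_cintegrable (schwartz_cis y sf).
  by apply: eq_cintegral => x; rewrite /K /= mulrA (mulrC (f x)).
have E2 x : f x * fourier g x = cintegral (fun y => K (x, y)).
  rewrite -cintegralZ; last exact: schwartz_cintegrable (schwartz_cis x sg).
  by apply: eq_cintegral => y; rewrite /K /= mulrA (dotC y x).
rewrite (eq_cintegral E1) (eq_cintegral E2).
apply: complex_ext.
  rewrite [LHS]Re_cintegral; apply/esym.
  apply: (@Rintegral_fubini (fun z => complex.Re (K z)) (Mf * Mg)) => // x y.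
  exact: le_trans (ler_Re_normc _) (bK x y).
rewrite [LHS]Im_cintegral; apply/esym.
apply: (@Rintegral_fubini (fun z => complex.Im (K z)) (Mf * Mg)) => // x y.
exact: le_trans (ler_Im_normc _) (bK x y).
Qed.

End fourier_transform.

(** * Fourier inversion and the Plancherel identity *)

Section fourier_inversion.
Context {R : realType} {n : nat}.
Notation E := (Rn R n).
Notation mu := (lebesgue_Rn R n).
Notation leb := (@lebesgue_measure R).
Notation C := (R[i]).
Implicit Types (f g : E -> C) (x y xi : E) (i : 'I_n).

Definition vsub x y : E := [tuple (tnth x j : R) - (tnth y j : R) | j < n].

Lemma tnth_vsub x y j : tnth (vsub x y) j = (tnth x j : R) - (tnth y j : R).
Proof. by rewrite tnth_mktuple. Qed.

Lemma dot_vsub x y z : dot x (vsub y z) = dot x y - dot x z.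
Proof. by rewrite /dot -sumrB; apply: eq_bigr => i _; rewrite tnth_vsub mulrBr. Qed.

Lemma measurable_gauss1 (c m : R) :
  measurable_fun setT (fun t : measurableTypeR R => expR (- (c * (t - m) ^+ 2)) : R).
Proof.
apply: measurableT_comp => //; apply: measurable_funN; apply: measurable_funM => //.
by apply: measurable_funX; apply: measurable_funB.
Qed.

Lemma integral_gauss1 (c m : R) : 0 < c ->
  (\int[leb]_t (expR (- (c * (t - m) ^+ 2)))%:E = (Num.sqrt (pi / c))%:E)%E.
Proof.
(* With this standard deviation the integrand is sqrt(pi / c) times a normal density of mean m. *)
move=> c0; pose s := Num.sqrt (2 * c)^-1.
have s2 : s ^+ 2 = (2 * c)^-1 by rewrite sqr_sqrtr // invr_ge0 mulr_ge0 // ltW.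
have s0 : s != 0 by rewrite gt_eqF // sqrtr_gt0 invr_gt0 mulr_gt0.
have p0 : pi / c != 0 :> R by rewrite gt_eqF // divr_gt0 // pi_gt0.
have E1 t : expR (- (c * (t - m) ^+ 2)) = Num.sqrt (pi / c) * normal_pdf m s t.
  rewrite normal_pdfE // /normal_peak /normal_fun s2.
  have -> : (2 * c)^-1 * pi *+ 2 = pi / c by field; rewrite gt_eqF.
  rewrite mulVKf; last by rewrite gt_eqF // sqrtr_gt0 divr_gt0 // pi_gt0.
  by congr expR; field; rewrite gt_eqF.
under eq_integral do rewrite E1 EFinM.
rewrite ge0_integralZl //; last 2 first.
- by apply/measurable_EFinP; exact: measurable_normal_pdf.
- by move=> x _; rewrite lee_fin normal_pdf_ge0.
by rewrite integral_normal_pdf mule1.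
Qed.

Definition gaussR (c : R) x : R := expR (- (c * dot x x)).

Lemma gaussR_ge0 c x : 0 <= gaussR c x. Proof. exact: expR_ge0. Qed.

Lemma gaussR_prod c x xi : gaussR c (vsub x xi) =
  \prod_(i < n) expR (- (c * ((tnth x i : R) - (tnth xi i : R)) ^+ 2)).
Proof.
rewrite /gaussR -expR_sum; congr expR; rewrite sumrN; congr (- _).
by rewrite /dot mulr_sumr; apply: eq_bigr => i _; rewrite tnth_vsub expr2.
Qed.

Lemma measurable_gaussR c xi : measurable_fun setT (fun x : E => gaussR c (vsub x xi)).
Proof.
under eq_fun do rewrite gaussR_prod.
exact: (@measurable_prod_coord _ n (fun i t => expR (- (c * (t - (tnth xi i : R)) ^+ 2)))
  (fun i => measurable_gauss1 c (tnth xi i))).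
Qed.

Lemma integral_gaussR c xi : 0 < c ->
  (\int[mu]_x (gaussR c (vsub x xi))%:E = (Num.sqrt (pi / c) ^+ n)%:E)%E.
Proof.
move=> c0; under eq_integral do rewrite gaussR_prod.
rewrite (integral_prod (f := fun i t => expR (- (c * (t - (tnth xi i : R)) ^+ 2)))
  (c := fun=> Num.sqrt (pi / c))).
- by rewrite prodr_const card_ord.
- by move=> i; exact: measurable_gauss1.
- by move=> i t; exact: expR_ge0.
- by move=> i; exact: integral_gauss1.
Qed.

Lemma integrable_gaussR c xi : 0 < c ->
  mu.-integrable setT (EFin \o (fun x => gaussR c (vsub x xi))).
Proof.
move=> c0; apply/integrableP; split; first by apply/measurable_EFinP; exact: measurable_gaussR.
under eq_integral => x _ do rewrite gee0_abs ?lee_fin ?gaussR_ge0 //.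
by rewrite integral_gaussR // ltry.
Qed.

Lemma Rintegral_gaussR c xi : 0 < c ->
  \int[mu]_x gaussR c (vsub x xi) = Num.sqrt (pi / c) ^+ n.
Proof. by move=> c0; rewrite /Rintegral integral_gaussR. Qed.

Definition origin : E := [tuple 0 | j < n].

Lemma vsub_origin x : vsub x origin = x.
Proof. by apply: eq_from_tnth => j; rewrite !tnth_mktuple subr0. Qed.

Lemma dot_origin x : dot x origin = 0.
Proof. by rewrite /dot big1 // => i _; rewrite tnth_mktuple mulr0. Qed.

Lemma zero_pd_constant f : (forall i x, is_pd i f x 0) -> forall x y, f x = f y.
Proof.
move=> df x y.
have H (g : E -> R) : (forall i x, is_derive (0 : R) (1 : R) (fun h => g (shift_coord x i h)) 0) ->
    g x = g y.
  move=> dg; have := @partials_bounded_lipschitz _ _ g (fun _ _ => 0) 0 dg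
    (fun _ _ => eq_ind_r (fun z => z <= 0) (lexx 0) (normr0 R)) y x.
  by rewrite mul0r normr_le0 subr_eq0 => /eqP.
apply: complex_ext.
  by apply: (H (fun x => complex.Re (f x))) => i z; exact: (df i z).1.
by apply: (H (fun x => complex.Im (f x))) => i z; exact: (df i z).2.
Qed.

(* The transform g of a Gaussian satisfies grad g = - (xi / 2c) g. *)
Lemma fourier_gaussian c xi : 0 < c ->
  fourier (gaussian c) xi = (Num.sqrt (pi / c) ^+ n)%:C * gaussian (4 * c)^-1 xi.
Proof.
move=> c0; have c0' : c != 0 by rewrite gt_eqF.
have sG : schwartz (gaussian c : E -> C) by exact: schwartz_gaussian.
set G := fourier (gaussian c : E -> C).
have dG i eta : is_pd i G eta ((- ((tnth eta i : R) / (2 * c)))%:C * G eta).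
  have H := is_pd_fourier i eta sG.
  have P := fourier_partial i eta sG.
  have E1 : partial i (gaussian c : E -> C) =
      fun x => imag (- (2 * c)) * (imag (- (tnth x i : R)) * gaussian c x).
    apply/funext => x; apply: is_pd_partial.
    have := is_pd_gaussian i c x.
    rewrite (_ : (- (2 * c * (tnth x i : R)))%:C =
      imag (- (2 * c)) * imag (- (tnth x i : R))); last first.
      by apply: complex_ext; rewrite !cpartsE; ring.
    by rewrite -mulrA.
  have sH := schwartz_coord i sG.
  rewrite E1 fourierZ // -/G in P.
  rewrite (_ : _ * G eta = fourier (fun x => imag (- (tnth x i : R)) * gaussian c x) eta) //.
  apply: (@mulfI _ (imag (- (2 * c)))).
    by rewrite eq_complex /= negb_and orbC oppr_eq0 mulf_neq0.
  rewrite P mulrA; congr (_ * _).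
  by apply: complex_ext; rewrite !cpartsE; field.
(* The transform divided by the expected Gaussian has zero gradient, hence is constant; its value at
   the origin is the integral of the original Gaussian. *)
pose q eta : C := G eta * gaussian (- (4 * c)^-1) eta.
have dq i eta : is_pd i q eta 0.
  have := is_pdM (dG i eta) (is_pd_gaussian i (- (4 * c)^-1) eta).
  rewrite (_ : _ + _ = 0) //.
  set a := (- (_ / _))%:C; set b := (- (2 * _ * _))%:C.
  have -> : b = - a.
    by apply: complex_ext; rewrite !cpartsE; field.
  by rewrite mulNr mulrN mulrCA mulrA addrN.
have qc := zero_pd_constant dq xi origin.
have g1 eta : gaussian (- (4 * c)^-1) eta * gaussian (4 * c)^-1 eta = 1 :> C.
  by rewrite /gaussian -rmorphM -expRD -opprD -mulrDl addNr mul0r oppr0 expR0.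
have -> : G xi = q xi * gaussian (4 * c)^-1 xi by rewrite /q -mulrA g1 mulr1.
rewrite qc; congr (_ * _).
rewrite /q (_ : gaussian _ origin = 1) ?mulr1; last first.
  by rewrite /gaussian dot_origin mulr0 oppr0 expR0.
rewrite /G fourierE; apply: complex_ext; rewrite ?Re_cintegral ?Im_cintegral.
  rewrite -(Rintegral_gaussR origin c0); apply: eq_Rintegral => x _.
  by rewrite dot_origin !cpartsE sin0 cos0 vsub_origin mulr1 oppr0 mulr0 subr0.
rewrite (@eq_Rintegral _ _ _ mu setT (fun=> 0)); first by rewrite Rintegral_cst // mul0r.
by move=> x _; rewrite dot_origin !cpartsE sin0 oppr0 mulr0 mul0r addr0.
Qed.

Lemma cisJ_cis (a b : R) : cis a * (cis b)^*%C = cis (a - b).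
Proof. by apply: complex_ext; rewrite !cpartsE ?cosB ?sinB; ring. Qed.

(** Its transform is a Gaussian centred at xi, of width of order sqrt(c) and total mass (2 pi)^n: an
    approximate identity as c tends to 0. *)
Definition modulated_gaussian c xi x : C := (cis (dot x xi))^*%C * gaussian c x.

Lemma schwartz_modulated_gaussian c xi : 0 < c -> schwartz (modulated_gaussian c xi).
Proof.
move=> c0; apply: schwartz_slow_mul; last exact: schwartz_gaussian.
by apply: smooth_inJ; [exact: slowJ|exact: smooth_slow_cis].
Qed.

Lemma fourier_modulated_gaussian c xi y : 0 < c ->
  fourier (modulated_gaussian c xi) y =
  (Num.sqrt (pi / c) ^+ n)%:C * (gaussR (4 * c)^-1 (vsub y xi))%:C.
Proof.
move=> c0; rewrite -[RHS](fourier_gaussian (vsub y xi) c0).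
rewrite !fourierE; apply: eq_cintegral => x.
by rewrite dot_vsub -cisJ_cis /modulated_gaussian; ring.
Qed.

Lemma schwartz_lipschitz f : schwartz f -> exists2 L : R, 0 <= L &
  forall x y, normc (f y - f x) <= L * enorm (vsub y x).
Proof.
move=> sf.
have [L L0 HL] : exists2 L : R, 0 <= L & forall i x, normc (partial i f x) <= L.
  have /choice[M HM] : forall i : 'I_n, exists M : R, forall x, normc (partial i f x) <= M.
    move=> i; have [M HM] := schwartz_rapid (schwartz_partial i sf) 0%N.
    by exists M => x; have := HM x; rewrite expr0 mul1r.
  exists (\sum_i `|M i|); first exact: sumr_ge0.
  move=> i x; apply: le_trans (HM i x) _.
  by rewrite (bigD1 i) //=; apply: le_trans (ler_norm _) _; rewrite lerDl sumr_ge0.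
exists (2 * L * n%:R); first by rewrite !mulr_ge0.
move=> x y.
have S : \sum_(i < n) `|(tnth y i : R) - (tnth x i : R)| <= n%:R * enorm (vsub y x).
  apply: (@le_trans _ _ (\sum_(i < n) enorm (vsub y x))); last first.
    by rewrite sumr_const card_ord mulr_natl.
  by apply: ler_sum => i _; rewrite -tnth_vsub; exact: coord_le_enorm.
have H1 := @partials_bounded_lipschitz _ _ (fun x => complex.Re (f x)) _ L
  (fun i x => (schwartz_pd i x sf).1) (fun i x => le_trans (ler_Re_normc _) (HL i x)) x y.
have H2 := @partials_bounded_lipschitz _ _ (fun x => complex.Im (f x)) _ L
  (fun i x => (schwartz_pd i x sf).2) (fun i x => le_trans (ler_Im_normc _) (HL i x)) x y.
apply: le_trans (normc_le_parts _) _; rewrite !cpartsE.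
apply: le_trans (lerD H1 H2) _.
rewrite -mulrDl (_ : L + L = 2 * L); last by ring.
rewrite -[X in _ <= X]mulrA.
by apply: ler_wpM2l => //; rewrite mulr_ge0.
Qed.

(** With u = |x| / sqrt(8 c), the Gaussian on the left is the square of exp(- u^2); one of the two
    factors absorbs u. *)
Lemma enorm_gaussR c x : 0 < c ->
  enorm x * gaussR (4 * c)^-1 x <= Num.sqrt (8 * c) * gaussR (8 * c)^-1 x.
Proof.
move=> c0; have k0 : 0 < 8 * c by rewrite mulr_gt0.
have r0 : 0 < Num.sqrt (8 * c) by rewrite sqrtr_gt0.
set u := enorm x / Num.sqrt (8 * c).
have E1 : enorm x = Num.sqrt (8 * c) * u by rewrite /u mulrC divfK // gt_eqF.
have u2 : u ^+ 2 = dot x x / (8 * c) by rewrite /u expr_div_n enorm_sq sqr_sqrtr // ltW.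
have -> : gaussR (4 * c)^-1 x = expR (- u ^+ 2) * expR (- u ^+ 2).
  by rewrite -expRD /gaussR u2; congr expR; field; rewrite gt_eqF.
have -> : gaussR (8 * c)^-1 x = expR (- u ^+ 2).
  by rewrite /gaussR u2; congr expR; rewrite mulrC.
rewrite E1 -mulrA; apply: ler_wpM2l; first exact: ltW.
rewrite mulrA; apply: ler_piMl; first exact: expR_ge0.
rewrite expRN ler_pdivrMr ?expR_gt0 // mul1r.
have := expR_ge1Dx (u ^+ 2); have := sqr_ge0 (u - 1); nra.
Qed.

Definition fourier_const : R := (2 * pi) ^+ n.

Lemma fourier_const_gt0 : 0 < fourier_const.
Proof. by rewrite exprn_gt0 // mulr_gt0 // pi_gt0. Qed.

Lemma schwartz_smooth_slow f : schwartz f -> smooth_slow f.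
Proof.
move=> sf; exists (@schwartz R n); split => // g sg; split.
  have [N HN] := schwartz_rapid sg 0%N.
  by exists 0, N => x; have := HN x; rewrite expr0 mul1r mulr1.
by move=> i; exists (partial i g) => [|x]; [exact: schwartz_partial|exact: (schwartz_pd i x sg)].
Qed.

Lemma schwartz_mul f g : schwartz f -> schwartz g -> schwartz (fun x => f x * g x).
Proof. by move=> /schwartz_smooth_slow; exact: schwartz_slow_mul. Qed.

Lemma schwartz_cisJ g xi : schwartz g -> schwartz (fun x => g x * (cis (dot x xi))^*%C).
Proof.
move=> sg; under eq_fun do rewrite mulrC; apply: schwartz_slow_mul => //.
by apply: smooth_inJ; [exact: slowJ|exact: smooth_slow_cis].
Qed.

(** By the multiplication formula the integral is an average of f around xi at scale sqrt(c), and f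
    is Lipschitz. *)
Lemma regularized_inversion f xi : schwartz f -> exists2 B : R, 0 <= B &
  forall c, 0 < c ->
    normc (cintegral (fun x => fourier f x * modulated_gaussian c xi x) -
      fourier_const%:C * f xi) <= B * Num.sqrt c.
Proof.
move=> sf; have [L L0 HL] := schwartz_lipschitz sf.
(* L is the Lipschitz constant, sqrt(8) comes from [enorm_gaussR], and the n-th power is the
   prefactor (pi / c)^(n/2) times the mass (8 pi c)^(n/2) of the wider Gaussian; the powers of c
   cancel. *)
pose B := 2 * (L * (Num.sqrt 8 * Num.sqrt (8 * pi ^+ 2) ^+ n)).
exists B; first by rewrite !mulr_ge0 ?sqrtr_ge0 ?exprn_ge0 ?sqrtr_ge0.
move=> c c0.
have p0 : 0 < pi :> R by exact: pi_gt0.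
have q0 : 0 < (4 * c)^-1 by rewrite invr_gt0 mulr_gt0.
have q8 : 0 < (8 * c)^-1 by rewrite invr_gt0 mulr_gt0.
have sm := schwartz_modulated_gaussian xi c0.
rewrite fourier_multiplication //.
set A := Num.sqrt (pi / c) ^+ n.
have A0 : 0 <= A by rewrite exprn_ge0 // sqrtr_ge0.
pose w y := A * gaussR (4 * c)^-1 (vsub y xi).
have Ew : (fun y => (w y)%:C) = fourier (modulated_gaussian c xi).
  by apply/funext => y; rewrite fourier_modulated_gaussian // /w rmorphM.
have sw : schwartz (fun y => (w y)%:C) by rewrite Ew; exact: schwartz_fourier.
have iw := schwartz_cintegrable sw.
have ifw := schwartz_cintegrable (schwartz_mul sf sw).
have Iw : cintegral (fun y => (w y)%:C) = fourier_const%:C.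
  apply: complex_ext; rewrite ?Re_cintegral ?Im_cintegral /=; last first.
    by rewrite Rintegral_cst // mul0r.
  rewrite RintegralZl //; last exact: integrable_gaussR.
  rewrite Rintegral_gaussR // /A -exprMn -sqrtrM ?divr_ge0 ?(ltW p0) ?(ltW c0) //.
  rewrite (_ : pi / c * (pi / (4 * c)^-1) = (2 * pi) ^+ 2); last by field; rewrite gt_eqF.
  by rewrite sqrtr_sqr ger0_norm // mulr_ge0 // ltW.
have E1 : cintegral (fun x => f x * fourier (modulated_gaussian c xi) x) -
    fourier_const%:C * f xi = cintegral (fun y => f y * (w y)%:C + (- f xi) * (w y)%:C).
  rewrite -Iw mulrC -mulNr -Ew -cintegralZ // -cintegralD //; exact: cintegrableZ.
rewrite E1.
have iB : mu.-integrable setT (EFin \o (fun y => L * (A * (Num.sqrt (8 * c) * gaussR (8 * c)^-1 (vsub y xi))))).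
  rewrite (_ : _ \o _ = fun y => ((L * (A * Num.sqrt (8 * c)))%:E * (gaussR (8 * c)^-1 (vsub y xi))%:E)%E).
    by apply: integrableZl => //; exact: integrable_gaussR.
  by apply/funext => y /=; rewrite -EFinM !mulrA.
apply: le_trans (normc_cintegral_le _ iB _) _.
- by apply: cintegrableD => //; exact: cintegrableZ.
- move=> y; rewrite -mulrDl normcM normc_real ger0_norm; last by rewrite mulr_ge0 // gaussR_ge0.
  apply: (@le_trans _ _ (L * enorm (vsub y xi) * (A * gaussR (4 * c)^-1 (vsub y xi)))).
    by apply: ler_wpM2r (HL _ _); rewrite mulr_ge0 // gaussR_ge0.
  rewrite (_ : _ * (A * _) = L * (A * (enorm (vsub y xi) * gaussR (4 * c)^-1 (vsub y xi)))); last by ring.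
  by apply: ler_wpM2l => //; apply: ler_wpM2l => //; exact: enorm_gaussR.
rewrite le_eqVlt; apply/orP; left; apply/eqP.
under eq_Rintegral do rewrite !mulrA.
rewrite RintegralZl //; last exact: integrable_gaussR.
rewrite Rintegral_gaussR // /B (sqrtrM c) //.
rewrite (_ : 8 * pi ^+ 2 = (pi / c) * (pi / (8 * c)^-1)); last by field; rewrite gt_eqF.
rewrite (sqrtrM (pi / _^-1)) ?divr_ge0 ?(ltW p0) ?(ltW c0) // exprMn /A.
by ring.
Qed.

(** The error is at most the integral of c |x|^2 |g|, because 1 - exp(- r) <= r. *)
Lemma gaussian_regularization g xi : schwartz g -> exists2 B : R, 0 <= B &
  forall c, 0 < c ->
    normc (cintegral (fun x => g x * modulated_gaussian c xi x) -
      cintegral (fun x => g x * (cis (dot x xi))^*%C)) <= B * c.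
Proof.
move=> sg; have [M M0 HM] := rapid_decay_Re (schwartz_rapid (schwartz_dot sg)).
exists (2 * \int[mu]_x (M * decay x)).
  by rewrite mulr_ge0 // Rintegral_ge0 // => x _; rewrite mulr_ge0 // ltW // decay_gt0.
move=> c c0.
have sJ := schwartz_cisJ xi sg.
have sM := schwartz_mul sg (schwartz_modulated_gaussian xi c0).
have -> : cintegral (fun x => g x * modulated_gaussian c xi x) -
      cintegral (fun x => g x * (cis (dot x xi))^*%C) =
    cintegral (fun x => g x * modulated_gaussian c xi x + (- 1) * (g x * (cis (dot x xi))^*%C)).
  rewrite cintegralD; last 2 first.
  - exact: schwartz_cintegrable.
  - exact: schwartz_cintegrable (schwartz_scale _ sJ).
  by rewrite cintegralZ ?mulN1r //; exact: schwartz_cintegrable.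
rewrite mulrAC -mulrA -RintegralZl //; last exact: integrable_scale_decay.
apply: normc_cintegral_le.
- by apply: cintegrableD; apply: schwartz_cintegrable => //; exact: schwartz_scale.
- rewrite (_ : _ \o _ = fun x => ((c * M)%:E * (decay x)%:E)%E).
    by apply: integrableZl => //; exact: integrable_decay.
  by apply/funext => x; rewrite /= mulrA.
move=> x.
rewrite (_ : _ + _ = g x * (cis (dot x xi))^*%C * (gaussian c x - 1)); last first.
  by rewrite /modulated_gaussian; ring.
rewrite !normcM normcJ normc_cis mulr1.
have -> : gaussian c x - 1 = (gaussR c x - 1)%:C by rewrite rmorphB.
rewrite normc_real.
have g1 : `|gaussR c x - 1| <= c * dot x x.
  rewrite distrC ger0_norm; last first.
    by rewrite subr_ge0 /gaussR -expR0 ler_expR oppr_le0 mulr_ge0 ?dot_ge0 // ltW.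
  have := expR_ge1Dx (- (c * dot x x)); rewrite /gaussR; lra.
apply: (@le_trans _ _ (normc (g x) * (c * dot x x))).
  by apply: ler_wpM2l => //; exact: normc_ge0.
rewrite mulrCA; apply: ler_wpM2l; first exact: ltW.
have := HM x; rewrite normcM normc_real ger0_norm ?dot_ge0 //.
by rewrite mulrC.
Qed.

Theorem fourier_inversion f xi : schwartz f ->
  cintegral (fun x => fourier f x * (cis (dot x xi))^*%C) = fourier_const%:C * f xi.
Proof.
move=> sf.
have [B1 B10 H1] := regularized_inversion xi sf.
have [B2 B20 H2] := gaussian_regularization xi (schwartz_fourier sf).
apply/eqP; rewrite -subr_eq0; apply/eqP; apply: eq0_normc.
apply/eqP; rewrite eq_le normc_ge0 andbT.
apply/ler_addgt0Pl => e e0; rewrite addr0.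
(* For c = d^2 with d <= 1 the two errors are at most B1 d and B2 d^2 <= B2 d. *)
pose d := Num.min 1 (e / (B1 + B2 + 1)).
have b0 : 0 < B1 + B2 + 1 by rewrite ltr_wpDl // addr_ge0.
have d0 : 0 < d by rewrite lt_min ltr01 divr_gt0.
have d1 : d <= 1 by rewrite ge_min lexx.
have de : d * (B1 + B2 + 1) <= e by rewrite -ler_pdivlMr // ge_min lexx orbT.
have := H1 (d ^+ 2) (exprn_gt0 _ d0); have := H2 (d ^+ 2) (exprn_gt0 _ d0).
rewrite sqrtr_sqr (ger0_norm (ltW d0)).
set I1 := cintegral _; set I2 := cintegral _ => h2 h1.
have -> : I2 - fourier_const%:C * f xi = (I1 - fourier_const%:C * f xi) - (I1 - I2).
  by ring.
apply: le_trans (le_normcD _ _) _; rewrite normcN.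
have d2 : d ^+ 2 <= d by rewrite expr2 ler_piMl // ltW.
apply: le_trans (lerD h1 h2) _; apply: le_trans de.
by have := ler_wpM2l B20 d2; lra.
Qed.

(** The inversion formula conjugated: the inverse kernel becomes the kernel of [fourier] itself. *)
Lemma fourierJ_fourier g xi : schwartz g ->
  fourier (fun x => (fourier g x)^*%C) xi = fourier_const%:C * (g xi)^*%C.
Proof.
move=> sg; have := congr1 (@conjc R) (fourier_inversion xi sg).
rewrite -cintegralJ; last first.
  by apply: schwartz_cintegrable; apply: schwartz_cisJ; exact: schwartz_fourier.
rewrite cJM conjc_real => <-; apply: eq_cintegral => x.
by rewrite cJM conjcK.
Qed.

(** The multiplication formula for g and the conjugate of its transform, followed by inversion. *)
Theorem plancherel g : schwartz g ->
  \int[mu]_x (normc (fourier g x) ^+ 2) = fourier_const * \int[mu]_x (normc (g x) ^+ 2).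
Proof.
move=> sg; have sF := schwartzJ (schwartz_fourier sg).
have E1 (a : C) : complex.Re (a * a^*%C) = normc a ^+ 2.
  by rewrite normc_sq !cpartsE; ring.
have := congr1 (@complex.Re R) (fourier_multiplication sg sF).
rewrite !Re_cintegral.
under eq_Rintegral do rewrite E1.
move=> ->.
have i2 : mu.-integrable setT (EFin \o (fun x => normc (g x) ^+ 2)).
  have [M M0 HM] := rapid_decay_Re (schwartz_rapid sg).
  have [N HN] := schwartz_rapid sg 0%N.
  have [m1 m2] := schwartz_measurable sg.
  apply: (@decay_integrable _ _ _ (N * M)).
    under eq_fun do rewrite normc_sq.
    by apply: measurable_funD; apply: measurable_funX.
  move=> x; rewrite ger0_norm ?sqr_ge0 // expr2 -mulrA; apply: ler_pM.
  - exact: normc_ge0.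
  - exact: normc_ge0.
  - by have := HN x; rewrite expr0 mul1r.
  - exact: HM.
rewrite -RintegralZl //; apply: eq_Rintegral => x _.
rewrite fourierJ_fourier // mulrCA !cpartsE normc_sq; ring.
Qed.

End fourier_inversion.

(** * Square-integrable functions *)

Section square_integrable.
Context d (T : measurableType d) (R : realType).
Variable mu : {measure set T -> \bar R}.
Implicit Types f g h : T -> R.

Definition l2 f := measurable_fun setT f /\ mu.-integrable setT (EFin \o (fun x => f x ^+ 2)).
Definition nsq f : R := \int[mu]_x (f x ^+ 2).
Definition ip f g : R := \int[mu]_x (f x * g x).

Lemma l2_ip_integrable f g : l2 f -> l2 g -> mu.-integrable setT (EFin \o (fun x => f x * g x)).
Proof.
move=> [mf intf] [mg intg].
apply: (@le_integrable _ _ _ _ _ _ _ (fun x => (f x ^+ 2)%:E + (g x ^+ 2)%:E)%E) => //.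
- by apply/measurable_EFinP; exact: measurable_funM.
- move=> x _; rewrite /= lee_fin [leRHS]ger0_norm ?addr_ge0 ?sqr_ge0 // ler_norml.
  have := sqr_ge0 (f x - g x); have := sqr_ge0 (f x + g x).
  have := sqr_ge0 (f x); have := sqr_ge0 (g x); nra.
- exact: integrableD.
Qed.

Lemma l2D f g : l2 f -> l2 g -> l2 (fun x => f x + g x).
Proof.
move=> lf lg; have [mf intf] := lf; have [mg intg] := lg.
split; first exact: measurable_funD.
rewrite (_ : _ \o _ = fun x => ((f x ^+ 2)%:E + (2%:E * (f x * g x)%:E + (g x ^+ 2)%:E))%E).
  apply: integrableD => //; apply: integrableD => //; apply: integrableZl => //.
  exact: l2_ip_integrable.
by apply/funext => x /=; rewrite -EFinM -!EFinD; congr EFin; ring.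
Qed.

Lemma l2Z c f : l2 f -> l2 (fun x => c * f x).
Proof.
move=> [mf intf]; split; first by apply: measurable_funM.
rewrite (_ : _ \o _ = fun x => ((c ^+ 2)%:E * (f x ^+ 2)%:E)%E).
  exact: integrableZl.
by apply/funext => x /=; rewrite -EFinM exprMn.
Qed.

Lemma l2B f g : l2 f -> l2 g -> l2 (fun x => f x - g x).
Proof.
move=> lf lg; have := l2D lf (l2Z (-1) lg).
by under [X in l2 X -> _]eq_fun do rewrite mulN1r.
Qed.

Lemma nsq_ge0 f : 0 <= nsq f.
Proof. by apply: Rintegral_ge0 => x _; exact: sqr_ge0. Qed.

Lemma ipC f g : ip f g = ip g f.
Proof. by apply: eq_Rintegral => x _; rewrite mulrC. Qed.

Lemma ipDl f g h : l2 f -> l2 g -> l2 h -> ip (fun x => f x + g x) h = ip f h + ip g h.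
Proof.
move=> lf lg lh; rewrite /ip -RintegralD //; last 2 first.
- exact: l2_ip_integrable.
- exact: l2_ip_integrable.
by apply: eq_Rintegral => x _; rewrite mulrDl.
Qed.

Lemma ipZl c f h : l2 f -> l2 h -> ip (fun x => c * f x) h = c * ip f h.
Proof.
move=> lf lh; rewrite /ip -RintegralZl //; last exact: l2_ip_integrable.
by apply: eq_Rintegral => x _; rewrite mulrA.
Qed.

Lemma ipBl f g h : l2 f -> l2 g -> l2 h -> ip (fun x => f x - g x) h = ip f h - ip g h.
Proof.
move=> lf lg lh; rewrite /ip -RintegralB //; last 2 first.
- exact: l2_ip_integrable.
- exact: l2_ip_integrable.
by apply: eq_Rintegral => x _; rewrite mulrBl.
Qed.

Lemma nsqDZ c f g : l2 f -> l2 g ->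
  nsq (fun x => f x + c * g x) = nsq f + 2 * c * ip f g + c ^+ 2 * nsq g.
Proof.
move=> lf lg; have [mf intf] := lf; have [mg intg] := lg.
have ifg := l2_ip_integrable lf lg.
have i1 : mu.-integrable setT (EFin \o (fun x => 2 * c * (f x * g x))).
  rewrite (_ : _ \o _ = fun x => ((2 * c)%:E * (f x * g x)%:E)%E) //.
  exact: integrableZl.
have i2 : mu.-integrable setT (EFin \o (fun x => c ^+ 2 * g x ^+ 2)).
  rewrite (_ : _ \o _ = fun x => ((c ^+ 2)%:E * (g x ^+ 2)%:E)%E) //.
  exact: integrableZl.
have i3 : mu.-integrable setT (EFin \o (fun x => f x ^+ 2 + 2 * c * (f x * g x))).
  rewrite (_ : _ \o _ = fun x => ((f x ^+ 2)%:E + (2 * c * (f x * g x))%:E)%E) //.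
  exact: integrableD.
rewrite /nsq /ip -!RintegralZl // -RintegralD // -RintegralD //.
by apply: eq_Rintegral => x _; ring.
Qed.

Lemma cauchy_schwarz f g : l2 f -> l2 g -> ip f g ^+ 2 <= nsq f * nsq g.
Proof.
move=> lf lg.
have H c : 0 <= nsq f + 2 * c * ip f g + c ^+ 2 * nsq g.
  by rewrite -nsqDZ //; exact: nsq_ge0.
have f0 := nsq_ge0 f; have g0 := nsq_ge0 g.
have [gz|gnz] := eqVneq (nsq g) 0.
  rewrite gz mulr0; have [->|nz] := eqVneq (ip f g) 0; first by rewrite expr0n.
  (* When g has norm 0 the quadratic polynomial in c is affine; this c would give it the value -
     1. *)
  have := H (- (nsq f + 1) / (2 * ip f g)); rewrite gz mulr0 addr0.
  rewrite (_ : 2 * _ * ip f g = - (nsq f + 1)); last by field.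
  by lra.
(* The minimum of the quadratic polynomial. *)
have := H (- ip f g / nsq g).
rewrite (_ : _ + _ = nsq f - ip f g ^+ 2 / nsq g); last by field.
by rewrite subr_ge0 ler_pdivrMr // lt0r gnz.
Qed.

Lemma geometric_cauchy (u : R^nat) (b : R) : 0 <= b ->
  (forall k, `|u k.+1 - u k| <= b * 2^-1 ^+ k) ->
  cvgn u /\ forall k, `|u k - limn u| <= 2 * b * 2^-1 ^+ k.
Proof.
move=> b0 H.
have p0 k : 0 <= b * 2^-1 ^+ k by rewrite mulr_ge0 // exprn_ge0 // invr_ge0.
(* The exact partial sum of the geometric series is kept, so that the induction on m closes. *)
have bnd m k : `|u (k + m)%N - u k| <= 2 * (b * 2^-1 ^+ k) - 2 * (b * 2^-1 ^+ (k + m)).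
  elim: m => [|m IH]; first by rewrite addn0 !subrr normr0.
  rewrite addnS -(subrK (u (k + m)%N) (u (k + m).+1)) -addrA.
  apply: le_trans (ler_normD _ _) _.
  apply: le_trans (lerD (H (k + m)%N) IH) _.
  rewrite exprS; have := p0 (k + m)%N; lra.
have bnd2 m k : `|u (k + m)%N - u k| <= 2 * b * 2^-1 ^+ k.
  by apply: le_trans (bnd m k) _; have := p0 (k + m)%N; rewrite -mulrA; lra.
have c0 : (fun k => 2 * b * 2^-1 ^+ k) @ \oo --> (0 : R).
  rewrite -[X in _ --> X](mulr0 (2 * b)); apply: cvgM; first exact: cvg_cst.
  by apply: cvg_expr; rewrite ger0_norm ?invr_ge0 // invf_lt1 // ltr1n.
have cu : cvgn u.
  apply: cauchy_cvg; apply: cauchy_exP => e e0.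
  have /cvgrPdist_lt /(_ _ e0) [N _ HN] := c0.
  have HN' := HN N (leqnn N); rewrite /= sub0r normrN in HN'.
  exists (u N); exists N => // k /= Nk; rewrite /ball /= distrC.
  rewrite -(subnKC Nk); apply: le_lt_trans (bnd2 _ _) _.
  exact: le_lt_trans (ler_norm _) HN'.
split => // k.
have ck : (fun m => `|u k - u (m + k)%N|) @ \oo --> `|u k - limn u|.
  apply: cvg_norm; apply: cvgB; first exact: cvg_cst.
  by move: cu; rewrite -(cvg_shiftn k).
apply: (cvgr_to_le ck).
by near=> m; rewrite distrC addnC; exact: bnd2.
Unshelve. all: by end_near. Qed.

(** Riesz-Fischer with explicit rates. The squared increments, weighted by 4^k, have integrals at
    most 2^- k, so their sum G is finite almost everywhere; where it is finite, the increments are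
    at most sqrt(G) 2^- k and the sequence converges pointwise. *)
Lemma l2_complete (f : nat -> T -> R) : (forall k, l2 (f k)) ->
  (forall k, nsq (fun x => f k.+1 x - f k x) <= 8^-1 ^+ k) ->
  exists2 h, l2 h & (fun k => nsq (fun x => f k x - h x)) @ \oo --> (0 : R).
Proof.
move=> lf Hf.
pose D k x := f k.+1 x - f k x.
have lD k : l2 (D k) by exact: l2B.
pose G x := (\sum_(0 <= k <oo) (4 ^+ k * D k x ^+ 2)%:E)%E.
have t0 k x : (0 <= (4 ^+ k * D k x ^+ 2)%:E)%E.
  by rewrite lee_fin mulr_ge0 ?sqr_ge0 // exprn_ge0.
have mt k : measurable_fun setT (fun x => (4 ^+ k * D k x ^+ 2)%:E).
  apply/measurable_EFinP; apply: measurable_funM => //; apply: measurable_funX.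
  by have [] := lD k.
have mG : measurable_fun setT G by apply: ge0_emeasurable_sum.
have G0 x : (0 <= G x)%E by apply: nneseries_ge0 => k _ _.
have IG : (\int[mu]_x G x <= 2%:E)%E.
  rewrite integral_nneseries //.
  apply: (@le_trans _ _ (\sum_(0 <= k <oo) (2^-1 ^+ k)%:E)%E).
    apply: lee_nneseries => // k _; first by rewrite integral_ge0.
    have -> : (\int[mu]_x (4 ^+ k * D k x ^+ 2)%:E = (4 ^+ k * nsq (D k))%:E)%E.
      under eq_integral do rewrite EFinM.
      have [_ iD] := lD k.
      by rewrite integralZl // EFinM /nsq /Rintegral fineK //; exact: (integrable_fin_num measurableT iD).
    rewrite lee_fin; apply: (@le_trans _ _ (4 ^+ k * 8^-1 ^+ k)).
      by apply: ler_wpM2l; [rewrite exprn_ge0|exact: Hf].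
    by rewrite -exprMn (_ : 4 / 8 = 2^-1 :> R); last by field.
  apply: lime_le; first by apply: is_cvg_nneseries => k _ _; rewrite lee_fin exprn_ge0 // invr_ge0.
  near=> N; rewrite sumEFin lee_fin big_mkord.
  have -> : \sum_(i < N) 2^-1 ^+ i = 2 - 2 * 2^-1 ^+ N :> R.
    elim: {+}N => [|m IH]; first by rewrite big_ord0 expr0; ring.
    by rewrite big_ord_recr /= IH exprS; field.
  by rewrite lerBlDr lerDl mulr_ge0 // exprn_ge0 // invr_ge0.
(* Off this set of full measure the functions are replaced by 0, so that the limit exists at every
   point and is measurable. *)
pose S := [set x | (G x < +oo)%E].
have mS : measurable S.
  rewrite (_ : S = setT `&` [set x | (G x < +oo)%E]); last by rewrite setTI.
  exact: emeasurable_fun_infty_o.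
have muS : mu (~` S) = 0.
  have iG : mu.-integrable setT G.
    apply/integrableP; split => //; under eq_integral do rewrite gee0_abs //.
    by apply: le_lt_trans IG _; rewrite ltry.
  have [N [mN N0 sN]] := integrable_ae measurableT iG.
  apply/eqP; rewrite -measure_le0 -N0; apply: le_measure; rewrite ?inE //.
    exact: measurableC.
  move=> x /= Sx; apply: sN => /= /(_ I) fG; apply: Sx.
  by rewrite /S /= -ge0_fin_numE.
pose fS k := f k \_ S.
pose h x := limn (fun k => fS k x).
(* The bound is the square of the geometric tail 2 sqrt(G) 2^- k. *)
have key x : (fun k => fS k x) @ \oo --> h x /\
    forall k, (fS k x - h x) ^+ 2 <= 4 * 4^-1 ^+ k * fine (G x).
  rewrite /h /fS /patch; case: (boolP (x \in S)) => [/set_mem xS|xS]; last first.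
    split; first by rewrite lim_cst //; exact: cvg_cst.
    move=> k; rewrite lim_cst // subrr expr0n /= !mulr_ge0 ?fine_ge0 //.
  pose b := Num.sqrt (fine (G x)).
  have b2 : b ^+ 2 = fine (G x) by rewrite sqr_sqrtr // fine_ge0.
  have b0 : 0 <= b by exact: sqrtr_ge0.
  have Hb k : `|f k.+1 x - f k x| <= b * 2^-1 ^+ k.
    have p0 : 0 < 2^-1 ^+ k :> R by rewrite exprn_gt0 // invr_gt0.
    rewrite -(@ler_pXn2r _ 2) ?nnegrE ?mulr_ge0 ?(ltW p0) //.
    rewrite real_normK ?num_real // exprMn b2 -ler_pdivrMr ?exprn_gt0 //.
    rewrite -exprM mulnC exprM exprVn (_ : 2 ^+ 2 = 4 :> R); last by ring.
    rewrite exprVn invrK.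
    rewrite -lee_fin fineK ?ge0_fin_numE // mulrC.
    apply: le_trans (nneseries_lim_ge k.+1 _); last by move=> j _ _; exact: t0.
    rewrite big_nat_recr //= leeDr //.
    by apply: sume_ge0 => j _; exact: t0.
  have [cu lu] := geometric_cauchy b0 Hb.
  split=> // k.
  rewrite -real_normK ?num_real //.
  apply: (@le_trans _ _ ((2 * b * 2^-1 ^+ k) ^+ 2)).
    by rewrite lerXn2r ?nnegrE ?mulr_ge0 ?exprn_ge0 ?invr_ge0 //; exact: lu.
  have Q : 2^-1 ^+ k ^+ 2 = 4^-1 ^+ k :> R.
    by rewrite -exprM mulnC exprM; congr (_ ^+ k); field.
  rewrite exprMn Q exprMn b2 (_ : 2 ^+ 2 = 4 :> R); last by ring.
  by rewrite mulrAC.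
have mfS k : measurable_fun setT (fS k).
  apply/measurable_restrict => //; have [mf _] := lf k.
  exact: measurable_funS mf.
have mh : measurable_fun setT h.
  apply: (measurable_fun_cvg mfS) => x _; exact: (key x).1.
have aeS : {ae mu, forall x, S x} by exists (~` S); split => //; exact: measurableC.
(* The pointwise bound is integrated, the integral of G being at most 2. *)
have intk k : (\int[mu]_x ((f k x - h x) ^+ 2)%:E <= (8 * 4^-1 ^+ k)%:E)%E.
  rewrite (ae_eq_integral (fun x => ((fS k x - h x) ^+ 2)%:E)) //; last 3 first.
  - by apply/measurable_EFinP; apply: measurable_funX; apply: measurable_funB => //; have [] := lf k.
  - by apply/measurable_EFinP; apply: measurable_funX; exact: measurable_funB.
  - by apply: filterS aeS => x Sx _; rewrite /fS /patch mem_set.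
  apply: (@le_trans _ _ (\int[mu]_x ((4 * 4^-1 ^+ k)%:E * G x))%E).
    apply: ae_ge0_le_integral => //.
    - by move=> x _; rewrite lee_fin sqr_ge0.
    - by apply/measurable_EFinP; apply: measurable_funX; exact: measurable_funB.
    - by move=> x _; rewrite mule_ge0 // lee_fin mulr_ge0 // exprn_ge0 // invr_ge0.
    - exact: measurable_funeM.
    apply: filterS aeS => x Sx _.
    have EG : G x = (fine (G x))%:E by rewrite fineK // ge0_fin_numE.
    rewrite EG -EFinM lee_fin; exact: (key x).2.
  rewrite ge0_integralZl //.
  apply: (@le_trans _ _ ((4 * 4^-1 ^+ k)%:E * 2%:E)%E).
    by apply: lee_wpmul2l => //; rewrite lee_fin mulr_ge0 // exprn_ge0 // invr_ge0.
  by rewrite -EFinM lee_fin mulrAC (_ : 4 * 2 = 8 :> R); last by ring.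
have lh0 k : l2 (fun x => f k x - h x).
  split; first by apply: measurable_funB => //; have [] := lf k.
  apply/integrableP; split.
    by apply/measurable_EFinP; apply: measurable_funX; apply: measurable_funB => //; have [] := lf k.
  under eq_integral do rewrite gee0_abs ?lee_fin ?sqr_ge0 //.
  by apply: le_lt_trans (intk k) _; rewrite ltry.
exists h.
  have := l2B (lf 0%N) (lh0 0%N).
  by under [X in l2 X -> _]eq_fun do rewrite subKr.
have c0 : (fun k => 8 * 4^-1 ^+ k) @ \oo --> (0 : R).
  rewrite -[X in _ --> X](mulr0 8); apply: cvgM; first exact: cvg_cst.
  by apply: cvg_expr; rewrite ger0_norm ?invr_ge0 // invf_lt1 // ltr1n.
apply: (squeeze_cvgr _ (cvg_cst 0) c0).
near=> k; rewrite nsq_ge0 /= -lee_fin /nsq /Rintegral fineK; first exact: intk.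
have [_ ih] := lh0 k; exact: (integrable_fin_num measurableT ih).
Unshelve. all: by end_near. Qed.

End square_integrable.

Lemma cvg_sqr (R : realType) (u : R^nat) (l : R) :
  u @ \oo --> l -> (fun k => u k ^+ 2) @ \oo --> l ^+ 2.
Proof. by move=> H; rewrite expr2; under eq_fun do rewrite expr2; exact: cvgM. Qed.

(** * Riesz representation of a bounded functional on a linear subspace *)

Section riesz_representation.
Context d (T : measurableType d) (R : realType).
Variable mu : {measure set T -> \bar R}.
Implicit Types f g h : T -> R.
Notation l2 := (l2 mu).
Notation ip := (ip mu).
Notation nsq := (nsq mu).

Lemma ip_cvg (f : nat -> T -> R) h g : (forall k, l2 (f k)) -> l2 h -> l2 g ->
  (fun k => nsq (fun x => f k x - h x)) @ \oo --> (0 : R) ->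
  (fun k => ip (f k) g) @ \oo --> ip h g.
Proof.
move=> lf lh lg H; apply/cvgrPdist_le => e e0.
have N0 : 0 < nsq g + 1 by rewrite ltr_wpDl ?nsq_ge0.
have d0 : 0 < e ^+ 2 / (nsq g + 1) by rewrite divr_gt0 // exprn_gt0.
have /cvgrPdist_le /(_ _ d0) := H; apply: filterS => k.
rewrite sub0r normrN ger0_norm ?nsq_ge0 // ler_pdivlMr // => Hk.
rewrite distrC -ipBl // -(@ler_pXn2r _ 2) ?nnegrE ?(ltW e0) //.
rewrite real_normK ?num_real //.
apply: le_trans (cauchy_schwarz (l2B (lf k) lh) lg) _; apply: le_trans Hk.
by apply: ler_wpM2l; [exact: nsq_ge0|rewrite lerDl].
Qed.

Lemma nsq_cvg (f : nat -> T -> R) h : (forall k, l2 (f k)) -> l2 h ->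
  (fun k => nsq (fun x => f k x - h x)) @ \oo --> (0 : R) ->
  (fun k => nsq (f k)) @ \oo --> nsq h.
Proof.
move=> lf lh H.
have E k : nsq (f k) = nsq (fun x => f k x - h x) + (ip (f k) h + ip (f k) h) - nsq h.
  have := nsqDZ (-1) (lf k) lh; rewrite sqrrN expr1n mul1r.
  under [X in nsq X = _ -> _]eq_fun do rewrite mulN1r.
  by move=> ->; ring.
have -> : (fun k => nsq (f k)) =
    (fun k => nsq (fun x => f k x - h x) + (ip (f k) h + ip (f k) h) - nsq h).
  by apply/funext => k.
suff : (fun k => nsq (fun x => f k x - h x) + (ip (f k) h + ip (f k) h) - nsq h) @ \oo -->
    0 + (ip h h + ip h h) - ip h h by rewrite add0r addrK.
apply: cvgB; last exact: cvg_cst.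
by apply: cvgD => //; apply: cvgD; exact: ip_cvg.
Qed.

Variables (S : (T -> R) -> Prop) (phi : (T -> R) -> R) (C : R).
Hypotheses (S_l2 : forall f, S f -> l2 f) (S_inhab : exists f, S f).
Hypothesis S_lin : forall c f g, S f -> S g -> S (fun x => f x + c * g x).
Hypothesis phi_lin : forall c f g, S f -> S g ->
  phi (fun x => f x + c * g x) = phi f + c * phi g.
Hypothesis phi_bounded : forall f, S f -> phi f ^+ 2 <= C * nsq f.
Hypothesis C_ge0 : 0 <= C.

(* The representing function minimizes |f|^2 - 2 phi f over the closure of S. *)
Lemma riesz_subspace : exists h, [/\ l2 h, nsq h <= C & forall f, S f -> phi f = ip h f].
Proof.
pose J f := nsq f - 2 * phi f.
(* J is bounded below since 2 |phi f| <= 2 sqrt(C nsq f) <= C + nsq f. *)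
have Jge f : S f -> - C <= J f.
  move=> Sf; rewrite /J; have := phi_bounded Sf; have := nsq_ge0 mu f.
  set N := nsq f; set t := phi f => N0 H.
  have [t0|t0] := leP (2 * t) (C + N); first by lra.
  have CN0 : 0 <= C + N by rewrite addr_ge0.
  have : (C + N) ^+ 2 < (2 * t) ^+ 2.
    by rewrite ltr_pXn2r // nnegrE ?CN0 // (le_trans CN0 (ltW t0)).
  have := sqr_ge0 (C - N); nra.
have hJ : has_inf (J @` S).
  split; first by have [f Sf] := S_inhab; exists (J f), f.
  by exists (- C) => _ [f Sf <-]; exact: Jge.
pose m := inf (J @` S).
have mle f : S f -> m <= J f by move=> Sf; apply: ge_inf; [exact: hJ.2|exists f].
have JDZ c f g : S f -> S g ->
    J (fun x => f x + c * g x) = J f + 2 * c * (ip f g - phi g) + c ^+ 2 * nsq g.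
  move=> Sf Sg; rewrite /J nsqDZ ?phi_lin //; [by ring|exact: S_l2|exact: S_l2].
(* A minimizing sequence, fast enough for consecutive squared distances to stay below the 8^- k that
   [l2_complete] requires. *)
have /choice[f Hf] : forall k : nat, exists f, S f /\ J f <= m + 4^-1 * 8^-1 ^+ k.
  move=> k; have e0 : 0 < 4^-1 * 8^-1 ^+ k :> R.
    by rewrite mulr_gt0 ?invr_gt0 // exprn_gt0 // invr_gt0.
  have [_ [f Sf <-] /ltW Hf] := inf_adherent e0 hJ.
  by exists f.
have Sf k := (Hf k).1.
have lf k := S_l2 (Sf k).
have Hfm k : J (f k) <= m + 4^-1 * 8^-1 ^+ k := (Hf k).2.
(* Parallelogram identity: at the midpoint J is the mean of its two values minus a quarter of the
   squared distance, and it is at least m. *)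
have Cf k : nsq (fun x => f k.+1 x - f k x) <= 8^-1 ^+ k.
  pose dk x := f k.+1 x + (-1) * f k x.
  have Sd : S dk by exact: S_lin.
  have E1 := JDZ 1 (f k) dk (Sf k) Sd.
  have E2 := JDZ 2^-1 (f k) dk (Sf k) Sd.
  have M2 := mle _ (S_lin 2^-1 (Sf k) Sd).
  have Ek : (fun x => f k x + 1 * dk x) = f k.+1.
    by apply/funext => x; rewrite /dk; ring.
  have -> : (fun x => f k.+1 x - f k x) = dk.
    by apply/funext => x; rewrite /dk; ring.
  rewrite Ek expr1n !mul1r mulr1 in E1.
  have H1 := Hfm k; have H2 := Hfm k.+1; rewrite exprS in H2.
  rewrite E2 in M2.
  have p0 : 0 <= 8^-1 ^+ k :> R by rewrite exprn_ge0 // invr_ge0.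
  have q : (2^-1 : R) ^+ 2 = 4^-1 by field.
  rewrite q in M2; lra.
have [h lh ch] := l2_complete lf Cf.
have eps0 : (fun k => 4^-1 * 8^-1 ^+ k) @ \oo --> (0 : R).
  rewrite -[X in _ --> X](mulr0 4^-1); apply: cvgM; first exact: cvg_cst.
  by apply: cvg_expr; rewrite ger0_norm ?invr_ge0 // invf_lt1 // ltr1n.
have rep g : S g -> phi g = ip h g.
  move=> Sg; have lg := S_l2 Sg.
  have c1 := ip_cvg lf lh lg ch.
  have N0 : 0 < nsq g + 1 by rewrite ltr_wpDl ?nsq_ge0.
  (* Moving from f k along g with coefficient - b / (nsq g + 1) lowers J by at least b^2 / (nsq g +
     1), and J cannot drop below m. The + 1 covers a g of norm 0. *)
  have b2 k : (ip (f k) g - phi g) ^+ 2 <= (nsq g + 1) * (4^-1 * 8^-1 ^+ k).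
    set b := ip (f k) g - phi g.
    have := mle _ (S_lin (- b / (nsq g + 1)) (Sf k) Sg).
    rewrite JDZ // -/b => H1.
    have H2 := Hfm k.
    set e := 4^-1 * _ in H2 *.
    have : b ^+ 2 / (nsq g + 1) <= e; last by rewrite ler_pdivrMr // mulrC.
    have E3 : 2 * (- b / (nsq g + 1)) * b + (- b / (nsq g + 1)) ^+ 2 * nsq g =
       - (b ^+ 2 / (nsq g + 1)) - b ^+ 2 / (nsq g + 1) ^+ 2.
      by field; rewrite gt_eqF.
    have : 0 <= b ^+ 2 / (nsq g + 1) ^+ 2 by rewrite divr_ge0 ?sqr_ge0.
    lra.
  have c2 : (fun k => (ip (f k) g - phi g) ^+ 2) @ \oo --> (ip h g - phi g) ^+ 2.
    by apply: cvg_sqr; apply: cvgB => //; exact: cvg_cst.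
  have c3 : (fun k => (nsq g + 1) * (4^-1 * 8^-1 ^+ k)) @ \oo --> (0 : R).
    rewrite -[X in _ --> X](mulr0 (nsq g + 1)).
    by apply: cvgM => //; exact: cvg_cst.
  have : (ip h g - phi g) ^+ 2 <= 0.
    apply: (ler_cvg_to c2 c3); exact: nearW.
  rewrite le_eqVlt ltNge sqr_ge0 orbF sqrf_eq0 subr_eq0 => /eqP ->.
  by [].
exists h; split => //.
have n0 := nsq_ge0 mu h.
have [->|nz] := eqVneq (nsq h) 0; first by [].
have np : 0 < nsq h by rewrite lt0r nz.
(* h is only a limit of elements of S: the bound on phi is applied to f k, where phi (f k) is the
   product of h and f k, and the limit is (nsq h)^2 <= C nsq h. *)
have c1 : (fun k => ip (f k) h ^+ 2) @ \oo --> nsq h ^+ 2.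
  by apply: cvg_sqr; exact: ip_cvg.
have c2 : (fun k => C * nsq (f k)) @ \oo --> C * nsq h.
  by apply: cvgM; [exact: cvg_cst|exact: nsq_cvg].
rewrite -(ler_pM2r np) -expr2; apply: (ler_cvg_to c1 c2); apply: nearW => k.
by rewrite ipC -rep //; exact: phi_bounded.
Qed.

End riesz_representation.

(** * Separation by Schwartz functions *)

Section orthants.
Context {R : realType} {n : nat}.
Notation E := (Rn R n).
Notation mu := (lebesgue_Rn R n).
Notation C := (R[i]).

Definition orthant (a : E) : set E := [set x | forall i, (tnth a i : R) < tnth x i].

Definition orthants : set (set E) := [set A | exists a, A = orthant a].

Lemma measurable_orthant a : measurable (orthant a).
Proof.
have -> : orthant a = \bigcap_(i in [set: 'I_n]) (fun x : E => (tnth x i : R)) @^-1` `](tnth a i : R), +oo[%classic.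
  apply/seteqP; split => [x H i _ /=|x H i]; first by rewrite in_itv /= andbT; exact: H.
  by have := H i I; rewrite /= in_itv /= andbT.
apply: fin_bigcap_measurable => // i _.
by rewrite -[X in measurable X]setTI; exact: measurable_coord.
Qed.

Lemma setI_closed_orthants : setI_closed orthants.
Proof.
move=> _ _ [a ->] [b ->].
exists [tuple Num.max (tnth a i : R) (tnth b i : R) | i < n].
apply/seteqP; split => [x [H1 H2] i|x H].
  by rewrite tnth_mktuple gt_max H1 H2.
by split => i; have := H i; rewrite tnth_mktuple gt_max => /andP[].
Qed.

(** Together with stability under intersection, this lets Dynkin's theorem pass from orthants to all
    measurable sets. *)
Lemma measurable_orthantsE : @measurable _ E = <<s orthants >>.
Proof.
apply/seteqP; split; last first.
  apply: smallest_sub; first exact: sigma_algebra_measurable.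
  by move=> _ [a ->]; exact: measurable_orthant.
pose T' := g_sigma_algebraType orthants.
have mid : measurable_fun [set: T'] (fun x : T' => x : E).
  apply/measurable_fun_tnthP => i.
  apply: (@measurability _ _ T' (measurableTypeR R) setT _ _ (RGenOInfty.measurableE R)) => _ [_ [c ->] <-].
  rewrite setTI.
  (* A half-space is the increasing union of orthants whose remaining thresholds - m tend to minus
     infinity. *)
  have -> : (@tnth n (measurableTypeR R) ^~ i \o (fun x : T' => x : E)) @^-1` `]c, +oo[ =
      \bigcup_m orthant [tuple if j == i then c else - m%:R | j < n].
    apply/seteqP; split => [x /=|x [m _ H] /=].
      rewrite in_itv /= andbT => cx.
      have [m Hm] : exists m : nat, enorm (x : E) < m%:R.
        exists (Num.truncn (enorm (x : E))).+1; exact: truncnS_gt.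
      exists m => // j; rewrite tnth_mktuple; case: eqP => [->//|_].
      have := coord_le_enorm (x : E) j; rewrite ler_norml => /andP[+ _].
      by apply: lt_le_trans; rewrite ltrN2.
    by have := H i; rewrite tnth_mktuple eqxx in_itv /= andbT.
  apply: (@bigcupT_measurable _ T') => m; apply: sub_sigma_algebra.
  by eexists.
move=> A mA; have := mid (@measurableT _ T') A mA.
by rewrite setTI.
Qed.

(* A smooth step that tends to the indicator of ]0, +oo[ at every point, 0 included. *)
Definition step (j : nat) (t : R) : R := (1 + expR (- (j%:R ^+ 2 * (t - j%:R^-1))))^-1.

Lemma step_ge0 j t : 0 <= step j t.
Proof. by rewrite invr_ge0 addr_ge0 // expR_ge0. Qed.

Lemma step_le1 j t : step j t <= 1.
Proof. by rewrite invf_le1 ?lerDl ?expR_ge0 // ltr_wpDr // expR_ge0. Qed.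

Lemma step_cvg t : (fun j => step j.+1 t) @ \oo --> (if 0 < t then 1 else 0 : R).
Proof.
have expS (j : nat) : expR (- j.+1%:R) <= j.+1%:R^-1 :> R.
  rewrite expRN lef_pV2 ?posrE ?expR_gt0 //.
  by have := expR_ge1Dx (j.+1%:R : R); apply: le_trans; rewrite lerDr.
(* With J = j + 1 the exponent is J (1 - J t): at least J when t <= 0, at most - J as soon as J t >=
   2. The offset 1 / J in [step] is what settles t = 0. *)
have -> : (fun j => step j.+1 t) =
    (fun j => (1 + expR (j.+1%:R * (1 - j.+1%:R * t)))^-1).
  apply/funext => j; rewrite /step; congr ((1 + expR _)^-1).
  have : j.+1%:R != 0 :> R by rewrite pnatr_eq0.
  by move: (j.+1%:R : R) => J J0; field.
have h0 := @cvg_harmonic R.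
case: ltP => [t0|t0].
  apply/cvgrPdist_le => e e0.
  have [M HM] : exists M : nat, 2 <= M%:R * t.
    exists (Num.truncn (2 / t)).+1; rewrite -ler_pdivrMr //; exact: ltW (truncnS_gt _).
  have /cvgrPdist_le /(_ e e0) := h0.
  apply: filterS2 (nbhs_infty_ge M) => j Mj.
  rewrite sub0r normrN ger0_norm ?invr_ge0 // => He.
  set x := expR _.
  have x0 : 0 < x by exact: expR_gt0.
  have x1 : x <= j.+1%:R^-1.
    apply: le_trans (expS j); rewrite ler_expR.
    have : M%:R * t <= j.+1%:R * t.
      by rewrite ler_pM2r // ler_nat (leq_trans Mj).
    have : 0 < j.+1%:R :> R by rewrite ltr0n.
    by move=> j0 Mt; rewrite -mulrN1 ler_pM2l //; lra.
  rewrite (_ : 1 - (1 + x)^-1 = x / (1 + x)); last by field; rewrite gt_eqF // ltr_wpDr // ltW.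
  have x2 : 0 < 1 + x by rewrite addr_gt0.
  rewrite ger0_norm ?(divr_ge0 (ltW x0) (ltW x2)) // ler_pdivrMr //.
  by have := le_trans x1 He; nra.
apply/cvgrPdist_le => e e0.
have /cvgrPdist_le /(_ e e0) := h0.
apply: filterS => j; rewrite !sub0r !normrN ger0_norm ?invr_ge0 // => He.
have x1 : j.+1%:R <= expR (j.+1%:R * (1 - j.+1%:R * t)).
  have jp : 0 <= j.+1%:R :> R by [].
  apply: (@le_trans _ _ (expR j.+1%:R)).
    by have := expR_ge1Dx (j.+1%:R : R); apply: le_trans; rewrite lerDr.
  by rewrite ler_expR; have : j.+1%:R * t <= 0 by [rewrite mulr_ge0_le0]; nra.
have j0 : 0 < j.+1%:R :> R by rewrite ltr0n.
rewrite ger0_norm; last by rewrite invr_ge0 addr_ge0 // expR_ge0.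
have x2 : 0 < 1 + expR (j.+1%:R * (1 - j.+1%:R * t)) by rewrite ltr_pwDl // expR_ge0.
apply: le_trans He; rewrite /harmonic lef_pV2 ?posrE ?j0 ?x2 //.
by apply: le_trans x1 _; rewrite lerDr.
Qed.

Definition box_step (j : nat) (a x : E) : R :=
  \prod_(i < n) step j ((tnth x i : R) - (tnth a i : R)).

Lemma box_step_bound j a x : `|box_step j a x| <= 1.
Proof.
rewrite /box_step ger0_norm; last by apply: prodr_ge0 => i _; exact: step_ge0.
have : 0 <= box_step j a x <= 1; last by case/andP.
rewrite /box_step; apply: (big_ind (fun z : R => 0 <= z <= 1)).
- by rewrite ler01 lexx.
- move=> y z /andP[y0 y1] /andP[z0 z1].
  by rewrite mulr_ge0 //= mulr_ile1.
- by move=> i _; rewrite step_ge0 step_le1.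
Qed.

Lemma box_step_cvg a x :
  (fun j => box_step j.+1 a x) @ \oo --> (\1_(orthant a) x : R).
Proof.
have -> : \1_(orthant a) x = \prod_(i < n) (if 0 < (tnth x i : R) - (tnth a i : R) then 1 else 0) :> R.
  rewrite indicE; have [xa|xa] := pselect (orthant a x).
    rewrite mem_set // big1 // => i _; rewrite subr_gt0; by rewrite (xa i).
  rewrite memNset //; have [i Hi] : exists i, ~~ ((tnth a i : R) < tnth x i).
    by apply/existsP; apply: contra_notT xa; rewrite negb_exists => /forallP H i;
      have := H i; rewrite negbK.
  by rewrite (bigD1 i) //= subr_gt0 (negbTE Hi) mul0r.
rewrite /box_step; elim: (index_enum _) => [|i r IH].
  rewrite big_nil; under eq_fun do rewrite big_nil; exact: cvg_cst.
rewrite big_cons; under eq_fun do rewrite big_cons.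
by apply: cvgM => //; exact: step_cvg.
Qed.

Lemma schwartz_box_step j a : schwartz (fun x : E => (box_step j a x)%:C * gaussian 1 x).
Proof.
apply: schwartz_slow_mul; last exact: schwartz_gaussian.
rewrite /box_step; elim: (index_enum _) => [|i r IH].
  by under eq_fun do rewrite big_nil; exact: smooth_slow_cst.
under eq_fun do rewrite big_cons rmorphM.
apply: smooth_slow_mul => //.
rewrite (_ : (fun x => _) = logistic (j%:R ^+ 2) ((tnth a i : R) + j%:R^-1) i).
  exact: smooth_slow_logistic.
by apply/funext => x; rewrite /logistic /step opprD addrA.
Qed.

(** The product g of h with a Gaussian is integrable. Smooth steps approximate the indicators of
    orthants, so g has integral 0 on each orthant, hence on every measurable set, hence vanishes
    almost everywhere. *)
Lemma schwartz_separates (h : E -> R) : measurable_fun setT h ->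
  (forall phi, schwartz phi -> mu.-integrable setT (EFin \o (fun x => h x * complex.Re (phi x)))) ->
  (forall phi, schwartz phi -> (forall x, complex.Im (phi x) = 0) ->
    \int[mu]_x (h x * complex.Re (phi x)) = 0) ->
  {ae mu, forall x, h x = 0}.
Proof.
move=> mh ih zh.
pose g x := h x * gaussR 1 x.
have sG := @schwartz_gaussian R n 1 ltr01.
have ig : mu.-integrable setT (EFin \o g) := ih _ sG.
have mg : measurable_fun setT g by have /integrableP[/measurable_EFinP] := ig.
have zg : (\int[mu]_x (g x)%:E = 0)%E.
  rewrite -[LHS]fineK; last exact: (integrable_fin_num measurableT ig).
  by have := zh _ sG (fun=> erefl); rewrite /Rintegral => ->.
(* Dominated convergence along the products of steps, with majorant |g|. *)
have zO a : (\int[mu]_(x in orthant a) (g x)%:E = 0)%E.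
  rewrite integral_mkcond.
  have Eb j x : h x * complex.Re ((box_step j a x)%:C * gaussian 1 x) = g x * box_step j a x.
    by rewrite /gaussian !cpartsE /g /gaussR; ring.
  have igb j : mu.-integrable setT (EFin \o (fun x => g x * box_step j.+1 a x)).
    have := ih _ (schwartz_box_step j.+1 a).
    by congr (_.-integrable _ _); apply/funext => x; rewrite [in RHS]/comp -Eb.
  have zgb j : (\int[mu]_x (g x * box_step j.+1 a x)%:E = 0)%E.
    rewrite -[LHS]fineK; last exact: (integrable_fin_num measurableT (igb j)).
    congr EFin; rewrite -[RHS](zh _ (schwartz_box_step j.+1 a)).
      by apply: eq_Rintegral => x _; rewrite Eb.
    by move=> x; rewrite /gaussian !cpartsE mul0r mulr0 addr0.
  have c0 : (fun j => \int[mu]_x (g x * box_step j.+1 a x)%:E)%E @ \oo --> (0 : \bar R).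
    by under eq_fun do rewrite zgb; exact: cvg_cst.
  have [| | | | |_ _ cD] := @dominated_convergence _ E R mu setT measurableT
    (fun j x => (g x * box_step j.+1 a x)%:E) ((EFin \o g) \_ (orthant a)) (fun x => `|g x|%:E).
  - by move=> j; case/integrableP : (igb j).
  - apply/(measurable_restrictT _ (measurable_orthant a)).
    by apply/measurable_EFinP; exact: measurable_funS mg.
  - apply: aeW => x _.
    have -> : ((EFin \o g) \_ (orthant a)) x = (g x * \1_(orthant a) x)%:E.
      by rewrite /patch indicE; case: (x \in _); rewrite ?mulr1 ?mulr0.
    apply: cvg_EFin; first exact: nearW.
    by apply: cvgM; [exact: cvg_cst|exact: box_step_cvg].
  - exact: integrable_norm ig.
  - apply: aeW => x j _; rewrite /= lee_fin normrM.
    by apply: ler_piMr => //; exact: box_step_bound.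
  by apply: cvg_unique cD c0.
have zA (A : set E) : measurable A -> (\int[mu]_(x in A) (g x)%:E = 0)%E.
  move=> mA; have sA : <<s orthants >> A by rewrite -measurable_orthantsE.
  apply: (@dynkin_induction _ E orthants (fun A => \int[mu]_(x in A) (g x)%:E = 0)%E
    measurable_orthantsE setI_closed_orthants _ _ _ _ A sA) => //.
  - by move=> _ [a ->].
  - move=> B mB zB; move: zg; rewrite -(setvU B) integral_setU //.
    + by rewrite zB adde0.
    + exact: measurableC.
    + by apply/measurable_EFinP; exact: measurable_funTS.
    + by rewrite /disj_set setICl.
  - move=> F mF tF zF; rewrite integral_bigcup //.
      by rewrite eseries0.
    by apply: integrableS ig => //; exact: bigcup_measurable.
have H : ae_eq mu setT (EFin \o g) (fun=> 0%E).
  by apply: (integral_ae_eq measurableT ig (measurable_cst _)) => A _ mA; rewrite integral0; exact: zA.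
apply: filterS H => x /(_ I) /= [] /eqP.
by rewrite mulf_eq0 (gt_eqF (expR_gt0 _)) orbF => /eqP.
Qed.

End orthants.

(** * The Fourier transform on L^2 *)

Section fourier_of_L2.
Context {R : realType} {n : nat}.
Notation E := (Rn R n).
Notation mu := (lebesgue_Rn R n).
Notation FC := (@fourier_const R n).
Notation C := (R[i]).
Implicit Types (f g h v : E -> C) (phi : E -> C).

Lemma Lfun2P (f : E -> R) : f \in Lfun mu 2%:E <-> l2 mu f.
Proof.
split=> [Lf|[mf intf]].
  split; first by have := sub_Lfun_mfun Lf; rewrite inE.
  exact: Lfun2_integrable_sqr.
rewrite inE; apply/andP; split; first by rewrite inE.
rewrite inE /finLfun /= /finite_norm unlock /=.
apply: poweR_lty.
have /integrableP[_] := intf; apply: le_lt_trans.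
rewrite le_eqVlt; apply/orP; left; apply/eqP.
apply: eq_integral => x _ /=; rewrite ?poweR_EFin powR_mulrn // real_normK ?num_real //.
by rewrite ger0_norm ?sqr_ge0.
Qed.

Lemma L2P f : L2 f <-> l2 mu (fun x => complex.Re (f x)) /\ l2 mu (fun x => complex.Im (f x)).
Proof. by split=> [[/Lfun2P ? /Lfun2P]|[/Lfun2P ? /Lfun2P]]. Qed.

Definition cnsq f : R := nsq mu (fun x => complex.Re (f x)) + nsq mu (fun x => complex.Im (f x)).

Lemma cnsq_ge0 f : 0 <= cnsq f.
Proof. by rewrite addr_ge0 ?nsq_ge0. Qed.

Lemma cnsqE f : L2 f -> cnsq f = \int[mu]_x (normc (f x) ^+ 2).
Proof.
move=> /L2P[[_ i1] [_ i2]]; rewrite /cnsq /nsq -RintegralD //.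
by apply: eq_Rintegral => x _; rewrite normc_sq.
Qed.

Lemma L2_cmeasurable f : L2 f -> cmeasurable f.
Proof. by move=> /L2P[[? _] [? _]]. Qed.

Lemma L2D f g : L2 f -> L2 g -> L2 (fun x => f x + g x).
Proof.
move=> /L2P[f1 f2] /L2P[g1 g2]; apply/L2P; split.
  by under eq_fun do rewrite cpartsE; exact: l2D.
by under eq_fun do rewrite cpartsE; exact: l2D.
Qed.

Lemma L2Z (c : C) f : L2 f -> L2 (fun x => c * f x).
Proof.
move=> /L2P[f1 f2]; apply/L2P; split.
  by under eq_fun do rewrite cpartsE; apply: l2B; exact: l2Z.
by under eq_fun do rewrite cpartsE; apply: l2D; exact: l2Z.
Qed.

Lemma L2B f g : L2 f -> L2 g -> L2 (fun x => f x - g x).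
Proof.
move=> lf lg; have := L2D lf (L2Z (- 1) lg).
by under [X in L2 X -> _]eq_fun do rewrite mulN1r.
Qed.

Lemma L2J f : L2 f -> L2 (fun x => (f x)^*%C).
Proof.
move=> /L2P[f1 f2]; apply/L2P; split; first by under eq_fun do rewrite cpartsE.
under eq_fun do rewrite cpartsE -mulN1r; exact: l2Z.
Qed.

Lemma schwartz_L2 phi : schwartz phi -> L2 phi.
Proof.
move=> sp.
have [m1 m2] := schwartz_measurable sp.
have [M M0 HM] := rapid_decay_Re (schwartz_rapid sp).
have [N HN] := schwartz_rapid sp 0%N.
have bnd (g : E -> R) : measurable_fun setT g -> (forall x, `|g x| <= normc (phi x)) -> l2 mu g.
  move=> mg gp; split => //; apply: (@decay_integrable _ _ _ (N * M)).
    exact: measurable_funX.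
  move=> x; rewrite normrX expr2 -mulrA; apply: ler_pM => //.
    by apply: le_trans (gp x) _; have := HN x; rewrite expr0 mul1r.
  exact: le_trans (gp x) (HM x).
by apply/L2P; split; apply: bnd => // x; [exact: ler_Re_normc|exact: ler_Im_normc].
Qed.

Lemma L2M_cintegrable f g : L2 f -> L2 g -> cintegrable (fun x => f x * g x).
Proof.
move=> /L2P[f1 f2] /L2P[g1 g2]; split.
  rewrite (_ : (fun x => _) = (fun x => (complex.Re (f x) * complex.Re (g x))%:E -
      (complex.Im (f x) * complex.Im (g x))%:E)%E).
    by apply: integrableB => //; exact: l2_ip_integrable.
  by apply/funext => x; rewrite cpartsE.
rewrite (_ : (fun x => _) = (fun x => (complex.Re (f x) * complex.Im (g x))%:E +
    (complex.Im (f x) * complex.Re (g x))%:E)%E).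
  by apply: integrableD => //; exact: l2_ip_integrable.
by apply/funext => x; rewrite cpartsE.
Qed.

Lemma L2_tempered_fun f : L2 f -> tempered_fun f.
Proof.
move=> lf; split; first exact: L2_cmeasurable.
by move=> phi sp; apply: L2M_cintegrable => //; exact: schwartz_L2.
Qed.

Lemma Re_cintegralM f g : L2 f -> L2 g -> complex.Re (cintegral (fun x => f x * g x)) =
  ip mu (fun x => complex.Re (f x)) (fun x => complex.Re (g x)) -
  ip mu (fun x => complex.Im (f x)) (fun x => complex.Im (g x)).
Proof.
move=> /L2P[f1 f2] /L2P[g1 g2]; rewrite Re_cintegral /ip -RintegralB //.
- by apply: eq_Rintegral => x _; rewrite cpartsE.
- exact: l2_ip_integrable.
- exact: l2_ip_integrable.
Qed.

(** The pairing is bilinear, without conjugation; the factor 2 is that of (p - q)^2 <= 2 p^2 + 2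
    q^2. *)
Lemma Re_cintegralM_bound f g : L2 f -> L2 g ->
  complex.Re (cintegral (fun x => f x * g x)) ^+ 2 <= 2 * cnsq f * cnsq g.
Proof.
move=> lf lg; rewrite Re_cintegralM //.
have /L2P[f1 f2] := lf; have /L2P[g1 g2] := lg.
have := cauchy_schwarz f1 g1; have := cauchy_schwarz f2 g2.
rewrite /cnsq.
have := nsq_ge0 mu (fun x => complex.Re (f x)); have := nsq_ge0 mu (fun x => complex.Im (f x)).
have := nsq_ge0 mu (fun x => complex.Re (g x)); have := nsq_ge0 mu (fun x => complex.Im (g x)).
set a := nsq _ _; set b := nsq _ _; set c := nsq _ _; set e := nsq _ _.
set p := ip _ _ _; set q := ip _ _ _ => a0 b0 c0 e0 H1 H2.
have := sqr_ge0 (p + q); have := mulr_ge0 e0 a0; have := mulr_ge0 c0 b0; nra.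
Qed.

Lemma schwartz_Re phi : schwartz phi -> schwartz (fun x => (complex.Re (phi x))%:C).
Proof.
move=> sp; rewrite (_ : (fun x => _) = fun x => (2^-1)%:C * (phi x + (phi x)^*%C)).
  by apply: schwartz_scale; apply: schwartz_add => //; exact: schwartzJ.
by apply/funext => x; apply: complex_ext; rewrite !cpartsE; field.
Qed.

Lemma schwartz_Im phi : schwartz phi -> schwartz (fun x => (complex.Im (phi x))%:C).
Proof.
move=> sp; have := schwartz_Re (schwartz_scale (imag (- 1)) sp).
by under [X in schwartz X -> _]eq_fun do rewrite !cpartsE mul0r mulN1r opprK add0r.
Qed.

Lemma complex_split (z : C) : z = (complex.Re z)%:C + imag 1 * (complex.Im z)%:C.
Proof. by apply: complex_ext; rewrite !cpartsE; ring. Qed.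

Lemma cnsq_fourier phi : schwartz phi -> cnsq (fourier phi) = FC * cnsq phi.
Proof.
move=> sp; rewrite !cnsqE; [exact: plancherel|exact: schwartz_L2|].
by apply: schwartz_L2; exact: schwartz_fourier.
Qed.

(** The transform on L^2 is obtained by duality: the left-hand side is a functional of psi that the
    Plancherel identity bounds in L^2. Taking c = 1 and c = - i gives the real and the imaginary
    part of the pairing. *)
Lemma fourier_riesz v (c : C) : L2 v -> exists h : E -> R,
  [/\ l2 mu h, nsq mu h <= 2 * cnsq (fun x => c * v x) * FC &
      forall psi : E -> R, schwartz (fun x => (psi x)%:C) ->
        complex.Re (c * cintegral (fun x => v x * fourier (fun x => (psi x)%:C) x)) = ip mu h psi].
Proof.
move=> lv; have lcv := L2Z c lv.
pose F (psi : E -> R) := fourier (fun x => (psi x)%:C).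
have lF psi : schwartz (fun x => (psi x)%:C) -> L2 (F psi).
  by move=> s; apply: schwartz_L2; exact: schwartz_fourier.
have E1 psi : schwartz (fun x => (psi x)%:C) ->
    c * cintegral (fun x => v x * F psi x) = cintegral (fun x => c * v x * F psi x).
  move=> s; rewrite -cintegralZ; last by apply: L2M_cintegrable => //; exact: lF.
  by apply: eq_cintegral => x; rewrite mulrA.
have := @riesz_subspace _ E R mu (fun psi => schwartz (fun x => (psi x)%:C))
  (fun psi => complex.Re (c * cintegral (fun x => v x * F psi x)))
  (2 * cnsq (fun x => c * v x) * FC).
apply.
- by move=> psi s; have /L2P[] := schwartz_L2 s.
- by exists (fun x => gaussR 1 x); exact: schwartz_gaussian.
- move=> a f g sf sg; under eq_fun do rewrite rmorphD rmorphM.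
  by apply: schwartz_add => //; exact: schwartz_scale.
- move=> a f g sf sg.
  have -> : cintegral (fun x => v x * F (fun x => f x + a * g x) x) =
      cintegral (fun x => v x * F f x) + a%:C * cintegral (fun x => v x * F g x).
    rewrite -cintegralZ -?cintegralD; last 3 first.
    + by apply: L2M_cintegrable => //; exact: lF.
    + by apply: cintegrableZ; apply: L2M_cintegrable => //; exact: lF.
    + by apply: L2M_cintegrable => //; exact: lF.
    apply: eq_cintegral => x; rewrite /F.
    have -> : (fun x => (f x + a * g x)%:C) = fun x => (f x)%:C + a%:C * (g x)%:C.
      by apply/funext => y; rewrite rmorphD rmorphM.
    rewrite fourierD // ?fourierZ //; last exact: schwartz_scale.
    by ring.
  by rewrite mulrDr cReD mulrCA [complex.Re (a%:C * _)]cReM Rec Imc mul0r subr0.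
- move=> psi s; rewrite E1 //; apply: le_trans (Re_cintegralM_bound lcv (lF _ s)) _.
  rewrite cnsq_fourier // mulrA le_eqVlt; apply/orP; left; apply/eqP; congr (_ * _).
  by rewrite /cnsq [X in _ + X](_ : _ = 0) ?addr0 // /nsq (@eq_Rintegral _ _ _ mu setT (fun=> 0))
    ?Rintegral_cst ?mul0r // => x _; rewrite expr0n.
- by rewrite !mulr_ge0 ?cnsq_ge0 // ltW // fourier_const_gt0.
Qed.

Lemma fourier_of_L2 v : L2 v -> exists h,
  [/\ L2 h, cnsq h <= 4 * FC * cnsq v &
      forall phi, schwartz phi ->
        cintegral (fun x => v x * fourier phi x) = cintegral (fun x => h x * phi x)].
Proof.
move=> lv.
have [h1 [l1 n1 r1]] := fourier_riesz 1 lv.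
have [h2 [l2' n2 r2]] := fourier_riesz (imag (- 1)) lv.
have cn2 : cnsq (fun x => imag (- 1) * v x) = cnsq v.
  rewrite /cnsq addrC; congr (_ + _); apply: eq_Rintegral => x _; rewrite !cpartsE; ring.
have cn1 : cnsq (fun x => 1 * v x) = cnsq v by under eq_fun do rewrite mul1r.
rewrite cn2 in n2; rewrite cn1 in n1.
pose h x : C := h1 x +i* h2 x.
have lh : L2 h by apply/L2P.
have lF phi : schwartz phi -> L2 (fourier phi).
  by move=> s; apply: schwartz_L2; exact: schwartz_fourier.
have real psi : schwartz (fun x => (psi x)%:C) ->
    cintegral (fun x => v x * fourier (fun x => (psi x)%:C) x) =
    cintegral (fun x => h x * (psi x)%:C).
  move=> s; apply: complex_ext.
    have := r1 _ s; rewrite mul1r => ->; rewrite Re_cintegral.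
    by apply: eq_Rintegral => x _; rewrite !cpartsE /h /= mulr0 subr0.
  have := r2 _ s; rewrite cReM Re_imag Im_imag mul0r mulN1r opprK add0r => ->; rewrite Im_cintegral.
  by apply: eq_Rintegral => x _; rewrite !cpartsE /h /= mulr0 add0r.
exists h; split => //.
  rewrite /cnsq; have -> : 4 * FC * cnsq v =
    2 * cnsq v * FC + 2 * cnsq v * FC by ring.
  exact: lerD n1 n2.
move=> phi sp.
have sR := schwartz_Re sp; have sI := schwartz_Im sp.
have E1 : phi = fun x => (complex.Re (phi x))%:C + imag 1 * (complex.Im (phi x))%:C.
  by apply/funext => x; exact: complex_split.
(* Both sides are complex linear in phi, so the case of real test functions suffices. *)
rewrite {1}E1.
transitivity (cintegral (fun x => v x * fourier (fun x => (complex.Re (phi x))%:C) x +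
    imag 1 * (v x * fourier (fun x => (complex.Im (phi x))%:C) x))).
  apply: eq_cintegral => x; rewrite fourierD // ?fourierZ //; last exact: schwartz_scale.
  by ring.
rewrite cintegralD ?cintegralZ ?real //; last 3 first.
- by apply: L2M_cintegrable => //; exact: lF.
- by apply: L2M_cintegrable => //; exact: lF.
- by apply: cintegrableZ; apply: L2M_cintegrable => //; exact: lF.
rewrite -cintegralZ -?cintegralD; last 3 first.
- by apply: L2M_cintegrable => //; exact: schwartz_L2.
- by apply: cintegrableZ; apply: L2M_cintegrable => //; exact: schwartz_L2.
- by apply: L2M_cintegrable => //; exact: schwartz_L2.
by apply: eq_cintegral => x; rewrite {3}(complex_split (phi x)); ring.
Qed.

(** The inverse transform is the conjugate of the transform of the conjugate, divided by (2
    pi)^n. *)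
Lemma inverse_fourier_of_L2 h : L2 h -> exists2 v, L2 v &
  forall phi, schwartz phi ->
    cintegral (fun x => v x * fourier phi x) = cintegral (fun x => h x * phi x).
Proof.
move=> lh; have [w [lw _ Hw]] := fourier_of_L2 (L2J lh).
have K0 : FC%:C != 0 :> C.
  by rewrite eq_complex /= negb_and gt_eqF // fourier_const_gt0.
exists (fun x => FC%:C^-1 * (w x)^*%C); first by apply: L2Z; exact: L2J.
move=> phi sp; have sJ := schwartzJ (schwartz_fourier sp).
have lF : L2 (fourier phi) by apply: schwartz_L2; exact: schwartz_fourier.
have := congr1 (@conjc R) (Hw _ sJ).
rewrite -(cintegralJ (L2M_cintegrable (L2J lh) (schwartz_L2 (schwartz_fourier sJ)))).
rewrite -(cintegralJ (L2M_cintegrable lw (L2J lF))).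
have -> : cintegral (fun x => ((h x)^*%C * fourier (fun x => (fourier phi x)^*%C) x)^*%C) =
    FC%:C * cintegral (fun x => h x * phi x).
  rewrite -cintegralZ; last by apply: L2M_cintegrable => //; exact: schwartz_L2.
  apply: eq_cintegral => x; rewrite fourierJ_fourier // !cJM !conjcK conjc_real; ring.
have -> : cintegral (fun x => (w x * (fourier phi x)^*%C)^*%C) =
    cintegral (fun x => (w x)^*%C * fourier phi x).
  by apply: eq_cintegral => x; rewrite cJM conjcK.
move=> H; apply: (mulfI K0); rewrite H -cintegralZ; last first.
  by apply: L2M_cintegrable => //; apply: L2Z; exact: L2J.
by apply: eq_cintegral => x; rewrite mulrA mulrA divff // mul1r.
Qed.

(** Makes the transform of a distribution unique almost everywhere when it is a function. Real test
    functions allow the two parts to be separated independently. *)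
Lemma tempered_fun_unique f g : tempered_fun f -> tempered_fun g ->
  (forall phi, schwartz phi ->
    cintegral (fun x => f x * phi x) = cintegral (fun x => g x * phi x)) ->
  {ae mu, forall x, f x = g x}.
Proof.
move=> [[mf1 mf2] tf] [[mg1 mg2] tg] H.
have iR phi : schwartz phi -> cintegrable (fun x => f x * (complex.Re (phi x))%:C) /\
   cintegrable (fun x => g x * (complex.Re (phi x))%:C).
  by move=> sp; have sR := schwartz_Re sp; split; [exact: tf|exact: tg].
have aeR : {ae mu, forall x, complex.Re (f x) - complex.Re (g x) = 0}.
  apply: schwartz_separates; first exact: measurable_funB.
    move=> phi sp; have [[i1 _] [i2 _]] := iR phi sp.
    rewrite (_ : _ \o _ = (fun x => (complex.Re (f x * (complex.Re (phi x))%:C))%:E -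
       (complex.Re (g x * (complex.Re (phi x))%:C))%:E)%E).
      exact: integrableB.
    by apply/funext => x; rewrite /= -EFinB; congr EFin; rewrite !cpartsE; ring.
  move=> phi sp pR; have [[i1 _] [i2 _]] := iR phi sp.
  have := congr1 (@complex.Re R) (H _ (schwartz_Re sp)); rewrite !Re_cintegral => /eqP.
  rewrite -subr_eq0 -RintegralB // => /eqP <-.
  by apply: eq_Rintegral => x _; rewrite !cpartsE; ring.
have aeI : {ae mu, forall x, complex.Im (f x) - complex.Im (g x) = 0}.
  apply: schwartz_separates; first exact: measurable_funB.
    move=> phi sp; have [[_ i1] [_ i2]] := iR phi sp.
    rewrite (_ : _ \o _ = (fun x => (complex.Im (f x * (complex.Re (phi x))%:C))%:E -
       (complex.Im (g x * (complex.Re (phi x))%:C))%:E)%E).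
      exact: integrableB.
    by apply/funext => x; rewrite /= -EFinB; congr EFin; rewrite !cpartsE; ring.
  move=> phi sp pR; have [[_ i1] [_ i2]] := iR phi sp.
  have := congr1 (@complex.Im R) (H _ (schwartz_Re sp)); rewrite !Im_cintegral => /eqP.
  rewrite -subr_eq0 -RintegralB // => /eqP <-.
  by apply: eq_Rintegral => x _; rewrite !cpartsE; ring.
apply: filterS2 aeR aeI => x /eqP; rewrite subr_eq0 => /eqP e1 /eqP.
by rewrite subr_eq0 => /eqP e2; exact: complex_ext.
Qed.

End fourier_of_L2.

(** * Weak time derivatives *)

Section weak_time_derivative.
Context {R : realType} {n : nat}.
Notation E := (Rn R n).
Notation mu := (lebesgue_Rn R n).
Notation l2 := (l2 mu).
Notation nsq := (nsq mu).
Notation ip := (ip mu).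

Definition rschwartz (psi : E -> R) := schwartz (fun x => (psi x)%:C).

(** A polynomial, hence a multiplier of Schwartz functions, that dominates |x|^2 and every |x|^(2
    sigma) with 0 <= sigma < 2. *)
Definition wgt (x : E) : R := (1 + dot x x) ^+ 2.

Lemma wgt_ge1 x : 1 <= wgt x.
Proof. by rewrite exprn_ege1 // lerDl dot_ge0. Qed.

Lemma wgt_gt0 x : 0 < wgt x.
Proof. exact: lt_le_trans ltr01 (wgt_ge1 x). Qed.

Lemma measurable_wgt : measurable_fun setT wgt.
Proof. by apply: measurable_funX; apply: measurable_funD => //; exact: measurable_dot_sq. Qed.

Lemma measurable_wgtV : measurable_fun setT (fun x => (wgt x)^-1).
Proof.
rewrite (_ : (fun x => _) = (@powR R ^~ (-1)) \o wgt); last first.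
  by apply/funext => x /=; rewrite powR_inv1 // ltW // wgt_gt0.
exact: measurableT_comp (measurable_powR _) measurable_wgt.
Qed.

Lemma schwartz_wgt (phi : E -> R[i]) : schwartz phi -> schwartz (fun x => (wgt x)%:C * phi x).
Proof.
rewrite (_ : (fun x => _) = fun x => ((1 + (dot x x)%:C) * (1 + (dot x x)%:C)) * phi x).
  apply: schwartz_slow_mul.
  have s1 : smooth_slow (fun x : E => 1 + (dot x x)%:C).
    by apply: smooth_slow_add; [exact: smooth_slow_cst|exact: smooth_slow_dot].
  exact: smooth_slow_mul.
by apply/funext => x; rewrite /wgt expr2 rmorphM rmorphD.
Qed.

Lemma rschwartz_wgt psi : rschwartz psi -> rschwartz (fun x => wgt x * psi x).
Proof. by move=> /schwartz_wgt; rewrite /rschwartz; under [X in _ -> schwartz X]eq_fun do rewrite rmorphM. Qed.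

Lemma rschwartz_l2 psi : rschwartz psi -> l2 psi.
Proof. by move=> s; have /L2P[] := schwartz_L2 s. Qed.

Lemma rschwartz_lin c f g : rschwartz f -> rschwartz g -> rschwartz (fun x => f x + c * g x).
Proof.
move=> sf sg; rewrite /rschwartz; under eq_fun do rewrite rmorphD rmorphM.
by apply: schwartz_add => //; exact: schwartz_scale.
Qed.

Lemma ae_eq_nsq f g : measurable_fun setT f -> measurable_fun setT g ->
  {ae mu, forall x, f x = g x} -> nsq f = nsq g.
Proof.
move=> mf mg fg; rewrite /nsq /Rintegral; congr fine; apply: ae_eq_integral => //.
- by apply/measurable_EFinP; exact: measurable_funX.
- by apply/measurable_EFinP; exact: measurable_funX.
- by apply: filterS fg => x -> _.
Qed.

(** The Riesz representative h of the functional on weighted test functions satisfies the bound by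
    construction. It equals D almost everywhere, since wgt (D - h) is orthogonal to all Schwartz
    functions. *)
Lemma nsq_dual (D : E -> R) (C : R) : 0 <= C -> l2 D ->
  (forall psi, rschwartz psi -> ip D (fun x => wgt x * psi x) ^+ 2 <=
     C * nsq (fun x => wgt x * psi x)) ->
  nsq D <= C.
Proof.
move=> C0 lD H.
have lw psi : rschwartz psi -> l2 (fun x => wgt x * psi x).
  by move=> sp; exact: rschwartz_l2 (rschwartz_wgt sp).
have [| | | | | |h [lh hC Hh]] := @riesz_subspace _ E R mu
  (fun g => exists2 psi, rschwartz psi & g = fun x => wgt x * psi x) (ip D) C.
- by move=> _ [psi sp ->]; exact: lw.
- exists (fun x => wgt x * gaussR 1 x); exists (gaussR 1) => //.
  exact: schwartz_gaussian.
- move=> c _ _ [p sp ->] [q sq ->]; exists (fun x => p x + c * q x).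
    exact: rschwartz_lin.
  by apply/funext => x; ring.
- move=> c _ _ [p sp ->] [q sq ->].
  rewrite ![ip D _]ipC ipDl ?ipZl //; [exact: lw|exact: lw|].
  by apply: l2Z; exact: lw.
- by move=> _ [p sp ->]; exact: H.
- by [].
have lDh := l2B lD lh.
have ae : {ae mu, forall x, wgt x * (D x - h x) = 0}.
  have il phi : schwartz phi -> mu.-integrable setT
      (EFin \o (fun x => wgt x * (D x - h x) * complex.Re (phi x))).
    move=> sp; have s : rschwartz (fun x => complex.Re (phi x)) := schwartz_Re sp.
    have := l2_ip_integrable lDh (lw _ s).
    by congr (_.-integrable _ _); apply/funext => x /=; rewrite mulrCA mulrA.
  apply: schwartz_separates => //.
    by apply: measurable_funM; [exact: measurable_wgt|have [] := lDh].
  move=> phi sp _.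
  have s : rschwartz (fun x => complex.Re (phi x)) := schwartz_Re sp.
  have := Hh _ (ex_intro2 _ _ _ s erefl); move=> /eqP; rewrite -subr_eq0 -ipBl //; last first.
    exact: rschwartz_l2 (rschwartz_wgt s).
  by move=> /eqP <-; apply: eq_Rintegral => x _; rewrite mulrCA mulrA.
rewrite (@ae_eq_nsq _ h) //; [by have [] := lD|by have [] := lh|].
apply: filterS ae => x /eqP; rewrite mulf_eq0 gt_eqF ?wgt_gt0 //= subr_eq0.
by move=> /eqP.
Qed.

(* Y' = Z in the sense of distributions for t > 0; G psi is the function t |-> (Y t, psi). *)
Definition weak_derivative (Y Z : R -> E -> R) := exists G : (E -> R) -> R -> R,
  forall psi, rschwartz psi ->
    (forall t : R, 0 <= t -> G psi t = ip (Y t) psi) /\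
    (forall t : R, 0 < t -> is_derive t (1 : R) (G psi) (\int[mu]_x (Z t x * psi x))).

Definition l2_continuous_at (F : R -> E -> R) (s : R) := forall e : R, 0 < e ->
  exists2 d : R, 0 < d & forall t : R, 0 <= t -> `|t - s| < d -> nsq (fun x => F t x - F s x) <= e.

Lemma mean_value (g g' : R -> R) (s t : R) : 0 < s -> 0 < t ->
  (forall r : R, 0 < r -> is_derive r (1 : R) g (g' r)) ->
  exists r, [/\ 0 < r, `|r - s| <= `|t - s| & g t - g s = g' r * (t - s)].
Proof.
move=> s0 t0 dg.
have H a b : 0 < a -> a <= b -> exists2 r, a <= r <= b & g b - g a = g' r * (b - a).
  move=> a0 ab.
  have H1 x : x \in `]a, b[%R -> is_derive x (1 : R) g (g' x).
    by rewrite in_itv /= => /andP[/(lt_trans a0) x0 _]; exact: dg.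
  have H2 : {within `[a, b], continuous g}.
    apply: derivable_within_continuous => x; rewrite in_itv /= => /andP[ax _].
    by have [] := dg x (lt_le_trans a0 ax).
  have [r rab ->] := MVT_segment ab H1 H2.
  by exists r => //; move: rab; rewrite in_itv.
have [st|/ltW ts] := leP s t.
  have [r /andP[sr rt] E1] := H s t s0 st.
  exists r; split => //; first exact: lt_le_trans s0 sr.
  by rewrite !ger0_norm ?subr_ge0 // lerD2r.
have [r /andP[tr rs] E1] := H t s t0 ts.
exists r; split => //; first exact: lt_le_trans t0 tr.
  by rewrite !ler0_norm ?subr_le0 // lerN2 lerD2r.
by rewrite -opprB E1; ring.
Qed.

(** For each psi the mean value theorem gives (Y t - Y s, psi) = (t - s) (Z r, psi) with r depending
    on psi. As r is within |t - s| of s, continuity of Z / wgt bounds Z r - Z s independently of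
    psi, which is what [nsq_dual] asks for. *)
Lemma weak_derivative_estimate (Y Z : R -> E -> R) (s : R) : 0 < s ->
  (forall t : R, 0 <= t -> l2 (Y t)) ->
  (forall t : R, 0 <= t -> l2 (fun x => (wgt x)^-1 * Z t x)) ->
  weak_derivative Y Z ->
  l2_continuous_at (fun t x => (wgt x)^-1 * Z t x) s ->
  forall e : R, 0 < e -> exists2 d : R, 0 < d & forall t : R, 0 <= t -> `|t - s| < d ->
    nsq (fun x => (wgt x)^-1 * (Y t x - Y s x - (t - s) * Z s x)) <= e * (t - s) ^+ 2.
Proof.
move=> s0 lY lZ [G HG] cZ e e0.
have [d d0 Hd] := cZ e e0.
(* The bound s keeps t positive, where the weak derivative exists. *)
exists (Num.min d s); first by rewrite lt_min d0 s0.
move=> t t0' ; rewrite lt_min => /andP[td ts].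
have t0 : 0 < t by move: ts; rewrite ltr_norml => /andP[]; lra.
have l2w f : l2 f -> l2 (fun x => (wgt x)^-1 * f x).
  move=> [mf intf]; split.
    by apply: measurable_funM => //; exact: measurable_wgtV.
  apply: (@le_integrable _ _ _ _ _ _ _ (EFin \o (fun x => f x ^+ 2))) => //.
    apply/measurable_EFinP; apply: measurable_funX; apply: measurable_funM => //.
    exact: measurable_wgtV.
  move=> x _; rewrite /= lee_fin !ger0_norm ?sqr_ge0 // exprMn.
  apply: ler_piMl; first exact: sqr_ge0.
  by rewrite expr_le1 ?invr_ge0 ?(ltW (wgt_gt0 x)) // invf_le1 ?wgt_gt0 // wgt_ge1.
have l1 : l2 (fun x => (wgt x)^-1 * (Y t x - Y s x)).
  by apply: l2w; apply: l2B; apply: lY => //; exact: ltW.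
have l2' : l2 (fun x => (t - s) * ((wgt x)^-1 * Z s x)).
  by apply: l2Z; apply: lZ; exact: ltW.
have lD : l2 (fun x => (wgt x)^-1 * (Y t x - Y s x - (t - s) * Z s x)).
  have := l2B l1 l2'.
  by under [X in l2 X -> _]eq_fun do rewrite mulrCA -mulrBr.
apply: nsq_dual => //; first by rewrite mulr_ge0 ?sqr_ge0 // ltW.
move=> psi sp; have lp := rschwartz_l2 sp; have lwp := rschwartz_l2 (rschwartz_wgt sp).
have [Gip dG] := HG psi sp.
have wE r : (\int[mu]_x (Z r x * psi x))%R = ip (fun x => (wgt x)^-1 * Z r x) (fun x => wgt x * psi x).
  by apply: eq_Rintegral => x _; field; rewrite gt_eqF // wgt_gt0.
have [r [r0 rs E1]] := mean_value s0 t0 dG.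
have -> : ip (fun x => (wgt x)^-1 * (Y t x - Y s x - (t - s) * Z s x)) (fun x => wgt x * psi x) =
    (t - s) * ip (fun x => (wgt x)^-1 * Z r x - (wgt x)^-1 * Z s x) (fun x => wgt x * psi x).
  rewrite ipBl //; [|exact: lZ (ltW r0)|exact: lZ (ltW s0)].
  rewrite mulrBr -!wE mulrC -E1 !Gip ?(ltW s0) // wE -ipZl //; last exact: lZ (ltW s0).
  rewrite -ipBl //; [|exact: lY|exact: lY (ltW s0)].
  have -> : ip (fun x => Y t x - Y s x) psi =
      ip (fun x => (wgt x)^-1 * (Y t x - Y s x)) (fun x => wgt x * psi x).
    by apply: eq_Rintegral => x _; field; rewrite gt_eqF // wgt_gt0.
  rewrite -ipBl //; apply: eq_Rintegral => x _.
  by field; rewrite gt_eqF // wgt_gt0.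
rewrite exprMn (mulrC e) -[leRHS]mulrA; apply: ler_wpM2l; first exact: sqr_ge0.
apply: le_trans (cauchy_schwarz (l2B (lZ _ (ltW r0)) (lZ _ (ltW s0))) lwp) _.
apply: ler_wpM2r; first exact: nsq_ge0.
by apply: Hd; [exact: ltW|exact: le_lt_trans td].
Qed.

(** The squared form of an error o(|t - s|) in the norm of L^2. *)
Definition l2_derivable (F : R -> E -> R) (F' : E -> R) (s : R) := forall e : R, 0 < e ->
  exists2 d : R, 0 < d & forall t : R, 0 <= t -> `|t - s| < d ->
    nsq (fun x => F t x - F s x - (t - s) * F' x) <= e * (t - s) ^+ 2.

Lemma is_derive_of_estimate (g : R -> R) (s v : R) :
  (forall e : R, 0 < e -> exists2 d : R, 0 < d & forall t : R, `|t - s| < d ->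
     `|g t - g s - (t - s) * v| <= e * `|t - s|) ->
  is_derive s (1 : R) g v.
Proof.
move=> H.
have C : (fun h => h^-1 *: (g (h *: (1 : R) + s) - g s)) @ (0 : R)^' --> v.
  apply/cvgrPdist_le => e e0; have [d d0 Hd] := H e e0.
  exists d => //= h /=; rewrite sub0r normrN => hd h0.
  have := Hd (h + s); rewrite addrK => /(_ hd) Hh.
  rewrite /GRing.scale /= mulr1 distrC.
  rewrite (_ : _ - v = h^-1 * (g (h + s) - g s - h * v)); last by field.
  by rewrite normrM normfV ler_pdivrMl ?normr_gt0 // [leRHS]mulrC.
apply: DeriveDef; first by apply/cvg_ex; exists v.
exact: cvg_lim C.
Qed.

Lemma is_derive_nsq (F : R -> E -> R) (F' : E -> R) (s : R) : 0 < s ->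
  (forall t : R, 0 <= t -> l2 (F t)) -> l2 F' -> l2_derivable F F' s ->
  is_derive s (1 : R) (fun t => nsq (F t)) (2 * ip (F s) F').
Proof.
move=> s0 lF lF' dF; apply: is_derive_of_estimate => e e0.
have N0 := nsq_ge0 mu (F s); have N0' := nsq_ge0 mu F'.
(* With D the remainder of F, this makes |(F s, D)| <= (e / 4) |t - s| by Cauchy-Schwarz, and nsq D
   <= (t - s)^2. The last bound in [d1] makes the quadratic terms at most (e / 2) |t - s|. *)
pose e1 := Num.min 1 ((e / 4) ^+ 2 / (nsq (F s) + 1)).
have e10 : 0 < e1.
  by rewrite lt_min ltr01 divr_gt0 ?ltr_wpDl // exprn_gt0 // divr_gt0.
have [d d0 Hd] := dF e1 e10.
pose d1 := Num.min (Num.min d s) (e / (4 * (nsq F' + 1))).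
have d10 : 0 < d1.
  by rewrite !lt_min d0 s0 divr_gt0 // mulr_gt0 // ltr_wpDl.
exists d1 => // t; rewrite !lt_min => /andP[/andP[td ts] te].
have t0 : 0 <= t by move: ts; rewrite ltr_norml => /andP[]; lra.
have HD := Hd t t0 td.
set D := (fun x => _) in HD.
have lFs := lF s (ltW s0).
have lD : l2 D by apply: l2B; [apply: l2B => //; exact: lF|exact: l2Z].
have nF : nsq (F t) = nsq (F s) + 2 * 1 * ip (F s) (fun x => F t x - F s x) +
    1 ^+ 2 * nsq (fun x => F t x - F s x).
  rewrite -nsqDZ //; last by apply: l2B => //; exact: lF.
  by apply: eq_Rintegral => x _; congr (_ ^+ 2); ring.
have nI : ip (F s) (fun x => F t x - F s x) = (t - s) * ip (F s) F' + ip (F s) D.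
  rewrite !(ipC _ (F s)) -ipZl // -ipDl //; last exact: l2Z.
  by apply: eq_Rintegral => x _; rewrite /D; ring.
(* Parallelogram identity for D and (t - s) F'. *)
have nB : nsq (fun x => F t x - F s x) <= 2 * nsq D + 2 * (t - s) ^+ 2 * nsq F'.
  have H1 := nsqDZ (t - s) lD lF'; have H2 := nsqDZ (- (t - s)) lD lF'.
  have := nsq_ge0 mu (fun x => D x + - (t - s) * F' x).
  have -> : nsq (fun x => F t x - F s x) = nsq (fun x => D x + (t - s) * F' x).
    by apply: eq_Rintegral => x _; rewrite /D; congr (_ ^+ 2); ring.
  rewrite H1 H2 sqrrN; lra.
have -> : nsq (F t) - nsq (F s) - (t - s) * (2 * ip (F s) F') =
    2 * ip (F s) D + nsq (fun x => F t x - F s x) by rewrite nF nI; ring.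
have b1 : `|ip (F s) D| <= (e / 4) * `|t - s|.
  rewrite -(@ler_pXn2r _ 2) ?nnegrE ?mulr_ge0 ?divr_ge0 ?(ltW e0) //.
  rewrite real_normK ?num_real // exprMn real_normK ?num_real //.
  apply: le_trans (cauchy_schwarz lFs lD) _.
  apply: (@le_trans _ _ (nsq (F s) * (((e / 4) ^+ 2 / (nsq (F s) + 1)) * (t - s) ^+ 2))).
    apply: ler_wpM2l => //; apply: le_trans HD _.
    by apply: ler_wpM2r; [exact: sqr_ge0|rewrite ge_min lexx orbT].
  rewrite mulrA; apply: ler_wpM2r; first exact: sqr_ge0.
  rewrite mulrA ler_pdivrMr ?ltr_wpDl //.
  by rewrite mulrC; apply: ler_wpM2l; [exact: sqr_ge0|rewrite lerDl].
have b2 : nsq D <= (t - s) ^+ 2.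
  apply: le_trans HD _; rewrite -[leRHS]mul1r.
  by apply: ler_wpM2r; [exact: sqr_ge0|rewrite ge_min lexx].
have b3 : (t - s) ^+ 2 * (4 * (nsq F' + 1)) <= e * `|t - s|.
  rewrite -[(t - s) ^+ 2]real_normK ?num_real // expr2 -mulrA mulrC.
  apply: ler_wpM2r => //; rewrite -ler_pdivlMr; first exact: ltW.
  by rewrite mulr_gt0 // ltr_wpDl.
apply: le_trans (ler_normD _ _) _.
rewrite normrM (ger0_norm (ler0n _ 2)) [`|nsq _|]ger0_norm ?nsq_ge0 //.
lra.
Qed.

End weak_time_derivative.

(** * Energy decay *)

Section multipliers.
Context {R : realType} {n : nat}.
Notation E := (Rn R n).
Notation mu := (lebesgue_Rn R n).
Notation l2 := (l2 mu).
Notation nsq := (nsq mu).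
Implicit Types (a f g : E -> R) (F : R -> E -> R).

Lemma l2_mult a (K : R) f : measurable_fun setT a -> (forall x, `|a x| <= K) -> l2 f ->
  l2 (fun x => a x * f x) /\ nsq (fun x => a x * f x) <= K ^+ 2 * nsq f.
Proof.
move=> ma aK [mf intf].
have K0 (x : E) : 0 <= K by have := aK x; apply: le_trans; exact: normr_ge0.
have H x : (a x * f x) ^+ 2 <= K ^+ 2 * f x ^+ 2.
  rewrite exprMn; apply: ler_wpM2r; first exact: sqr_ge0.
  by rewrite -real_normK ?num_real // lerXn2r ?nnegrE // (K0 x).
have iK : mu.-integrable setT (EFin \o (fun x => K ^+ 2 * f x ^+ 2)).
  rewrite (_ : _ \o _ = fun x => ((K ^+ 2)%:E * (f x ^+ 2)%:E)%E) //.
  exact: integrableZl.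
have mm : measurable_fun setT (fun x => a x * f x) by exact: measurable_funM.
have l : l2 (fun x => a x * f x).
  split => //; apply: le_integrable iK => //.
    by apply/measurable_EFinP; exact: measurable_funX.
  move=> x _; rewrite /= lee_fin !ger0_norm; first exact: H.
  - by apply: mulr_ge0; exact: sqr_ge0.
  - exact: sqr_ge0.
split => //; rewrite /nsq -RintegralZl //; apply: le_Rintegral => //.
by case: l.
Qed.

Lemma nsqD_le f g : l2 f -> l2 g -> nsq (fun x => f x + g x) <= 2 * nsq f + 2 * nsq g.
Proof.
move=> lf lg; have := nsqDZ 1 lf lg; have := nsqDZ (-1) lf lg.
have := nsq_ge0 mu (fun x => f x + -1 * g x).
under [X in _ -> _ -> nsq X = _ -> _]eq_fun do rewrite mul1r.
by lra.
Qed.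

Lemma l2_continuous_mult a F s : 0 <= s -> (forall t : R, 0 <= t -> l2 (F t)) ->
  measurable_fun setT a -> (forall x, `|a x| <= 1) ->
  l2_continuous_at F s -> l2_continuous_at (fun t x => a x * F t x) s.
Proof.
move=> s0 lF ma a1 cF e e0; have [d d0 Hd] := cF e e0.
exists d => // t t0 td.
have [_] := l2_mult ma a1 (l2B (lF t t0) (lF s s0)).
under [X in nsq X <= _ -> _]eq_fun do rewrite mulrBr.
by move=> /le_trans; apply; rewrite expr1n mul1r; exact: Hd.
Qed.

Lemma l2_continuousD F (G : R -> E -> R) s : 0 <= s ->
  (forall t : R, 0 <= t -> l2 (F t)) -> (forall t : R, 0 <= t -> l2 (G t)) ->
  l2_continuous_at F s -> l2_continuous_at G s ->
  l2_continuous_at (fun t x => F t x + G t x) s.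
Proof.
move=> s0 lF lG cF cG e e0; have e4 : 0 < e / 4 by rewrite divr_gt0.
have [d1 d10 H1] := cF _ e4; have [d2 d20 H2] := cG _ e4.
exists (Num.min d1 d2); first by rewrite lt_min d10 d20.
move=> t t0; rewrite lt_min => /andP[h1 h2].
have := nsqD_le (l2B (lF t t0) (lF s s0)) (l2B (lG t t0) (lG s s0)).
rewrite (_ : (fun x => _ + _) = (fun x => F t x + G t x - (F s x + G s x))); last first.
  by apply/funext => x; ring.
by have := H1 t t0 h1; have := H2 t t0 h2; lra.
Qed.

(** The weighted estimate loses a factor wgt; a multiplier a with a wgt bounded recovers it. The
    case of interest is an indicator of bounded frequencies. *)
Lemma l2_derivable_mult a (K : R) (Y : R -> E -> R) (Z : E -> R) s : 0 <= s ->
  (forall t : R, 0 <= t -> l2 (Y t)) -> l2 (fun x => (wgt x)^-1 * Z x) ->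
  measurable_fun setT a -> (forall x, `|a x * wgt x| <= K) ->
  (forall e : R, 0 < e -> exists2 d : R, 0 < d & forall t : R, 0 <= t -> `|t - s| < d ->
    nsq (fun x => (wgt x)^-1 * (Y t x - Y s x - (t - s) * Z x)) <= e * (t - s) ^+ 2) ->
  l2 (fun x => a x * Z x) /\ l2_derivable (fun t x => a x * Y t x) (fun x => a x * Z x) s.
Proof.
move=> s0 lY lZ ma aK H.
have maw : measurable_fun setT (fun x => a x * wgt x).
  by apply: measurable_funM => //; exact: measurable_wgt.
have mV (f : E -> R) : l2 f -> l2 (fun x => (wgt x)^-1 * f x).
  move=> lf; have [] // := @l2_mult (fun x => (wgt x)^-1) 1 f measurable_wgtV _ lf.
  move=> x; rewrite ger0_norm ?invr_ge0 ?(ltW (wgt_gt0 x)) //.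
  by rewrite invf_le1 ?wgt_gt0 // wgt_ge1.
have E1 (f : E -> R) x : a x * f x = a x * wgt x * ((wgt x)^-1 * f x).
  by field; rewrite gt_eqF // wgt_gt0.
split.
  under eq_fun do rewrite E1.
  exact: (l2_mult maw aK lZ).1.
move=> e e0.
have [d d0 Hd] := H (e / (K ^+ 2 + 1)) (divr_gt0 e0 (ltr_wpDl (sqr_ge0 K) ltr01)).
exists d => // t t0 td.
have lD : l2 (fun x => (wgt x)^-1 * (Y t x - Y s x - (t - s) * Z x)).
  have := l2B (mV _ (l2B (lY t t0) (lY s s0))) (l2Z (t - s) lZ).
  by under [X in l2 X -> _]eq_fun do rewrite mulrCA -mulrBr.
have [_] := l2_mult maw aK lD.
rewrite (_ : (fun x => _ * _) = (fun x => a x * Y t x - a x * Y s x - (t - s) * (a x * Z x))); last first.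
  by apply/funext => x; field; rewrite gt_eqF // wgt_gt0.
move=> /le_trans; apply.
apply: le_trans (ler_wpM2l (sqr_ge0 K) (Hd t t0 td)) _.
rewrite mulrA; apply: ler_wpM2r; first exact: sqr_ge0.
have K1 : 0 < K ^+ 2 + 1 by rewrite ltr_wpDl ?sqr_ge0.
rewrite mulrCA; apply: ler_piMr; first exact: ltW.
by rewrite ler_pdivrMr // mul1r lerDl.
Qed.

Lemma l2_derivableD (F G : R -> E -> R) (F' G' : E -> R) s : 0 <= s ->
  (forall t : R, 0 <= t -> l2 (F t)) -> (forall t : R, 0 <= t -> l2 (G t)) ->
  l2 F' -> l2 G' ->
  l2_derivable F F' s -> l2_derivable G G' s ->
  l2_derivable (fun t x => F t x + G t x) (fun x => F' x + G' x) s.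
Proof.
move=> s0 lF lG lF' lG' dF dG e e0; have e4 : 0 < e / 4 by rewrite divr_gt0.
have [d1 d10 H1] := dF _ e4; have [d2 d20 H2] := dG _ e4.
exists (Num.min d1 d2); first by rewrite lt_min d10 d20.
move=> t t0; rewrite lt_min => /andP[h1 h2].
have := nsqD_le (l2B (l2B (lF t t0) (lF s s0)) (l2Z (t - s) lF'))
  (l2B (l2B (lG t t0) (lG s s0)) (l2Z (t - s) lG')).
rewrite (_ : (fun x => _ + _) =
  (fun x => F t x + G t x - (F s x + G s x) - (t - s) * (F' x + G' x))); last first.
  by apply/funext => x; ring.
by have := H1 t t0 h1; have := H2 t t0 h2; lra.
Qed.

(** Gronwall's argument: exp(l r) y(r) has nonpositive derivative. *)
Lemma decay_of_derivative (y y' : R -> R) (l : R) :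
  (forall s : R, 0 < s -> is_derive s (1 : R) y (y' s)) ->
  (forall s : R, 0 < s -> y' s <= - l * y s) ->
  forall s t : R, 0 < s -> s <= t -> expR (l * t) * y t <= expR (l * s) * y s.
Proof.
move=> dy Hy s t s0 st.
pose z (r : R) := expR (l * r) * y r.
have dz (r : R) : 0 < r -> is_derive r (1 : R) z (expR (l * r) * (y' r + l * y r)).
  move=> r0.
  have d1 : is_derive r (1 : R) (fun r => l * r) l.
    have := is_deriveM (is_derive_cst l r (1:R)) (is_derive_id r (1:R)).
    by move=> /is_derive_eq; apply; rewrite /GRing.scale /=; ring.
  have d2 := @is_derive1_comp _ expR _ r _ _ (is_derive_expR _) d1.
  have := is_deriveM d2 (dy r r0).
  by move=> /is_derive_eq; apply; rewrite /GRing.scale /=; ring.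
have H1 (x : R) : x \in `]s, t[%R -> derivable z x 1.
  by rewrite in_itv /= => /andP[/(lt_trans s0) x0 _]; have [] := dz x x0.
have H2 (x : R) : x \in `]s, t[%R -> derive1 z x <= 0.
  rewrite in_itv /= => /andP[/(lt_trans s0) x0 _]; rewrite derive1E.
  have [_ ->] := dz x x0; rewrite mulr_ge0_le0 ?expR_ge0 //.
  by have := Hy x x0; lra.
have H3 : {within `[s, t], continuous z}.
  apply: derivable_within_continuous => x; rewrite in_itv /= => /andP[sx _].
  by have [] := dz x (lt_le_trans s0 sx).
by apply: (ler0_derive1_le_cc H1 H2 H3) => //; rewrite in_itv /= ?lexx ?st.
Qed.

Lemma ae_le_of_integrals (f g : E -> R) (D : set E) : measurable D ->
  mu.-integrable setT (EFin \o f) -> mu.-integrable setT (EFin \o g) ->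
  (forall B, measurable B -> B `<=` D -> \int[mu]_(x in B) f x <= \int[mu]_(x in B) g x) ->
  {ae mu, forall x, D x -> f x <= g x}.
Proof.
move=> mD intf intg H.
have mf : measurable_fun setT f by have /integrableP[/measurable_EFinP] := intf.
have mg : measurable_fun setT g by have /integrableP[/measurable_EFinP] := intg.
(* On the set where the claim fails, the integral inequality forces the nonnegative f - g to have
   integral 0. *)
pose B := D `&` [set x | g x < f x].
have mB : measurable B.
  apply: measurableI => //; rewrite -[X in measurable X]setTI.
  have := measurable_fun_ltr mg mf; move=> /(_ measurableT [set true] I).
  by congr (measurable (_ `&` _)); apply/seteqP; split => x /=; case: (g x < f x).
have ifB : mu.-integrable B (EFin \o f) by apply: integrableS intf.
have igB : mu.-integrable B (EFin \o g) by apply: integrableS intg.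
have ifg : mu.-integrable B (EFin \o (fun x => f x - g x)).
  rewrite (_ : _ \o _ = fun x => ((f x)%:E - (g x)%:E)%E) //; exact: integrableB.
have I0 : (\int[mu]_(x in B) `|(f x - g x)%:E| = 0)%E.
  have E1 : (\int[mu]_(x in B) `|(f x - g x)%:E| = \int[mu]_(x in B) (f x - g x)%:E)%E.
    apply: eq_integral => x /set_mem [_ /= gf].
    by rewrite /= ger0_norm // subr_ge0 ltW.
  apply/eqP; rewrite eq_le integral_ge0 // andbT E1.
  rewrite -(@fineK _ (\int[mu]_(x in B) _)%E); last exact: (integrable_fin_num mB ifg).
  rewrite lee_fin -/(Rintegral mu B (fun x => f x - g x)) RintegralB // subr_le0.
  by apply: H => // x [].
have /(_ I0) := (ae_eq_integral_abs mu mB (measurable_int _ ifg)).1.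
move=> Z; apply: filterS Z => x Hx Dx.
rewrite leNgt; apply/negP => gf.
have := Hx (conj Dx gf) => /= -[] /eqP; rewrite subr_eq0 => /eqP fg.
by move: gf; rewrite fg ltxx.
Qed.

End multipliers.

(** * Lyapunov function at a single frequency *)

Section lyapunov.
Context {R : realType}.

(* p = |xi|^2 and d = |xi|^(2 sigma). *)
Definition lyap (a b v w h : R) : R :=
  (v + a / 2 * w) ^+ 2 + (h + b / 2 * w) ^+ 2 + (1 - a ^+ 2 / 4 - b ^+ 2 / 4) * w ^+ 2.

(** The derivative of [lyap] along V' = p W, W' = - p V + p H - d W, H' = - p H - p W. Expanded,
    [lyap] is v^2 + w^2 + h^2 + a v w + b h w; the completed squares make its integral a sum of
    three squared norms. *)
Definition dlyap (p d a b v w h : R) : R :=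
  2 * ((v + a / 2 * w) * (p * w + a / 2 * (- p * v + p * h - d * w)) +
       (h + b / 2 * w) * (- p * h - p * w + b / 2 * (- p * v + p * h - d * w)) +
       (1 - a ^+ 2 / 4 - b ^+ 2 / 4) * w * (- p * v + p * h - d * w)).

(** Without the cross terms, v is not damped and w only through d. The coefficient a contributes - a
    p v^2, and b contributes - b p w^2. *)
Lemma dlyapE (p d a b v w h : R) : dlyap p d a b v w h =
  - 2 * d * w ^+ 2 - 2 * p * h ^+ 2 +
  a * (p * w ^+ 2 - p * v ^+ 2 + p * (v * h) - d * (v * w)) +
  b * (- p * (v * h) + p * h ^+ 2 - d * (w * h) - p * (w * h) - p * w ^+ 2).
Proof. by rewrite /dlyap; field. Qed.

Lemma lyap_ge (a b v w h : R) : 0 <= a <= 4^-1 -> 0 <= b <= 4^-1 ->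
  v ^+ 2 + w ^+ 2 + h ^+ 2 <= 2 * lyap a b v w h.
Proof.
move=> /andP[a0 a1] /andP[b0 b1]; rewrite /lyap.
have := sqr_ge0 (v + a * w); have := sqr_ge0 (h + b * w).
have : a ^+ 2 * w ^+ 2 <= 4^-1 * w ^+ 2.
  by apply: ler_wpM2r; [exact: sqr_ge0|nra].
have : b ^+ 2 * w ^+ 2 <= 4^-1 * w ^+ 2.
  by apply: ler_wpM2r; [exact: sqr_ge0|nra].
have := sqr_ge0 w; lra.
Qed.

Lemma lyap_le (a b v w h : R) : 0 <= a <= 4^-1 -> 0 <= b <= 4^-1 ->
  lyap a b v w h <= 2 * (v ^+ 2 + w ^+ 2 + h ^+ 2).
Proof.
move=> /andP[a0 a1] /andP[b0 b1]; rewrite /lyap.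
have := sqr_ge0 (v - a / 2 * w); have := sqr_ge0 (h - b / 2 * w).
have : a ^+ 2 * w ^+ 2 <= 4^-1 * w ^+ 2.
  by apply: ler_wpM2r; [exact: sqr_ge0|nra].
have : b ^+ 2 * w ^+ 2 <= 4^-1 * w ^+ 2.
  by apply: ler_wpM2r; [exact: sqr_ge0|nra].
have := sqr_ge0 w; lra.
Qed.

(** As d may be negligible, w must be damped through b, which has to exceed a because the term in a
    also produces + a p w^2. *)
Lemma dlyap_weak_damping (p d v w h : R) : 0 <= d -> d <= p ->
  dlyap p d 16^-1 4^-1 v w h <= - (p / 64) * (v ^+ 2 + w ^+ 2 + h ^+ 2).
Proof.
move=> d0 dp; have p0 := le_trans d0 dp; rewrite dlyapE.
(* The claim is linear in p and d: with p = d + (p - d), the mixed products are absorbed by squares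
   weighted by p, d and p - d. *)
have e0 : 0 <= p - d by rewrite subr_ge0.
have h1 := mulr_ge0 p0 (sqr_ge0 (v / 6 + h / 2)).
have h1' := mulr_ge0 p0 (sqr_ge0 (v / 6 - h / 2)).
have h2 := mulr_ge0 d0 (sqr_ge0 (v / 8 + w / 4)).
have h2' := mulr_ge0 d0 (sqr_ge0 (v / 8 - w / 4)).
have h3 := mulr_ge0 p0 (sqr_ge0 (w / 3 + h * 3 / 4)).
have h4 := mulr_ge0 d0 (sqr_ge0 (w / 3 + h * 3 / 4)).
have h5 := mulr_ge0 d0 (sqr_ge0 w); have h6 := mulr_ge0 e0 (sqr_ge0 w).
have h7 := mulr_ge0 e0 (sqr_ge0 h); have h8 := mulr_ge0 d0 (sqr_ge0 h).
have h9 := mulr_ge0 e0 (sqr_ge0 v); have h10 := mulr_ge0 d0 (sqr_ge0 v).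
have h11 := mulr_ge0 p0 (sqr_ge0 (v / 8 + h * 3 / 4)).
have h12 := mulr_ge0 p0 (sqr_ge0 (w / 4 + h / 2)).
have h13 := mulr_ge0 d0 (sqr_ge0 (w / 4 + h / 2)).
nra.
Qed.

(** Here p = 4 a d. The mixed term a d v w has to be absorbed by d w^2 and a p v^2, which forces a
    to be of order p / d; with a = p / (4 d) everything is d times a form in a alone. The damping d
    already controls w, so b = 0, and the rate a^2 d is p^2 / (16 d). *)
Lemma dlyap_strong_damping (d a v w h : R) : 0 <= d -> 0 <= a <= 4^-1 ->
  dlyap (4 * a * d) d a 0 v w h <= - (2 * a ^+ 2 * d) * (v ^+ 2 + w ^+ 2 + h ^+ 2).
Proof.
move=> d0 /andP[a0 a1]; rewrite dlyapE.
have -> : - 2 * d * w ^+ 2 - 2 * (4 * a * d) * h ^+ 2 +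
  a * (4 * a * d * w ^+ 2 - 4 * a * d * v ^+ 2 + 4 * a * d * (v * h) - d * (v * w)) +
  0 * (- (4 * a * d) * (v * h) + 4 * a * d * h ^+ 2 - d * (w * h) - 4 * a * d * (w * h) -
   4 * a * d * w ^+ 2) =
  - (2 * w ^+ 2 + 8 * a * h ^+ 2 - 4 * a ^+ 2 * w ^+ 2 + 4 * a ^+ 2 * v ^+ 2
     - 4 * a ^+ 2 * (v * h) + a * v * w) * d by ring.
rewrite -subr_ge0 (_ : _ - _ = d * (2 * w ^+ 2 + 8 * a * h ^+ 2 - 4 * a ^+ 2 * w ^+ 2 +
  4 * a ^+ 2 * v ^+ 2 - 4 * a ^+ 2 * (v * h) + a * v * w -
  2 * a ^+ 2 * (v ^+ 2 + w ^+ 2 + h ^+ 2))); last by ring.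
apply: mulr_ge0 => //.
have A2 : a ^+ 2 <= a / 4 by nra.
have A3 : a ^+ 2 <= 16^-1 by nra.
have B1 : a ^+ 2 * w ^+ 2 <= 16^-1 * w ^+ 2 by apply: ler_wpM2r; [exact: sqr_ge0|].
have B2 : a ^+ 2 * h ^+ 2 <= a / 4 * h ^+ 2 by apply: ler_wpM2r; [exact: sqr_ge0|].
have B3 := sqr_ge0 (a * v - 2 * a * h).
have B4 := sqr_ge0 (a * v + w / 2).
have B5 := sqr_ge0 w; have B6 := mulr_ge0 a0 (sqr_ge0 h).
lra.
Qed.

End lyapunov.

(** * Differential inequalities for paths in L^2 *)

Section paths.
Context {R : realType} {n : nat}.
Notation E := (Rn R n).
Notation mu := (lebesgue_Rn R n).
Notation l2 := (l2 mu).
Notation nsq := (nsq mu).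
Notation ip := (ip mu).
Implicit Types (a : E -> R) (F G : R -> E -> R).

Definition l2_path F := (forall t : R, 0 <= t -> l2 (F t)) /\
  (forall s : R, 0 <= s -> l2_continuous_at F s).

Lemma l2_path_mult a F : measurable_fun setT a -> (forall x, `|a x| <= 1) ->
  l2_path F -> l2_path (fun t x => a x * F t x).
Proof.
move=> ma a1 [lF cF]; split=> [t t0|s s0]; first exact: (l2_mult ma a1 (lF t t0)).1.
by apply: l2_continuous_mult => //; exact: cF.
Qed.

Lemma l2_pathD F G : l2_path F -> l2_path G -> l2_path (fun t x => F t x + G t x).
Proof.
move=> [lF cF] [lG cG]; split=> [t t0|s s0]; first by apply: l2D; [exact: lF|exact: lG].
by apply: l2_continuousD => //; [exact: cF|exact: cG].
Qed.

Lemma truncated_derivative a (K : R) (Y Z : R -> E -> R) (s : R) : 0 < s ->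
  l2_path Y -> l2_path (fun t x => (wgt x)^-1 * Z t x) -> weak_derivative Y Z ->
  measurable_fun setT a -> (forall x, `|a x * wgt x| <= K) ->
  l2 (fun x => a x * Z s x) /\ l2_derivable (fun t x => a x * Y t x) (fun x => a x * Z s x) s.
Proof.
move=> s0 [lY cY] [lZ cZ] dYZ ma aK.
apply: (@l2_derivable_mult _ _ a K Y (Z s) s (ltW s0) lY (lZ s (ltW s0)) ma aK).
exact: (weak_derivative_estimate s0 lY lZ dYZ (cZ s (ltW s0))).
Qed.

(** The pointwise inequality of quadratic forms is integrated into a differential inequality for the
    sum of the three squared norms. *)
Lemma is_derive_sum_nsq (F1 F2 F3 : R -> E -> R) (F1' F2' F3' : E -> R) (s lam : R) : 0 < s ->
  (forall t : R, 0 <= t -> l2 (F1 t)) -> (forall t : R, 0 <= t -> l2 (F2 t)) ->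
  (forall t : R, 0 <= t -> l2 (F3 t)) -> l2 F1' -> l2 F2' -> l2 F3' ->
  l2_derivable F1 F1' s -> l2_derivable F2 F2' s -> l2_derivable F3 F3' s ->
  (forall x, 2 * (F1 s x * F1' x + F2 s x * F2' x + F3 s x * F3' x) <=
     - lam * (F1 s x ^+ 2 + F2 s x ^+ 2 + F3 s x ^+ 2)) ->
  exists2 y', is_derive s (1 : R) (fun t => nsq (F1 t) + nsq (F2 t) + nsq (F3 t)) y' &
    y' <= - lam * (nsq (F1 s) + nsq (F2 s) + nsq (F3 s)).
Proof.
move=> s0 l1 l2' l3 k1 k2 k3 d1 d2 d3 H.
exists (2 * (ip (F1 s) F1' + ip (F2 s) F2' + ip (F3 s) F3')).
  have := is_deriveD (is_deriveD (is_derive_nsq s0 l1 k1 d1) (is_derive_nsq s0 l2' k2 d2))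
    (is_derive_nsq s0 l3 k3 d3).
  by move=> /is_derive_eq; apply; ring.
have s0' := ltW s0.
have i1 := l2_ip_integrable (l1 s s0') k1; have i2 := l2_ip_integrable (l2' s s0') k2.
have i3 := l2_ip_integrable (l3 s s0') k3.
have j1 := (l1 s s0').2; have j2 := (l2' s s0').2; have j3 := (l3 s s0').2.
have i12 : mu.-integrable setT (EFin \o (fun x => F1 s x * F1' x + F2 s x * F2' x)).
  rewrite (_ : _ \o _ = fun x => ((F1 s x * F1' x)%:E + (F2 s x * F2' x)%:E)%E) //.
  exact: integrableD.
have i123 : mu.-integrable setT (EFin \o (fun x => F1 s x * F1' x + F2 s x * F2' x + F3 s x * F3' x)).
  rewrite (_ : _ \o _ = fun x => ((F1 s x * F1' x + F2 s x * F2' x)%:E + (F3 s x * F3' x)%:E)%E) //.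
  exact: integrableD.
have j12 : mu.-integrable setT (EFin \o (fun x => F1 s x ^+ 2 + F2 s x ^+ 2)).
  rewrite (_ : _ \o _ = fun x => ((F1 s x ^+ 2)%:E + (F2 s x ^+ 2)%:E)%E) //.
  exact: integrableD.
have j123 : mu.-integrable setT (EFin \o (fun x => F1 s x ^+ 2 + F2 s x ^+ 2 + F3 s x ^+ 2)).
  rewrite (_ : _ \o _ = fun x => ((F1 s x ^+ 2 + F2 s x ^+ 2)%:E + (F3 s x ^+ 2)%:E)%E) //.
  exact: integrableD.
rewrite /ip /nsq -!RintegralD // -!RintegralZl //; apply: le_Rintegral => //.
- rewrite (_ : _ \o _ = fun x => (2%:E * (F1 s x * F1' x + F2 s x * F2' x + F3 s x * F3' x)%:E)%E) //.
  exact: integrableZl.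
- rewrite (_ : _ \o _ = fun x => ((- lam)%:E * (F1 s x ^+ 2 + F2 s x ^+ 2 + F3 s x ^+ 2)%:E)%E) //.
  exact: integrableZl.
Qed.

Lemma nsq_right_cvg F t : l2_path F -> 0 <= t ->
  (fun k => nsq (F (t / k.+1%:R))) @ \oo --> nsq (F 0).
Proof.
move=> [lF cF] t0.
have p k : 0 <= t / k.+1%:R by rewrite divr_ge0.
apply: nsq_cvg => //; first by move=> k; exact: lF.
  exact: lF.
apply/cvgrPdist_le => e e0.
have [d d0 Hd] := cF 0 (lexx 0) e e0.
have c0 : (fun k => t * k.+1%:R^-1) @ \oo --> (0 : R).
  by rewrite -[X in _ --> X](mulr0 t); apply: cvgM; [exact: cvg_cst|exact: cvg_harmonic].
have /cvgrPdist_lt /(_ _ d0) := c0.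
apply: filterS => k; rewrite sub0r normrN => Hk.
rewrite sub0r normrN ger0_norm ?nsq_ge0 //.
by apply: Hd => //; rewrite subr0.
Qed.

Lemma nsq_sum_decay (F1 F2 F3 : R -> E -> R) (lam : R) :
  l2_path F1 -> l2_path F2 -> l2_path F3 ->
  (forall s : R, 0 < s -> exists2 y', is_derive s (1 : R)
     (fun t => nsq (F1 t) + nsq (F2 t) + nsq (F3 t)) y' &
    y' <= - lam * (nsq (F1 s) + nsq (F2 s) + nsq (F3 s))) ->
  forall t : R, 0 < t -> expR (lam * t) * (nsq (F1 t) + nsq (F2 t) + nsq (F3 t)) <=
    nsq (F1 0) + nsq (F2 0) + nsq (F3 0).
Proof.
move=> p1 p2 p3 H t t0.
pose y (r : R) := nsq (F1 r) + nsq (F2 r) + nsq (F3 r).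
(* At nonpositive times the derivative is given the default value 0, to make the choice function
   total. *)
have H' (s : R) : exists y' : R, 0 < s -> is_derive s (1 : R) y y' /\ y' <= - lam * y s.
  have [s0|s0] := ltP 0 s; last by exists 0.
  by have [y' h1 h2] := H s s0; exists y'.
have [y' Hy'] := choice H'.
have D := decay_of_derivative (fun s s0 => (Hy' s s0).1) (fun s s0 => (Hy' s s0).2).
(* The comparison is valid from any positive time; starting at t / (k + 1) and letting k grow
   reaches time 0. *)
have c1 : (fun k => y (t / k.+1%:R)) @ \oo --> y 0.
  by apply: cvgD; [apply: cvgD|]; apply: nsq_right_cvg => //; exact: ltW.
have c0 : (fun k => lam * (t * k.+1%:R^-1)) @ \oo --> (0 : R).
  rewrite -[X in _ --> X](mulr0 lam) -[X in lam * X](mulr0 t).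
  by apply: cvgM; [exact: cvg_cst|apply: cvgM; [exact: cvg_cst|exact: cvg_harmonic]].
have c2 : (fun k => expR (lam * (t / k.+1%:R))) @ \oo --> (1 : R).
  by rewrite -[X in _ --> X]expR0; exact: cvg_comp c0 (@continuous_expR R 0).
have c : (fun k => expR (lam * (t / k.+1%:R)) * y (t / k.+1%:R)) @ \oo --> y 0.
  by rewrite -[X in _ --> X]mul1r; exact: cvgM.
rewrite -/(y t) -/(y 0); apply: (@cvgr_to_ge _ _ _ R _ (y 0) _ c); near=> k.
apply: D; first by rewrite divr_gt0.
by rewrite ler_pdivrMr // ler_peMr ?(ltW t0) // ler1n.
Unshelve. all: by end_near. Qed.

End paths.

Section truncation.
Context {R : realType} {n : nat}.
Notation E := (Rn R n).
Notation mu := (lebesgue_Rn R n).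
Notation l2 := (l2 mu).
Notation nsq := (nsq mu).

(** The absolute value of K allows for an empty B, where K may be negative. *)
Lemma indic_bound (B : set E) (c : E -> R) (K : R) : (forall x, `|c x| <= 1) ->
  (forall x, B x -> wgt x <= K) -> forall x, `|\1_B x * c x * wgt x| <= `|K|.
Proof.
move=> c1 BK x; rewrite indicE; have [/set_mem xB|xB] := boolP (x \in B); last first.
  by rewrite !mul0r normr0.
rewrite mul1r normrM (ger0_norm (ltW (wgt_gt0 x))).
apply: le_trans (ler_wpM2r (ltW (wgt_gt0 x)) (c1 x)) _.
by rewrite mul1r; apply: le_trans (BK x xB) (ler_norm K).
Qed.

Lemma nsq_indic (B : set E) (f : E -> R) :
  nsq (fun x => \1_B x * f x) = \int[mu]_(x in B) f x ^+ 2.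
Proof.
rewrite /nsq [RHS]Rintegral_mkcond; apply: eq_Rintegral => x _; rewrite patchE indicE.
by case: ifP => _; rewrite ?mul1r // mul0r expr0n.
Qed.

Lemma truncated_combination (B : set E) (c : E -> R) (K : R) (Y ZY W ZW : R -> E -> R) (s : R) :
  0 < s -> measurable B -> (forall x, B x -> wgt x <= K) ->
  measurable_fun setT c -> (forall x, `|c x| <= 1) ->
  l2_path Y -> l2_path (fun t x => (wgt x)^-1 * ZY t x) -> weak_derivative Y ZY ->
  l2_path W -> l2_path (fun t x => (wgt x)^-1 * ZW t x) -> weak_derivative W ZW ->
  l2 (fun x => \1_B x * (ZY s x + c x * ZW s x)) /\
  l2_derivable (fun t x => \1_B x * (Y t x + c x * W t x))
    (fun x => \1_B x * (ZY s x + c x * ZW s x)) s.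
Proof.
move=> s0 mB BK mc c1 pY pZY dY pW pZW dW.
have m1 : measurable_fun setT (\1_B : E -> R) by exact: measurable_indic.
have mBc : measurable_fun setT (fun x => \1_B x * c x) by exact: measurable_funM.
have b1 (x : E) : `|\1_B x : R| <= 1 by rewrite indicE; case: (_ \in _); rewrite ?normr1 ?normr0.
have b2 (x : E) : `|\1_B x * c x| <= 1.
  by rewrite normrM mulr_ile1.
have K1 (x : E) : `|\1_B x * wgt x| <= `|K|.
  have := @indic_bound B (fun=> 1) K _ BK x; rewrite mulr1; apply => y.
  by rewrite normr1.
have [l1 d1] := truncated_derivative s0 pY pZY dY m1 K1.
have [l2' d2] := truncated_derivative s0 pW pZW dW mBc (indic_bound c1 BK).
have E1 (f g : E -> R) : (fun x => \1_B x * (f x + c x * g x)) =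
    (fun x => \1_B x * f x + \1_B x * c x * g x).
  by apply/funext => x; ring.
rewrite E1; split; first exact: l2D.
rewrite (_ : (fun (t : R) x => _) = fun t x => \1_B x * Y t x + \1_B x * c x * W t x); last first.
  by apply/funext => t; exact: E1.
apply: l2_derivableD => //; first exact: ltW.
- exact: (l2_path_mult m1 b1 pY).1.
- exact: (l2_path_mult mBc b2 pW).1.
Qed.

End truncation.

(** * Decay at almost every frequency *)

Section energy_decay.
Context {R : realType} {n : nat}.
Notation E := (Rn R n).
Notation mu := (lebesgue_Rn R n).
Notation nsq := (nsq mu).
Variables (sigma tau : R).
Hypotheses (sigma0 : 0 <= sigma) (sigma2 : sigma < 2).
Hypotheses (tau0 : 0 <= tau) (tau1 : tau <= 1) (tau2 : tau <= 4 - 2 * sigma).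

Definition damping (x : E) : R := enorm x `^ (2 * sigma).

Lemma damping_ge0 x : 0 <= damping x. Proof. exact: powR_ge0. Qed.

Lemma measurable_damping : measurable_fun setT damping.
Proof. exact: measurableT_comp (measurable_powR _) (@measurable_enorm R n). Qed.

Lemma dot_le_wgt (x : E) : dot x x <= wgt x.
Proof. rewrite /wgt; have := dot_ge0 x; nra. Qed.

Lemma powR_le1 (r a : R) : 0 <= r -> r <= 1 -> 0 <= a -> r `^ a <= 1.
Proof. by move=> r0 r1 a0; apply: (le_trans (ge0_ler_powR a0 _ _ r1)); rewrite ?nnegrE ?powR1. Qed.

Lemma damping_le_wgt x : damping x <= wgt x.
Proof.
rewrite /damping; have [r1|/ltW r1] := leP (enorm x) 1.
  apply: le_trans (wgt_ge1 x); apply: powR_le1 => //; first exact: enorm_ge0.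
  by rewrite mulr_ge0.
apply: (@le_trans _ _ (enorm x `^ 4%:R)).
  have s4 : 2 * sigma <= 4 by move: sigma2; lra.
  exact: ler_powR.
rewrite powR_mulrn ?enorm_ge0 // (_ : enorm x ^+ 4 = dot x x ^+ 2); last first.
  by rewrite -enorm_sq -exprM.
by rewrite /wgt; have := dot_ge0 x; nra.
Qed.

(** The coefficient a of [lyap]: the constant of weak damping while d <= p, and p / (4 d) beyond. *)
Definition coef_v (x : E) : R :=
  if damping x <= dot x x then 16^-1 else dot x x / 4 * enorm x `^ (- (2 * sigma)).
Definition coef_h (x : E) : R := if damping x <= dot x x then 4^-1 else 0.
(** The square root turns the third term of [lyap] into the square of a multiple of W. *)
Definition coef_w (x : E) : R := Num.sqrt (1 - coef_v x ^+ 2 / 4 - coef_h x ^+ 2 / 4).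
(** 128 comes from weak damping: a dissipation p / 64 of v^2 + w^2 + h^2, halved in passing to
    [lyap]. *)
Definition rate (x : E) : R := enorm x `^ tau / 128.

Lemma coef_vP x : 0 <= coef_v x <= 4^-1.
Proof.
rewrite /coef_v; have [dp|dp] := leP (damping x) (dot x x); first by apply/andP; split; lra.
have d0 := le_lt_trans (dot_ge0 x) dp.
rewrite powRN -/(damping x) mulr_ge0 ?invr_ge0 ?(ltW d0) ?divr_ge0 ?dot_ge0 //=.
by rewrite ler_pdivrMr // mulrC ler_wpM2l ?invr_ge0 // ltW.
Qed.

Lemma coef_hP x : 0 <= coef_h x <= 4^-1.
Proof. by rewrite /coef_h; case: (leP (damping x) (dot x x)) => _; apply/andP; split; lra. Qed.

Lemma coef_w_ge0 x : 0 <= 1 - coef_v x ^+ 2 / 4 - coef_h x ^+ 2 / 4.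
Proof. have /andP[a0 a1] := coef_vP x; have /andP[b0 b1] := coef_hP x; nra. Qed.

Lemma coef_w_sq x : coef_w x ^+ 2 = 1 - coef_v x ^+ 2 / 4 - coef_h x ^+ 2 / 4.
Proof. by rewrite sqr_sqrtr // coef_w_ge0. Qed.

Lemma measurable_coef_v : measurable_fun setT coef_v.
Proof.
apply: measurable_fun_ifT => //.
  by apply: measurable_fun_ler; [exact: measurable_damping|exact: measurable_dot_sq].
apply: measurable_funM; first by apply: measurable_funM => //; exact: measurable_dot_sq.
exact: measurableT_comp (measurable_powR _) (@measurable_enorm R n).
Qed.

Lemma measurable_coef_h : measurable_fun setT coef_h.
Proof.
apply: measurable_fun_ifT => //.
by apply: measurable_fun_ler; [exact: measurable_damping|exact: measurable_dot_sq].
Qed.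

Lemma measurable_coef_w : measurable_fun setT coef_w.
Proof.
rewrite (_ : coef_w = (@powR R ^~ (2^-1)) \o
    (fun x => 1 - coef_v x ^+ 2 / 4 - coef_h x ^+ 2 / 4)); last first.
  by apply/funext => x /=; rewrite powR12_sqrt // coef_w_ge0.
apply: (measurableT_comp (measurable_powR _)).
apply: measurable_funB; [apply: measurable_funB => //|]; apply: measurable_funM => //;
  apply: measurable_funX; [exact: measurable_coef_v|exact: measurable_coef_h].
Qed.

Lemma measurable_rate : measurable_fun setT rate.
Proof.
apply: measurable_funM => //.
exact: measurableT_comp (measurable_powR _) (@measurable_enorm R n).
Qed.

(** For |xi| <= 1 the power |xi|^tau may exceed p; the - 1 makes the right-hand side nonnegative
    there, so that it is enough for the energy not to increase. *)
Lemma dlyap_rate x (v w h : R) :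
  dlyap (dot x x) (damping x) (coef_v x) (coef_h x) v w h <=
  - (rate x - 1) * lyap (coef_v x) (coef_h x) v w h.
Proof.
have av := coef_vP x; have bh := coef_hP x.
have q1 := lyap_ge v w h av bh; have q2 := lyap_le v w h av bh.
have S0 : 0 <= v ^+ 2 + w ^+ 2 + h ^+ 2 by rewrite !addr_ge0 ?sqr_ge0.
have q0 : 0 <= lyap (coef_v x) (coef_h x) v w h by lra.
have p0 := dot_ge0 x; have d0 := damping_ge0 x; have r0 := enorm_ge0 x.
suff [rho [rho0 Hrho Hd]] : exists rho, [/\ 0 <= rho, rate x - 1 <= rho &
    dlyap (dot x x) (damping x) (coef_v x) (coef_h x) v w h <=
    - (2 * rho) * (v ^+ 2 + w ^+ 2 + h ^+ 2)].
  apply: (le_trans Hd).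
  have := ler_wpM2l rho0 q2; have := ler_wpM2r q0 Hrho; lra.
have r1 : enorm x <= 1 -> rate x - 1 <= 0.
  by move=> r1; have := powR_le1 r0 r1 tau0; rewrite /rate; lra.
rewrite /coef_v /coef_h; have [dp|dp] := leP (damping x) (dot x x).
  exists (dot x x / 128); split; first by lra.
    have [/r1 H1|/ltW H1] := leP (enorm x) 1; first by lra.
    have t2 : tau <= 2 by move: tau1; lra.
    have : enorm x `^ tau <= enorm x `^ 2%:R by exact: ler_powR.
    by rewrite powR_mulrn // enorm_sq /rate; lra.
  have := dlyap_weak_damping v w h d0 dp; lra.
have d1 := le_lt_trans p0 dp.
set a := dot x x / 4 * _.
have aE : a = dot x x / 4 / damping x by rewrite /a powRN.
have a4 : 0 <= a <= 4^-1 by move: av; rewrite /coef_v [damping x <= _]leNgt dp.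
have pE : dot x x = 4 * a * damping x.
  by rewrite aE; field; rewrite gt_eqF.
(* a^2 d = p^2 / (16 d) is |xi|^(4 - 2 sigma) / 16 away from the origin; this is where tau <= 4 - 2
   sigma enters. *)
exists (a ^+ 2 * damping x); split; first by rewrite mulr_ge0 ?sqr_ge0.
  have [/r1 H1|H1] := leP (enorm x) 1; first by rewrite (le_trans H1) // mulr_ge0 ?sqr_ge0.
  have r00 : 0 < enorm x by exact: lt_trans H1.
  have : enorm x `^ tau <= enorm x `^ (4%:R - 2 * sigma) by rewrite ler_powR // ltW.
  rewrite powRB; last by rewrite (gt_eqF r00) implybT.
  rewrite powR_mulrn // -/(damping x) (_ : enorm x ^+ 4 = dot x x ^+ 2); last first.
    by rewrite -enorm_sq -exprM.
  rewrite (_ : dot x x ^+ 2 / damping x = 16 * (a ^+ 2 * damping x)); last first.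
    by rewrite aE; field; rewrite gt_eqF.
  have : 0 <= a ^+ 2 * damping x by rewrite mulr_ge0 ?sqr_ge0.
  by rewrite /rate; lra.
rewrite {1}pE; have := dlyap_strong_damping v w h d0 a4; lra.
Qed.

Variables V W H : R -> E -> R.
Hypotheses (pV : l2_path V) (pW : l2_path W) (pH : l2_path H).
Hypotheses (dV : weak_derivative V (fun t x => dot x x * W t x))
  (dW : weak_derivative W (fun t x => - dot x x * V t x + dot x x * H t x - damping x * W t x))
  (dH : weak_derivative H (fun t x => - dot x x * H t x - dot x x * W t x)).

Let energy (t : R) (x : E) := lyap (coef_v x) (coef_h x) (V t x) (W t x) (H t x).

Let G1 (t : R) (x : E) := V t x + coef_v x / 2 * W t x.
Let G2 (t : R) (x : E) := H t x + coef_h x / 2 * W t x.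
Let G3 (t : R) (x : E) := coef_w x * W t x.

Let energyE t x : energy t x = G1 t x ^+ 2 + G2 t x ^+ 2 + G3 t x ^+ 2.
Proof. by rewrite /energy /lyap /G1 /G2 /G3 [in RHS]exprMn coef_w_sq. Qed.

Let mv2 : measurable_fun setT (fun x => coef_v x / 2).
Proof. by apply: measurable_funM => //; exact: measurable_coef_v. Qed.
Let mh2 : measurable_fun setT (fun x => coef_h x / 2).
Proof. by apply: measurable_funM => //; exact: measurable_coef_h. Qed.
Let bv2 x : `|coef_v x / 2| <= 1.
Proof. by have /andP[a0 a1] := coef_vP x; rewrite ger0_norm; lra. Qed.
Let bh2 x : `|coef_h x / 2| <= 1.
Proof. by have /andP[a0 a1] := coef_hP x; rewrite ger0_norm; lra. Qed.
Let bw x : `|coef_w x| <= 1.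
Proof.
rewrite ger0_norm ?sqrtr_ge0 // -(@ler_pXn2r _ 2) ?nnegrE ?sqrtr_ge0 // expr1n coef_w_sq.
by have := sqr_ge0 (coef_v x); have := sqr_ge0 (coef_h x); lra.
Qed.

Let pG1 : l2_path G1. Proof. by apply: l2_pathD => //; exact: l2_path_mult. Qed.
Let pG2 : l2_path G2. Proof. by apply: l2_pathD => //; exact: l2_path_mult. Qed.
Let pG3 : l2_path G3.
Proof. by apply: l2_path_mult => //; exact: measurable_coef_w. Qed.

Let integrable_energy t : 0 <= t -> mu.-integrable setT (EFin \o energy t).
Proof.
move=> t0; rewrite (_ : _ \o _ = fun x => ((G1 t x ^+ 2)%:E + (G2 t x ^+ 2)%:E + (G3 t x ^+ 2)%:E)%E).
  apply: integrableD => //; [apply: integrableD => //|].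
  - exact: (pG1.1 t t0).2.
  - exact: (pG2.1 t t0).2.
  - exact: (pG3.1 t t0).2.
by apply/funext => x /=; rewrite energyE.
Qed.

(** After division by wgt, multiplication by |xi|^2 or |xi|^(2 sigma) is a contraction of L^2. *)
Let quotient_path (a : E -> R) (F : R -> E -> R) : measurable_fun setT a -> (forall x, 0 <= a x <= wgt x) ->
  l2_path F -> l2_path (fun t (x : E) => (wgt x)^-1 * (a x * F t x)).
Proof.
move=> ma aw pF.
rewrite (_ : (fun t x => _) = fun t x => (wgt x)^-1 * a x * F t x); last first.
  by apply/funext => t; apply/funext => x; rewrite mulrA.
apply: l2_path_mult => //; first by apply: measurable_funM => //; exact: measurable_wgtV.
move=> x; have /andP[a0 a1] := aw x.
by rewrite ger0_norm ?mulr_ge0 ?invr_ge0 ?(ltW (wgt_gt0 x)) // mulrC ler_pdivrMr ?wgt_gt0 // mul1r.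
Qed.

Let negative_path (F : R -> E -> R) : l2_path F -> l2_path (fun t x => - F t x).
Proof.
move=> pF; rewrite (_ : (fun t x => _) = fun t x => -1 * F t x); last first.
  by apply/funext => t; apply/funext => x; rewrite mulN1r.
by apply: l2_path_mult => // x; rewrite normrN1.
Qed.

Let pp (x : E) : 0 <= dot x x <= wgt x. Proof. by rewrite dot_ge0 dot_le_wgt. Qed.
Let pd x : 0 <= damping x <= wgt x. Proof. by rewrite damping_ge0 damping_le_wgt. Qed.
Let mp := @measurable_dot_sq R n.

Let pZV : l2_path (fun t (x : E) => (wgt x)^-1 * (dot x x * W t x)).
Proof. exact: quotient_path. Qed.

Let pZW : l2_path (fun t (x : E) => (wgt x)^-1 *
  (- dot x x * V t x + dot x x * H t x - damping x * W t x)).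
Proof.
have := l2_pathD (l2_pathD (negative_path (quotient_path mp pp pV)) (quotient_path mp pp pH))
  (negative_path (quotient_path measurable_damping pd pW)).
by congr l2_path; apply/funext => t; apply/funext => x; ring.
Qed.

Let pZH : l2_path (fun t (x : E) => (wgt x)^-1 * (- dot x x * H t x - dot x x * W t x)).
Proof.
have := l2_pathD (negative_path (quotient_path mp pp pH)) (negative_path (quotient_path mp pp pW)).
by congr l2_path; apply/funext => t; apply/funext => x; ring.
Qed.

Lemma energy_integral_decay (B : set E) (K lam t : R) : measurable B ->
  (forall x, B x -> wgt x <= K) -> (forall x, B x -> lam <= rate x - 1) -> 0 < t ->
  \int[mu]_(x in B) (expR (lam * t) * energy t x) <= \int[mu]_(x in B) energy 0 x.
Proof.
move=> mB BK Blam t0.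
have m1 : measurable_fun setT (\1_B : E -> R) by exact: measurable_indic.
have b1 (x : E) : `|\1_B x : R| <= 1 by rewrite indicE; case: (_ \in _); rewrite ?normr1 ?normr0.
have sumE r : 0 <= r -> nsq (fun x => \1_B x * G1 r x) + nsq (fun x => \1_B x * G2 r x) +
    nsq (fun x => \1_B x * G3 r x) = \int[mu]_(x in B) energy r x.
  move=> r0.
  have i1 : mu.-integrable B (EFin \o (fun x => G1 r x ^+ 2)).
    by apply: integrableS (pG1.1 r r0).2.
  have i2 : mu.-integrable B (EFin \o (fun x => G2 r x ^+ 2)).
    by apply: integrableS (pG2.1 r r0).2.
  have i3 : mu.-integrable B (EFin \o (fun x => G3 r x ^+ 2)).
    by apply: integrableS (pG3.1 r r0).2.
  have i12 : mu.-integrable B (EFin \o (fun x => G1 r x ^+ 2 + G2 r x ^+ 2)).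
    rewrite (_ : _ \o _ = fun x => ((G1 r x ^+ 2)%:E + (G2 r x ^+ 2)%:E)%E) //.
    exact: integrableD.
  by rewrite !nsq_indic -!RintegralD //; apply: eq_Rintegral => x _; rewrite energyE.
have iB r : 0 <= r -> mu.-integrable B (EFin \o energy r).
  by move=> r0; apply: integrableS (integrable_energy r0).
rewrite RintegralZl //; last by apply: iB; exact: ltW.
rewrite -!sumE ?(ltW t0) //.
apply: (@nsq_sum_decay _ _ (fun r x => \1_B x * G1 r x) (fun r x => \1_B x * G2 r x)
  (fun r x => \1_B x * G3 r x)) => //; [exact: l2_path_mult|exact: l2_path_mult|exact: l2_path_mult|].
move=> s s0.
have [k1 D1] := truncated_combination s0 mB BK mv2 bv2 pV pZV dV pW pZW dW.
have [k2 D2] := truncated_combination s0 mB BK mh2 bh2 pH pZH dH pW pZW dW.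
have m3 : measurable_fun setT (fun x => \1_B x * coef_w x).
  by apply: measurable_funM => //; exact: measurable_coef_w.
have [k3 D3] := truncated_derivative s0 pW pZW dW m3 (indic_bound bw BK).
have D3' : l2_derivable (fun r x => \1_B x * G3 r x) (fun x => \1_B x * coef_w x *
    (- dot x x * V s x + dot x x * H s x - damping x * W s x)) s.
  rewrite (_ : (fun r x => _) = fun r x => \1_B x * coef_w x * W r x) //.
  by apply/funext => r; apply/funext => x; rewrite mulrA.
apply: (is_derive_sum_nsq s0 _ _ _ k1 k2 k3 D1 D2 D3').
- exact: (l2_path_mult m1 b1 pG1).1.
- exact: (l2_path_mult m1 b1 pG2).1.
- exact: (l2_path_mult m1 b1 pG3).1.
(* Outside B both sides vanish; on B this is [dlyap_rate] with the rate bounded below by lam. *)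
move=> x; rewrite indicE; have [/set_mem xB|xB] := boolP (x \in B); last first.
  by rewrite !(mul0r, expr0n) /= !(addr0, mulr0).
rewrite !mul1r.
have Hd := dlyap_rate x (V s x) (W s x) (H s x).
have q0 : 0 <= lyap (coef_v x) (coef_h x) (V s x) (W s x) (H s x).
  have := lyap_ge (V s x) (W s x) (H s x) (coef_vP x) (coef_hP x).
  by have := sqr_ge0 (V s x); have := sqr_ge0 (W s x); have := sqr_ge0 (H s x); lra.
have := ler_wpM2r q0 (Blam x xB).
rewrite -energyE /energy.
move: Hd; rewrite /dlyap (_ : G3 s x * _ = coef_w x ^+ 2 * W s x *
  (- dot x x * V s x + dot x x * H s x - damping x * W s x)); last by rewrite /G3; ring.
rewrite coef_w_sq /G1 /G2; lra.
Qed.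

Lemma energy_decay t : 0 < t -> {ae mu, forall x,
  V t x ^+ 2 + W t x ^+ 2 + H t x ^+ 2 <=
  4 * expR (2 * t) * expR (- (rate x * t)) * (V 0 x ^+ 2 + W 0 x ^+ 2 + H 0 x ^+ 2)}.
Proof.
move=> t0.
(* Bounded frequencies on which the rate is at least an integer. There are countably many such sets,
   so the exceptional null sets can be collected. *)
pose D (k : nat * nat) := [set x : E | wgt x <= k.1%:R] `&` [set x | k.2%:R <= rate x].
have mD k : measurable (D k).
  apply: measurableI; rewrite -[X in measurable X]setTI.
    have := measurable_fun_ler (@measurable_wgt R n) (@measurable_cst _ _ _ _ setT (k.1%:R : R)).
    move=> /(_ measurableT [set true] I).
    by congr (measurable (_ `&` _)); apply/seteqP; split => x /=; case: (_ <= _).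
  have := measurable_fun_ler (@measurable_cst _ _ _ _ setT (k.2%:R : R)) measurable_rate.
  move=> /(_ measurableT [set true] I).
  by congr (measurable (_ `&` _)); apply/seteqP; split => x /=; case: (_ <= _).
have ae N j : {ae mu, forall x, D (N, j) x -> expR ((j%:R - 1) * t) * energy t x <= energy 0 x}.
  apply: ae_le_of_integrals => //.
  - rewrite (_ : _ \o _ = fun x => ((expR ((j%:R - 1) * t))%:E * (energy t x)%:E)%E) //.
    by apply: integrableZl => //; apply: integrable_energy; exact: ltW.
  - exact: integrable_energy.
  - move=> B mB BD; apply: (@energy_integral_decay _ N%:R) => //.
    + by move=> x /BD[].
    + by move=> x /BD[_ /= h]; rewrite lerD2r.
have := ae_foralln (fun N => ae_foralln (ae N)); apply: filterS => x Hx.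
have r0 : 0 <= rate x by rewrite divr_ge0 ?powR_ge0.
(* With j the integer part of the rate, - (j - 1) t <= 2 t - rate t. The factor 4 of the claim
   combines the 2 of [lyap_ge] with the 2 of [lyap_le]. *)
have /andP[t1 t2] := truncn_itv r0; set j := Num.trunc (rate x) in t1 t2.
have w1 := ltW (truncnS_gt (wgt x)).
have := Hx _ j (conj w1 t1).
have g1 := lyap_ge (V t x) (W t x) (H t x) (coef_vP x) (coef_hP x).
have g2 := lyap_le (V 0 x) (W 0 x) (H 0 x) (coef_vP x) (coef_hP x).
rewrite -/(energy t x) in g1; rewrite -/(energy 0 x) in g2.
rewrite -ler_pdivlMl ?expR_gt0 // -expRN => Hq.
apply: (le_trans g1).
have e1 : expR (- ((j%:R - 1) * t)) <= expR (2 * t) * expR (- (rate x * t)).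
  rewrite -expRD ler_expR; move: t2; rewrite -natr1 => t2.
  have := ler_wpM2r (ltW t0) (ltW t2); lra.
have S0 : 0 <= V 0 x ^+ 2 + W 0 x ^+ 2 + H 0 x ^+ 2 by rewrite !addr_ge0 ?sqr_ge0.
have h1 := ler_wpM2l (expR_ge0 (- ((j%:R - 1) * t))) g2.
have h2 := ler_wpM2r S0 e1.
lra.
Qed.

End energy_decay.

(** * The Cauchy problem on the Fourier side *)

Section fourier_side.
Context {R : realType} {n : nat}.
Notation E := (Rn R n).
Notation mu := (lebesgue_Rn R n).
Notation nsq := (nsq mu).
Notation C := (R[i]).
Notation FC := (@fourier_const R n).
Implicit Types (X Z : R -> E -> C) (T : R -> distribution_Rn R n).

Lemma L2norm_cnsq (f : E -> C) : L2 f -> (L2norm f `^ 2)%E = (cnsq f)%:E.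
Proof.
move=> lf; rewrite /L2norm powR_Lnorm // cnsqE // fineK.
  apply: eq_integral => x _; rewrite /= ger0_norm ?normc_ge0 // powR_mulrn ?normc_ge0 //.
have /L2P[[_ i1] [_ i2]] := lf.
apply: integrable_fin_num => //.
rewrite (_ : (fun x => _) = fun x => ((complex.Re (f x) ^+ 2)%:E + (complex.Im (f x) ^+ 2)%:E)%E).
  exact: integrableD.
by apply/funext => x /=; rewrite normc_sq.
Qed.

Lemma ae_eq_cnsq (f g : E -> C) : L2 f -> L2 g -> {ae mu, forall x, f x = g x} -> cnsq f = cnsq g.
Proof.
move=> /L2P[[f1 _] [f2 _]] /L2P[[g1 _] [g2 _]] fg; rewrite /cnsq.
congr (_ + _); apply: ae_eq_nsq => //; by apply: filterS fg => x ->.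
Qed.

Lemma ae_eq_cintegral (f g : E -> C) : cmeasurable f -> cmeasurable g ->
  {ae mu, forall x, f x = g x} -> cintegral f = cintegral g.
Proof.
move=> [f1 f2] [g1 g2] fg.
apply: complex_ext; rewrite ?Re_cintegral ?Im_cintegral /Rintegral; congr fine;
  apply: ae_eq_integral => //; try exact/measurable_EFinP.
- by apply: filterS fg => x -> _.
- by apply: filterS fg => x -> _.
Qed.

Definition represents T X := forall t : R, 0 <= t -> forall phi, schwartz phi ->
  T t (fourier phi) = cintegral (fun x => X t x * phi x).

(** The transform is chosen separately at each time. Continuity survives because X t - X s is almost
    everywhere the transform of f t - f s, whose norm is controlled by [fourier_of_L2]. *)
Lemma continuous_L2_fourier T : continuous_L2 T -> exists X,
  [/\ forall t : R, 0 <= t -> L2 (X t), represents T X,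
      l2_path (fun t x => complex.Re (X t x)) & l2_path (fun t x => complex.Im (X t x))].
Proof.
move=> [f [Hf cf]].
have ex (t : R) : exists h : E -> C, 0 <= t -> [/\ L2 h, cnsq h <= 4 * FC * cnsq (f t) &
      forall phi, schwartz phi ->
        cintegral (fun x => f t x * fourier phi x) = cintegral (fun x => h x * phi x)].
  (* At negative times the value is an arbitrary default. *)
  have [t0|t0] := leP 0 t; last by exists (f t).
  by have [h Hh] := fourier_of_L2 (Hf t t0).1; exists h.
have [X HX] := choice ex.
have lX (t : R) : 0 <= t -> L2 (X t) by move=> /HX[].
have rep (t : R) phi : 0 <= t -> schwartz phi ->
    cintegral (fun x => f t x * fourier phi x) = cintegral (fun x => X t x * phi x).
  by move=> t0; have [_ _ H] := HX t t0; exact: H.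
have iF (g : E -> C) phi : L2 g -> schwartz phi -> cintegrable (fun x => g x * fourier phi x).
  by move=> lg sp; apply: L2M_cintegrable => //; apply: schwartz_L2; exact: schwartz_fourier.
have iS (g : E -> C) phi : L2 g -> schwartz phi -> cintegrable (fun x => g x * phi x).
  by move=> lg sp; apply: L2M_cintegrable => //; exact: schwartz_L2.
have cont (s e : R) : 0 <= s -> 0 < e -> exists2 d : R, 0 < d & forall t : R, 0 <= t ->
    `|t - s| < d -> cnsq (fun x => X t x - X s x) <= e.
  move=> s0 e0; have K0 : 0 < 4 * FC by rewrite mulr_gt0 // fourier_const_gt0.
  pose e1 := Num.sqrt (e / (4 * FC)).
  have e10 : 0 < e1 by rewrite sqrtr_gt0 divr_gt0.
  have /fine_cvgP[fin /cvgrPdist_lt /(_ _ e10) cv] := cf s s0.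
  have [d d0 Hd] := filterI fin cv.
  exists d => // t t0 td.
  have [] := Hd t _ t0; first by rewrite /ball /= distrC.
  set N := L2norm _ => Nfin; rewrite /= sub0r normrN => Nlt.
  have lft := L2B (Hf t t0).1 (Hf s s0).1.
  have nE : cnsq (fun x => f t x - f s x) = fine N ^+ 2.
    have := L2norm_cnsq lft; rewrite -/N -(fineK Nfin) poweR_EFin => -[<-].
    by rewrite powR_mulrn // fine_ge0 // Lnorm_ge0.
  have nlt : fine N ^+ 2 <= e / (4 * FC).
    rewrite -(@sqr_sqrtr _ (e / (4 * FC))); last by rewrite divr_ge0 ?ltW.
    by rewrite -real_normK ?num_real // lerXn2r ?nnegrE ?sqrtr_ge0 // ltW.
  have [h [lh ch Hh]] := fourier_of_L2 lft.
  have -> : cnsq (fun x => X t x - X s x) = cnsq h.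
    have lD := L2B (lX t t0) (lX s s0).
    apply: ae_eq_cnsq => //; apply: tempered_fun_unique; [exact: L2_tempered_fun..|].
    move=> phi sp; rewrite -Hh //.
    transitivity (cintegral (fun x => X t x * phi x + (- 1) * (X s x * phi x))).
      by apply: eq_cintegral => x; ring.
    have lt_ := lX t t0; have ls := lX s s0.
    rewrite cintegralD ?cintegralZ -?rep //; try exact: iS; last first.
      by apply: cintegrableZ; exact: iS.
    rewrite -cintegralZ; last by apply: iF => //; exact: (Hf s s0).1.
    rewrite -cintegralD; last 2 first.
    - by apply: iF => //; exact: (Hf t t0).1.
    - by apply: cintegrableZ; apply: iF => //; exact: (Hf s s0).1.
    by apply: eq_cintegral => x; ring.
  apply: (le_trans ch); rewrite nE mulrC -ler_pdivlMr //.
exists X; split => //.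
- move=> t t0 phi sp; rewrite (Hf t t0).2; last exact: schwartz_fourier.
  exact: rep.
- split=> [t t0|s s0 e e0]; first by have /L2P[] := lX t t0.
  have [d d0 Hd] := cont s e s0 e0; exists d => // t t0 td.
  apply: le_trans (Hd t t0 td); rewrite /cnsq.
  rewrite [X in nsq X <= _](_ : _ = fun x => complex.Re (X t x - X s x)); last first.
    by apply/funext => x; rewrite cReD cReN.
  by rewrite lerDl nsq_ge0.
- split=> [t t0|s s0 e e0]; first by have /L2P[] := lX t t0.
  have [d d0 Hd] := cont s e s0 e0; exists d => // t t0 td.
  apply: le_trans (Hd t t0 td); rewrite /cnsq.
  rewrite [X in nsq X <= _](_ : _ = fun x => complex.Im (X t x - X s x)); last first.
    by apply/funext => x; rewrite cImD cImN.
  by rewrite lerDr nsq_ge0.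
Qed.

(** Real test functions decouple the real and the imaginary part, so the energy method can run on
    real functions. *)
Lemma weak_derivative_parts T T' X Z : represents T X -> is_time_derivative T T' ->
  (forall t : R, 0 < t -> forall phi, schwartz phi ->
     T' t (fourier phi) = cintegral (fun x => Z t x * phi x)) ->
  weak_derivative (fun t x => complex.Re (X t x)) (fun t x => complex.Re (Z t x)) /\
  weak_derivative (fun t x => complex.Im (X t x)) (fun t x => complex.Im (Z t x)).
Proof.
move=> rX dT rZ; split.
  exists (fun psi t => complex.Re (T t (fourier (fun x => (psi x)%:C)))) => psi sp.
  split=> [t t0|t t0].
    rewrite rX // Re_cintegral; apply: eq_Rintegral => x _.
    by rewrite cReM Rec Imc mulr0 subr0.
  have [+ _] := dT _ (schwartz_fourier sp) t t0.
  rewrite rZ // Re_cintegral => /is_derive_eq; apply; apply: eq_Rintegral => x _.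
  by rewrite cReM Rec Imc mulr0 subr0.
exists (fun psi t => complex.Im (T t (fourier (fun x => (psi x)%:C)))) => psi sp.
split=> [t t0|t t0].
  rewrite rX // Im_cintegral; apply: eq_Rintegral => x _.
  by rewrite cImM Rec Imc mulr0 add0r.
have [_ +] := dT _ (schwartz_fourier sp) t t0.
rewrite rZ // Im_cintegral => /is_derive_eq; apply; apply: eq_Rintegral => x _.
by rewrite cImM Rec Imc mulr0 add0r.
Qed.

Lemma laplacian_fourierE (phi : E -> C) : schwartz phi ->
  laplacian (fourier phi) = fourier (fun x => - 1 * ((dot x x)%:C * phi x)).
Proof.
move=> sp; apply/funext => xi; rewrite laplacian_fourier // fourierZ; last exact: schwartz_dot.
by rewrite mulN1r.
Qed.

End fourier_side.

(** * Decay of the transformed solution *)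

Section solutions.
Context {R : realType} {n : nat}.
Notation E := (Rn R n).
Notation mu := (lebesgue_Rn R n).
Notation C := (R[i]).
Implicit Types f g phi : E -> C.

Lemma L2_mult (a : E -> R) (K : R) f : measurable_fun setT a -> (forall x, `|a x| <= K) ->
  L2 f -> L2 (fun x => (a x)%:C * f x).
Proof.
move=> ma aK /L2P[f1 f2]; apply/L2P; split.
  rewrite (_ : (fun x => _) = fun x => a x * complex.Re (f x)).
    exact: (l2_mult ma aK f1).1.
  by apply/funext => x; rewrite cReM Rec Imc mul0r subr0.
rewrite (_ : (fun x => _) = fun x => a x * complex.Im (f x)).
  exact: (l2_mult ma aK f2).1.
by apply/funext => x; rewrite cImM Rec Imc mul0r addr0.
Qed.

Lemma L2S_cintegrable f phi : L2 f -> schwartz phi -> cintegrable (fun x => f x * phi x).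
Proof. by move=> lf sp; apply: L2M_cintegrable => //; exact: schwartz_L2. Qed.

Variable sigma : R.
Hypotheses (sigma0 : 0 <= sigma) (sigma2 : sigma < 2).

(** As |xi|^(2 sigma) need not be smooth, it is split into a bounded factor, given to f, and wgt,
    given to phi. *)
Lemma damping_cintegrable f phi : L2 f -> schwartz phi ->
  cintegrable (fun x => (damping sigma x)%:C * f x * phi x).
Proof.
move=> lf sp.
rewrite (_ : (fun x => _) =
  fun x => (damping sigma x / wgt x)%:C * f x * ((wgt x)%:C * phi x)); last first.
  apply/funext => x; rewrite rmorphM mulrACA mulrA; congr (_ * _).
  have w0 : (wgt x)%:C != 0 :> C by rewrite eq_complex /= negb_and gt_eqF // wgt_gt0.
  by rewrite fmorphV; field.
apply: L2S_cintegrable; last exact: schwartz_wgt.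
apply: (@L2_mult _ 1) => //.
  by apply: measurable_funM; [exact: measurable_damping|exact: measurable_wgtV].
move=> x; rewrite ger0_norm ?divr_ge0 ?damping_ge0 ?(ltW (wgt_gt0 x)) //.
by rewrite ler_pdivrMr ?wgt_gt0 // mul1r damping_le_wgt.
Qed.

(** [is_absD] only provides some function as transform of T; by uniqueness it is f almost
    everywhere. *)
Lemma absD_damping (T U : distribution_Rn R n) f : L2 f ->
  (forall phi, schwartz phi -> T (fourier phi) = cintegral (fun x => f x * phi x)) ->
  is_absD (2 * sigma) T U -> forall phi, schwartz phi ->
  U (fourier phi) = cintegral (fun x => (damping sigma x)%:C * f x * phi x).
Proof.
move=> lf Tf [h [[th Th] [tU HU]]] phi sp.
have fh : {ae mu, forall x, f x = h x}.
  apply: tempered_fun_unique => //; first exact: L2_tempered_fun.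
  by move=> psi sp'; rewrite -Tf // -[RHS]Th.
rewrite -[LHS]/(dist_fourier U phi) HU // /dist_of.
have md : cmeasurable (fun x : E => (damping sigma x)%:C).
  by split; [exact: measurable_damping|exact: measurable_cst].
have mphi := schwartz_measurable sp.
apply: ae_eq_cintegral.
- by apply: cmeasurableM => //; apply: cmeasurableM => //; exact: th.1.
- by apply: cmeasurableM => //; apply: cmeasurableM => //; exact: L2_cmeasurable.
- by apply: filterS fh => x ->.
Qed.

Variables (u0 : distribution_Rn R n) (u1 theta0 : E -> C).
Variables (u ut theta : R -> distribution_Rn R n).
Hypothesis sol : cauchy_solution sigma u0 u1 theta0 u ut theta.
Variable tau : R.
Hypotheses (tau0 : 0 <= tau) (tau1 : tau <= 1) (tau2 : tau <= 4 - 2 * sigma).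

Lemma cauchy_solution_decay : exists V W H : R -> E -> C,
  [/\ (forall t : R, 0 <= t -> [/\ L2 (V t), L2 (W t) & L2 (H t)]),
      represents (fun t => dist_absD2 (u t)) V, represents ut W, represents theta H &
      forall t : R, 0 < t -> {ae mu, forall x,
        normc (V t x) ^+ 2 + normc (W t x) ^+ 2 + normc (H t x) ^+ 2 <=
        4 * expR (2 * t) * expR (- (rate tau x * t)) *
        (normc (V 0 x) ^+ 2 + normc (W 0 x) ^+ 2 + normc (H 0 x) ^+ 2)}].
Proof.
have [V [lV rV pV1 pV2]] := continuous_L2_fourier (sol_absD2u sol).
have [W [lW rW pW1 pW2]] := continuous_L2_fourier (sol_ut sol).
have [H [lH rH pH1 pH2]] := continuous_L2_fourier (sol_theta sol).
exists V, W, H; split => //; first by move=> t t0; split; [exact: lV|exact: lW|exact: lH].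
have lapl T X (t : R) phi : represents T X -> (forall t : R, 0 <= t -> L2 (X t)) ->
    0 < t -> schwartz phi ->
    T t (laplacian (fourier phi)) = - cintegral (fun x => (dot x x)%:C * X t x * phi x) /\
    cintegrable (fun x => (dot x x)%:C * X t x * phi x).
  move=> rX lX /ltW t0 sp; have sd := schwartz_dot sp.
  have E1 : (fun x => (dot x x)%:C * X t x * phi x) = fun x => X t x * ((dot x x)%:C * phi x).
    by apply/funext => x; rewrite mulrCA mulrA.
  have i1 := L2S_cintegrable (lX t t0) sd.
  split; last by rewrite E1.
  rewrite laplacian_fourierE // rX //; last exact: schwartz_scale.
  rewrite E1 -[RHS]mulN1r -cintegralZ //.
  by apply: eq_cintegral => x; ring.
pose ZV (t : R) x : C := (dot x x)%:C * W t x.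
pose ZW (t : R) x : C := - 1 * ((dot x x)%:C * V t x) + ((dot x x)%:C * H t x +
  - 1 * ((damping sigma x)%:C * W t x)).
pose ZH (t : R) x : C := - 1 * ((dot x x)%:C * H t x) + - 1 * ((dot x x)%:C * W t x).
have [dV1 dV2] : weak_derivative (fun t x => complex.Re (V t x)) (fun t x => complex.Re (ZV t x)) /\
    weak_derivative (fun t x => complex.Im (V t x)) (fun t x => complex.Im (ZV t x)).
  (* The equation for V is the relation between u and u_t tested against minus the Laplacian of a
     Schwartz function. *)
  apply: (@weak_derivative_parts _ _ _ (fun t => dist_absD2 (ut t)) _ _ rV).
    move=> f sf t t0; have [d1 d2] := sol_ut_derivative sol (schwartz_laplacian sf) t0.
    rewrite /dist_absD2 /dist_laplacian; split.
      rewrite (_ : (fun r => _) = - (fun r => complex.Re (u r (laplacian f)))).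
        by rewrite cReN; exact: is_deriveN.
      by apply/funext => r; rewrite cReN.
    rewrite (_ : (fun r => _) = - (fun r => complex.Im (u r (laplacian f)))).
      by rewrite cImN; exact: is_deriveN.
    by apply/funext => r; rewrite cImN.
  move=> t t0 phi sp; rewrite /dist_absD2 /dist_laplacian.
  by rewrite (lapl ut W t phi rW lW t0 sp).1 opprK.
have [dW1 dW2] : weak_derivative (fun t x => complex.Re (W t x)) (fun t x => complex.Re (ZW t x)) /\
    weak_derivative (fun t x => complex.Im (W t x)) (fun t x => complex.Im (ZW t x)).
  have [utt [damp [dut Hdamp Heq]]] := sol_plate_eq sol.
  apply: (weak_derivative_parts rW dut) => t t0 phi sp.
  have := Heq t t0 (fourier phi) (schwartz_fourier sp).
  rewrite /dist_laplacian (lapl theta H t phi rH lH t0 sp).1.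
  rewrite (absD_damping (lW t (ltW t0)) (rW t (ltW t0)) (Hdamp t t0) sp).
  have [EV iV] := lapl _ V t phi rV lV t0 sp.
  (* The transform of u itself need not be a function, so one of the two Laplacians stays on u and
     gives V. *)
  have -> : u t (laplacian (laplacian (fourier phi))) =
      cintegral (fun x => (dot x x)%:C * V t x * phi x).
    by apply: oppr_inj; rewrite -EV.
  have iH := (lapl theta H t phi rH lH t0 sp).2.
  have iW := damping_cintegrable (lW t (ltW t0)) sp.
  move=> EQ.
  transitivity (cintegral (fun x => - 1 * ((dot x x)%:C * V t x * phi x) +
     ((dot x x)%:C * H t x * phi x + - 1 * ((damping sigma x)%:C * W t x * phi x)))); last first.
    by apply: eq_cintegral => x; rewrite /ZW; ring.
  rewrite cintegralD; last 2 first.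
  - exact: cintegrableZ.
  - by apply: cintegrableD => //; exact: cintegrableZ.
  rewrite cintegralD //; last exact: cintegrableZ.
  rewrite !cintegralZ //.
  apply/eqP; rewrite -subr_eq0 -EQ; apply/eqP; ring.
have [dH1 dH2] : weak_derivative (fun t x => complex.Re (H t x)) (fun t x => complex.Re (ZH t x)) /\
    weak_derivative (fun t x => complex.Im (H t x)) (fun t x => complex.Im (ZH t x)).
  have [thetat [dth Heq]] := sol_heat_eq sol.
  apply: (weak_derivative_parts rH dth) => t t0 phi sp.
  have := Heq t t0 (fourier phi) (schwartz_fourier sp).
  have [EH iH] := lapl theta H t phi rH lH t0 sp.
  have [EW iW] := lapl ut W t phi rW lW t0 sp.
  rewrite /dist_laplacian EH EW => EQ.
  transitivity (cintegral (fun x => - 1 * ((dot x x)%:C * H t x * phi x) +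
     - 1 * ((dot x x)%:C * W t x * phi x))); last first.
    by apply: eq_cintegral => x; rewrite /ZH; ring.
  rewrite cintegralD ?cintegralZ //; last 2 first.
  - exact: cintegrableZ.
  - exact: cintegrableZ.
  apply/eqP; rewrite -subr_eq0 -EQ; apply/eqP; ring.
have ZVre : (fun t x => complex.Re (ZV t x)) = fun t x => dot x x * complex.Re (W t x).
  by apply/funext => t; apply/funext => x; rewrite /ZV cReM Rec Imc; ring.
have ZVim : (fun t x => complex.Im (ZV t x)) = fun t x => dot x x * complex.Im (W t x).
  by apply/funext => t; apply/funext => x; rewrite /ZV cImM Rec Imc; ring.
have ZWre : (fun t x => complex.Re (ZW t x)) = fun t x => - dot x x * complex.Re (V t x) +
    dot x x * complex.Re (H t x) - damping sigma x * complex.Re (W t x).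
  apply/funext => t; apply/funext => x.
  by rewrite /ZW !(mulN1r, cReD, cReN, cReM, cImD, cImN, cImM, Rec, Imc); ring.
have ZWim : (fun t x => complex.Im (ZW t x)) = fun t x => - dot x x * complex.Im (V t x) +
    dot x x * complex.Im (H t x) - damping sigma x * complex.Im (W t x).
  apply/funext => t; apply/funext => x.
  by rewrite /ZW !(mulN1r, cReD, cReN, cReM, cImD, cImN, cImM, Rec, Imc); ring.
have ZHre : (fun t x => complex.Re (ZH t x)) = fun t x => - dot x x * complex.Re (H t x) -
    dot x x * complex.Re (W t x).
  apply/funext => t; apply/funext => x.
  by rewrite /ZH !(mulN1r, cReD, cReN, cReM, cImD, cImN, cImM, Rec, Imc); ring.
have ZHim : (fun t x => complex.Im (ZH t x)) = fun t x => - dot x x * complex.Im (H t x) -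
    dot x x * complex.Im (W t x).
  apply/funext => t; apply/funext => x.
  by rewrite /ZH !(mulN1r, cReD, cReN, cReM, cImD, cImN, cImM, Rec, Imc); ring.
rewrite ZVre in dV1; rewrite ZVim in dV2; rewrite ZWre in dW1; rewrite ZWim in dW2.
rewrite ZHre in dH1; rewrite ZHim in dH2.
move=> t t0.
(* The real and the imaginary parts solve the same real system; the two bounds add up. *)
have aeR := energy_decay sigma0 sigma2 tau0 tau1 tau2 pV1 pW1 pH1 dV1 dW1 dH1 t0.
have aeI := energy_decay sigma0 sigma2 tau0 tau1 tau2 pV2 pW2 pH2 dV2 dW2 dH2 t0.
apply: filterS2 aeR aeI => x hR hI; rewrite !normc_sq; lra.
Qed.

End solutions.

(** * Gevrey regularity *)

Section gevrey_regularity.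
Context {R : realType} {n : nat}.
Notation E := (Rn R n).
Notation mu := (lebesgue_Rn R n).
Notation C := (R[i]).

Lemma powR_le_expR (m delta : R) : 0 <= m -> 0 < delta ->
  exists2 K : R, 0 < K & forall z : R, 0 <= z -> z `^ m <= K * expR (delta * z).
Proof.
move=> m0 delta0; pose N := (Num.trunc m).+1.
have mN : m <= N%:R by exact: ltW (truncnS_gt m).
have N0 : 0 < N%:R :> R by rewrite ltr0n.
pose b := delta / N%:R; have b0 : 0 < b by rewrite divr_gt0.
have A0 : 0 < 1 + b^-1 by rewrite addr_gt0 ?invr_gt0.
(* 1 + z <= (1 + 1 / b) (1 + b z) <= (1 + 1 / b) exp(b z), raised to the power N >= m, with b N =
   delta. *)
exists ((1 + b^-1) ^+ N); first exact: exprn_gt0.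
move=> z z0; have z1 : 0 <= 1 + z by rewrite addr_ge0.
apply: (@le_trans _ _ ((1 + z) `^ m)); first by rewrite ge0_ler_powR ?nnegrE // lerDr.
apply: (@le_trans _ _ ((1 + z) `^ N%:R)); first by rewrite ler_powR // lerDl.
rewrite powR_mulrn //.
have -> : delta * z = N%:R * (b * z).
  by rewrite /b; field; rewrite gt_eqF.
rewrite expRM_natl -exprMn; apply: lerXn2r; rewrite ?nnegrE ?mulr_ge0 ?expR_ge0 ?(ltW A0) //.
apply: (@le_trans _ _ ((1 + b^-1) * (1 + b * z))); last first.
  by apply: ler_wpM2l; [exact: ltW|exact: expR_ge1Dx].
have -> : (1 + b^-1) * (1 + b * z) = 1 + z + (b^-1 + b * z) by field; rewrite gt_eqF.
by rewrite lerDl addr_ge0 ?mulr_ge0 ?invr_ge0 // ltW.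
Qed.

Lemma measurable_japanese : measurable_fun setT (@japanese R n).
Proof.
rewrite (_ : @japanese R n = (@powR R ^~ (2^-1)) \o (fun x => 1 + dot x x)); last first.
  by apply/funext => x /=; rewrite powR12_sqrt ?addr_ge0 ?dot_ge0 // /japanese enorm_sq.
apply: (measurableT_comp (measurable_powR _)).
by apply: measurable_funD => //; exact: measurable_dot_sq.
Qed.

Variable tau : R.
Hypotheses (tau0 : 0 < tau) (tau1 : tau <= 1).

(** The bracket is at most 2 or at most 2 |x|, according to whether |x| <= 1, and 2^tau <= 2. *)
Lemma japanese_powR_le (x : E) : japanese x `^ tau <= 2 * (1 + enorm x `^ tau).
Proof.
have r0 := enorm_ge0 x; have z0 := powR_ge0 (enorm x) tau.
have J0 : 0 <= japanese x by exact: sqrtr_ge0.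
have J2 : japanese x ^+ 2 = 1 + enorm x ^+ 2 by rewrite sqr_sqrtr // addr_ge0 ?sqr_ge0.
have t2 : (2 : R) `^ tau <= 2.
  by rewrite -[leRHS]powRr1 // ler_powR // ler1n.
have le y : 0 <= y -> 1 + enorm x ^+ 2 <= y ^+ 2 -> japanese x `^ tau <= y `^ tau.
  move=> y0 H; apply: ge0_ler_powR; rewrite ?nnegrE ?(ltW tau0) //.
  by rewrite -(@ler_pXn2r _ 2) ?nnegrE // J2.
have [r1|r1] := leP (enorm x) 1.
  apply: (@le_trans _ _ (2 `^ tau)); first by apply: le => //; nra.
  by lra.
apply: (@le_trans _ _ ((2 * enorm x) `^ tau)); first by apply: le; [rewrite mulr_ge0|nra].
by rewrite powRM //; have := ler_wpM2r z0 t2; lra.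
Qed.

Lemma gevrey_weight_bound (s t : R) : 0 <= s -> 0 < t -> exists c K : R, 0 < c /\
  forall x : E, (expR (c * japanese x `^ tau) * enorm x `^ s) ^+ 2 * expR (- (rate tau x * t)) <= K.
Proof.
move=> s0 t0.
have [K K0 HK] := @powR_le_expR (s * 2 / tau) (t / 256)
  (divr_ge0 (mulr_ge0 s0 (ler0n _ 2)) (ltW tau0)) (divr_gt0 t0 (ltr0n _ 256)).
(* With z = |x|^tau, the squared Gevrey weight has exponent at most t / 256 (1 + z) and |x|^(2 s)
   costs t / 256 z. Together the terms in z make t / 128 z, exactly what the rate provides. *)
exists (t / 1024), (K * expR (t / 256)); split; first by lra.
move=> x.
pose z := enorm x `^ tau; have z0 : 0 <= z := powR_ge0 _ _.
have E1 : (enorm x `^ s) ^+ 2 = z `^ (s * 2 / tau).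
  rewrite -powR_mulrn ?powR_ge0 // -!powRrM; congr (_ `^ _).
  by field; rewrite gt_eqF.
rewrite exprMn E1 expr2 -expRD.
apply: (@le_trans _ _ (expR (t / 1024 * japanese x `^ tau + t / 1024 * japanese x `^ tau) *
    (K * expR (t / 256 * z)) * expR (- (rate tau x * t)))).
  by apply: ler_wpM2r; [exact: expR_ge0|apply: ler_wpM2l; [exact: expR_ge0|exact: HK]].
rewrite [X in X * _]mulrCA -[leLHS]mulrA; apply: ler_wpM2l; first exact: ltW.
rewrite -!expRD ler_expR /rate -/z.
have := ler_wpM2l (ltW t0) (japanese_powR_le x); rewrite -/z; lra.
Qed.

Variables (X : E -> C) (g : E -> R) (M t : R).
Hypotheses (lX : L2 X) (ig : mu.-integrable setT (EFin \o g)).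
Hypothesis decay : {ae mu, forall x, normc (X x) ^+ 2 <= M * expR (- (rate tau x * t)) * g x}.

(** The exponential in the bound on X absorbs a^2, which leaves a multiple of the integrable g. *)
Lemma weighted_L2 (a : E -> R) (K : R) : measurable_fun setT a ->
  (forall x, a x ^+ 2 * expR (- (rate tau x * t)) <= K) -> L2 (fun x => (a x)%:C * X x).
Proof.
move=> ma aK; have [mX1 mX2] := L2_cmeasurable lX.
have ibound : mu.-integrable setT (fun x => (`|K| * `|M|)%:E * (g x)%:E)%E by exact: integrableZl.
have mg : measurable_fun setT g by apply/measurable_EFinP; case/integrableP: ig.
have key (y : E -> R) : measurable_fun setT y -> (forall x, y x ^+ 2 <= normc (X x) ^+ 2) ->
    l2 mu (fun x => a x * y x).
  move=> my yX; split; first exact: measurable_funM.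
  have mm : measurable_fun setT (EFin \o (fun x => (a x * y x) ^+ 2)).
    by apply/measurable_EFinP; apply: measurable_funX; exact: measurable_funM.
  apply/integrableP; split => //.
  have /integrableP[mb] := ibound; apply: le_lt_trans.
  apply: ae_ge0_le_integral => //.
  - exact: measurableT_comp.
  - exact: measurableT_comp.
  apply: filterS decay => x Hx _.
  have e0 := expR_ge0 (- (rate tau x * t)); have a0 := sqr_ge0 (a x).
  rewrite /= lee_fin ger0_norm ?sqr_ge0 // exprMn !normrM !normr_id.
  apply: (@le_trans _ _ (a x ^+ 2 * (M * expR (- (rate tau x * t)) * g x))).
    by apply: ler_wpM2l => //; apply: le_trans Hx.
  apply: (le_trans (ler_norm _)).
  rewrite normrM (ger0_norm a0) !normrM (ger0_norm e0).
  rewrite (_ : _ * (_ * _ * _) = a x ^+ 2 * expR (- (rate tau x * t)) * (`|M| * `|g x|)); last by ring.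
  rewrite -[leRHS]mulrA; apply: ler_wpM2r; first by rewrite mulr_ge0.
  exact: le_trans (aK x) (ler_norm K).
apply/L2P; split.
  rewrite (_ : (fun x => _) = fun x => a x * complex.Re (X x)).
    by apply: key => // x; rewrite normc_sq lerDl sqr_ge0.
  by apply/funext => x; rewrite cReM Rec Imc mul0r subr0.
rewrite (_ : (fun x => _) = fun x => a x * complex.Im (X x)).
  by apply: key => // x; rewrite normc_sq lerDr sqr_ge0.
by apply/funext => x; rewrite cImM Rec Imc mul0r addr0.
Qed.

Lemma gevrey_of_decay (s kappa : R) (T : distribution_Rn R n) : 0 <= s -> 0 < t ->
  kappa^-1 = tau ->
  (forall phi, schwartz phi -> T (fourier phi) = cintegral (fun x => X x * phi x)) ->
  absD_in_gevrey s kappa T.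
Proof.
move=> s0 t0 kE TX.
have [c [K [c0 HK]]] := gevrey_weight_bound s0 t0.
have ms : measurable_fun setT (fun x : E => enorm x `^ s).
  exact: measurableT_comp (measurable_powR _) (@measurable_enorm R n).
have mJ : measurable_fun setT (fun x : E => expR (c * japanese x `^ tau)).
  apply: (measurableT_comp (@measurable_expR R)); apply: measurable_funM => //.
  exact: measurableT_comp (measurable_powR _) measurable_japanese.
pose h (x : E) : C := (enorm x `^ s)%:C * X x.
have lh : L2 h.
  (* The Gevrey weight is at least 1, so the bound with the weight implies the one without. *)
  apply: (weighted_L2 ms) => x; apply: le_trans (HK x).
  apply: ler_wpM2r; first exact: expR_ge0.
  rewrite exprMn; apply: ler_peMl; first exact: sqr_ge0.
  apply: exprn_ege1; apply: le_trans (expR_ge1Dx _).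
  by rewrite lerDl mulr_ge0 ?powR_ge0 // ltW.
(* The Gevrey function is the inverse transform of |xi|^s X; the distribution |D|^s T is identified
   with it on the Fourier side. *)
have [v lv Hv] := inverse_fourier_of_L2 lh.
have Fv : is_fourier (dist_of v) h by split; [exact: L2_tempered_fun|exact: Hv].
exists v; split; last first.
  by exists X; split => //; split; [exact: L2_tempered_fun|exact: TX].
split=> //; exists c => //.
exists h; split => //; rewrite kE.
rewrite (_ : (fun x => _) = fun x => (expR (c * japanese x `^ tau) * enorm x `^ s)%:C * X x).
  by apply: weighted_L2 HK; exact: measurable_funM.
by apply/funext => x; rewrite /h rmorphM mulrA.
Qed.

End gevrey_regularity.

(** 1 / kappa is the minimum of 1 and 4 - 2 sigma, the two branches meeting at sigma = 3 / 2; these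
    are the conditions that the decay rate imposes on tau. *)
Lemma gevrey_index_inv (R : realType) (sigma : R) : sigma < 2 ->
  [/\ 0 < (gevrey_index sigma)^-1, (gevrey_index sigma)^-1 <= 1 &
      (gevrey_index sigma)^-1 <= 4 - 2 * sigma].
Proof.
by move=> s2; rewrite /gevrey_index; have [s3|s3] := leP sigma (3 / 2); rewrite ?invr1 ?invrK; split; lra.
Qed.

Theorem theorem3p1 (R : realType) (n : nat) (n_ge1 : (1 <= n)%N)
    (sigma s : R) (sigma_ge0 : 0 <= sigma) (sigma_lt2 : sigma < 2)
    (s_ge0 : 0 <= s)
    (u0 : distribution_Rn R n) (u1 theta0 : Rn R n -> R[i])
    (u0_tempered : tempered u0) (u0_L2 : in_L2 (dist_absD2 u0))
    (u1_L2 : L2 u1) (theta0_L2 : L2 theta0)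
    (u ut theta : R -> distribution_Rn R n)
    (sol : cauchy_solution sigma u0 u1 theta0 u ut theta)
    (t : R) (t_gt0 : 0 < t) :
  let kappa := gevrey_index sigma in
  [/\ absD_in_gevrey s kappa (dist_absD2 (u t)),
      absD_in_gevrey s kappa (ut t) &
      absD_in_gevrey s kappa (theta t)].
Proof.
move=> kappa; have [k0 k1 k2] := gevrey_index_inv sigma_lt2.
have [V [W [H [lVWH rV rW rH dec]]]] :=
  cauchy_solution_decay sigma_ge0 sigma_lt2 sol (ltW k0) k1 k2.
have [lV lW lH] := lVWH t (ltW t_gt0); have [lV0 lW0 lH0] := lVWH 0 (lexx 0).
pose g x := normc (V 0 x) ^+ 2 + normc (W 0 x) ^+ 2 + normc (H 0 x) ^+ 2.
have i2 (f : Rn R n -> R[i]) : L2 f ->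
    (lebesgue_Rn R n).-integrable setT (EFin \o (fun x => normc (f x) ^+ 2)).
  move=> /L2P[[_ i1] [_ i2]].
  rewrite (_ : _ \o _ = fun x => ((complex.Re (f x) ^+ 2)%:E + (complex.Im (f x) ^+ 2)%:E)%E).
    exact: integrableD.
  by apply/funext => x /=; rewrite normc_sq.
have ig : (lebesgue_Rn R n).-integrable setT (EFin \o g).
  rewrite (_ : _ \o _ = fun x => ((normc (V 0 x) ^+ 2)%:E + (normc (W 0 x) ^+ 2)%:E +
    (normc (H 0 x) ^+ 2)%:E)%E) //.
  by apply: integrableD => //; [apply: integrableD => //|]; exact: i2.
have D := dec t t_gt0.
pose M := 4 * expR (2 * t).
have sq (f : Rn R n -> R[i]) x : 0 <= normc (f x) ^+ 2 by exact: sqr_ge0.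
split.
- have D' : {ae lebesgue_Rn R n, forall x, normc (V t x) ^+ 2 <= M * expR (- (rate kappa^-1 x * t)) * g x}.
    by apply: filterS D => x /(le_trans _); apply; have := sq (W t) x; have := sq (H t) x; lra.
  exact: (gevrey_of_decay k0 k1 lV ig D' s_ge0 t_gt0 erefl (rV t (ltW t_gt0))).
- have D' : {ae lebesgue_Rn R n, forall x, normc (W t x) ^+ 2 <= M * expR (- (rate kappa^-1 x * t)) * g x}.
    by apply: filterS D => x /(le_trans _); apply; have := sq (V t) x; have := sq (H t) x; lra.
  exact: (gevrey_of_decay k0 k1 lW ig D' s_ge0 t_gt0 erefl (rW t (ltW t_gt0))).
- have D' : {ae lebesgue_Rn R n, forall x, normc (H t x) ^+ 2 <= M * expR (- (rate kappa^-1 x * t)) * g x}.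
    by apply: filterS D => x /(le_trans _); apply; have := sq (V t) x; have := sq (W t) x; lra.
  exact: (gevrey_of_decay k0 k1 lH ig D' s_ge0 t_gt0 erefl (rH t (ltW t_gt0))).
Qed.
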